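(* Let $\beta\in B$, and let $h\colon Z\to[0,+\infty)$ be $\mathcal Z$-measurable with $h(z)>0$ whenever $\beta'_+(z,0)=-\infty$, $z\in Z$. For every $a\in\mathrm{dom}(J_{[\beta h]})$: (i) the $(F(a),[\beta h])$-dual value is attained and $J_{[\beta h]}(a)=\omega_{F(a),[\beta h]}+K^*_{F(a),[\beta h]}(a)$; (ii) the Bregman projection $g_{[\beta h],a}$ of $h$ to $\mathcal G_a$ exists if and only if the moment vector of the effective $(F(a),[\beta h])$-dual solution $g^*_{F(a),[\beta h],a}$ exists and equals $a$, in which case $g_{[\beta h],a}=g^*_{F(a),[\beta h],a}$; (iii) the generalized Bregman projection $\hat g_{[\beta h],a}$ of $h$ to $\mathcal G_a$ exists and equals $g^*_{F(a),[\beta h],a}$. (Equalities of functions are $\mu$-a.e.)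
   Context: Setting. $(Z,\mathcal Z)$ is a measurable space with a $\sigma$-finite measure $\mu$, and $\varphi\colon Z\to\mathbb R^d$ is $\mathcal Z$-measurable (the moment mapping). $\Gamma$ is the class of functions $\gamma\colon\mathbb R\to(-\infty,+\infty]$ that are finite and strictly convex on $(0,+\infty)$, equal to $+\infty$ for $t<0$, and satisfy $\gamma(0)=\lim_{t\downarrow0}\gamma(t)$. For $\gamma\in\Gamma$, $\gamma'_\pm(t)$ are the right/left derivatives at $t>0$, $\gamma'_-(0)=-\infty$, $\gamma'_+(0)=\lim_{t\downarrow0}\gamma'_+(t)$. $B$ is the class of functions $\beta\colon Z\times\mathbb R\to(-\infty,+\infty]$ such that $\beta(\cdot,t)$ is $\mathcal Z$-measurable for each $t$ and $\beta(z,\cdot)\in\Gamma$ for each $z$. $\mathrm{sgn}(r)$ is the symbol $+$ if $r\ge0$ and $-$ if $r<0$. Convention: an integral whose positive and negative parts are both infinite equals $+\infty$. Bregman distance. For $\gamma\in\Gamma$ and $s,t\ge0$ let $\Delta_\gamma(s,t)=\gamma(s)-\gamma(t)-\gamma'_{\mathrm{sgn}(s-t)}(t)[s-t]$ if $\gamma'_+(t)$ is finite, and $\Delta_\gamma(s,0)=s\cdot(+\infty)$ otherwise (with $0\cdot\infty=0$); $\Delta_\gamma(s,t)=+\infty$ if $s<0$ or $t<0$. For $\mathcal Z$-measurable $g,h$: $B_\beta(g,h)=\int_Z\Delta_{\beta(z,\cdot)}(g(z),h(z))\,\mu(dz)$. For $h$ as in the claim, $[\beta h](z,t)=\Delta_{\beta(z,\cdot)}(t,h(z))$;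 then $[\beta h]\in B$. $\mathcal G$ is the linear space of $\mathcal Z$-measurable $g\colon Z\to\mathbb R$ with $\varphi g$ $\mu$-integrable (then $\int_Z\varphi g\,d\mu$ is the moment vector of $g$); $\mathcal G_a=\{g\in\mathcal G\colon\int_Z\varphi g\,d\mu=a\}$; the superscript $+$ denotes the subset of nonnegative functions. $J_{[\beta h]}(a)=\inf_{g\in\mathcal G_a^+}B_\beta(g,h)\in[0,+\infty]$ ($\inf\emptyset=+\infty$), $\mathrm{dom}(J_{[\beta h]})=\{a\in\mathbb R^d\colon J_{[\beta h]}(a)<+\infty\}$. For $a\in\mathrm{dom}(J_{[\beta h]})$, the Bregman projection $g_{[\beta h],a}$ of $h$ to $\mathcal G_a$ is the ($\mu$-a.e. unique) minimizer of $B_\beta(\cdot,h)$ over $\mathcal G_a^+$, if it exists. If all sequences $g_n\in\mathcal G_a^+$ with $B_\beta(g_n,h)\to J_{[\beta h]}(a)$ converge locally in measure to a common measurable function, this limit is the generalized Bregman projection $\hat g_{[\beta h],a}$; convergence $g_n\to g$ locally in measure means $\mu(Y\cap\{|g_n-g|>\varepsilon\})\to0$ for all $Y\in\mathcal Z$ with $\mu(Y)<\infty$ and all $\varepsilon>0$. Faces. $\mathrm{cn}_\varphi(\mu)=\{\int_Z\varphi g\,d\mu\colon g\in\mathcal G^+\}$. A face of a convex set $C\subseteq\mathbb R^d$ is a nonempty convex $F\subseteq C$ such that every closed line segment in $C$ with a relative interior point in $F$ lies in $F$. For $a\in\mathrm{cn}_\varphi(\mu)$, $F(a)$ is the unique face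 of $\mathrm{cn}_\varphi(\mu)$ whose relative interior contains $a$. $\mathrm{cl}$ is closure. $(F,[\beta h])$-dual problem. Write $\beta_h=[\beta h]$ and $\beta_h^*(z,r)=\sup_t[rt-\beta_h(z,t)]$, with derivative $(\beta_h^* )'$ in $r$. For a face $F$ of $\mathrm{cn}_\varphi(\mu)$: $\omega_{F,[\beta h]}=\int_{\{\varphi\notin\mathrm{cl}(F)\}}\beta_h(z,0)\,\mu(dz)$; $K_{F,[\beta h]}(\vartheta)=\int_{\{\varphi\in\mathrm{cl}(F)\}}\beta_h^*(z,\langle\vartheta,\varphi(z)\rangle)\,\mu(dz)$; the $(F,[\beta h])$-dual value for $a$ is $K^*_{F,[\beta h]}(a)=\sup_{\vartheta\in\mathbb R^d}[\langle\vartheta,a\rangle-K_{F,[\beta h]}(\vartheta)]$, and if it is finite its maximizers are the $(F,[\beta h])$-dual solutions for $a$. $\Theta_{F,[\beta h]}$ is the set of $\vartheta$ with $K_{F,[\beta h]}(\vartheta)<+\infty$ such that for $\mu$-a.a. $z$ with $\varphi(z)\in\mathrm{cl}(F)$ the function $\beta_h^*(z,\cdot)$ is finite in a neighborhood of $\langle\vartheta,\varphi(z)\rangle$; it always contains $0$. Each $(F,[\beta h])$-dual solution $\vartheta$ for $a$ belongs to $\Theta_{F,[\beta h]}$, and all of them give $\mu$-a.e. the same function equal to $(\beta_h^* )'(z,\langle\vartheta,\varphi(z)\rangle)$ if $\varphi(z)\in\mathrm{cl}(F)$ and the derivative exists, and to $0$ otherwise; this is the effective $(F,[\beta h])$-dual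 solution $g^*_{F,[\beta h],a}$. *)

(* Defs.v *)
From HB Require Import structures.
From mathcomp Require Import all_boot all_order all_algebra.
From mathcomp Require Import all_classical all_reals all_analysis measurable_realfun.
Set Implicit Arguments.
Unset Strict Implicit.
Unset Printing Implicit Defensive.
Import Order.TTheory GRing.Theory Num.Theory.
Import numFieldNormedType.Exports.
Local Open Scope classical_set_scope.
Local Open Scope ring_scope.

Section integrand_class.
Context {R : realType}.
Implicit Type gamma : R -> \bar R.

Definition strictly_convex_pos gamma :=
  forall s t l : R, 0 < s -> 0 < t -> s != t -> 0 < l < 1 ->
    (gamma (l * s + (1 - l) * t)%R < l%:E * gamma s + (1 - l)%:E * gamma t)%E.

Definition in_Gamma gamma :=
  [/\ forall t, gamma t != -oo%E,
      forall t, 0 < t -> gamma t \is a fin_num,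
      strictly_convex_pos gamma,
      forall t, t < 0 -> gamma t = +oo%E
    & gamma t @[t --> 0^'+] --> gamma 0].

Definition diff_quot gamma (t e : R) : \bar R :=
  ((gamma (t + e)%R - gamma t) * (e^-1)%:E)%E.

(* Only meaningful for [0 <= t]; at [t = 0] it is the limit of the right
   derivatives and may be [-oo]. *)
Definition right_deriv gamma (t : R) : \bar R :=
  if 0 < t then lim (diff_quot gamma t e @[e --> 0^'+])
  else lim (lim (diff_quot gamma u e @[e --> 0^'+]) @[u --> 0^'+]).

Definition left_deriv gamma (t : R) : \bar R :=
  if 0 < t then lim (diff_quot gamma t e @[e --> 0^'-]) else -oo%E.

(* gamma'_{sgn r}(t), with sgn 0 = + *)
Definition sgn_deriv gamma (r t : R) : \bar R :=
  if 0 <= r then right_deriv gamma t else left_deriv gamma t.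

(* For [in_Gamma gamma] and [0 <= t], the last branch is reached only at
   [t = 0]; note that [0%:E * +oo = 0] in MathComp-Analysis. *)
Definition bregman_delta gamma (s t : R) : \bar R :=
  if (s < 0) || (t < 0) then +oo%E
  else if right_deriv gamma t \is a fin_num then
    (gamma s - gamma t - sgn_deriv gamma (s - t) t * (s - t)%:E)%E
  else (s%:E * +oo)%E.

Definition conjugate gamma (r : R) : \bar R :=
  ereal_sup [set ((r * t)%:E - gamma t)%E | t in [set: R]].

(* Differentiability of an extended-real function requires finiteness in a
   neighbourhood, since [fine] sends infinite values to 0. *)
Definition ederivable (f : R -> \bar R) (r : R) :=
  (\forall s \near r, f s \is a fin_num) /\ derivable (fine \o f) r 1.

Definition ederiv (f : R -> \bar R) (r : R) : R := derive1 (fine \o f) r.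

End integrand_class.

Section convex_geometry.
Context {R : realType} {d : nat}.
Local Notation V := 'rV[R]_d.
Implicit Types (C F : set V) (x y a theta : V).

Definition dotp x y : R := \sum_(i < d) x 0 i * y 0 i.

Definition segment_point x y (t : R) : V := (1 - t) *: x + t *: y.
Definition closed_segment x y : set V :=
  [set segment_point x y t | t in [set t : R | 0 <= t <= 1]].
(* The singleton {x} when [x = y], as the relative interior of a point is itself. *)
Definition open_segment x y : set V :=
  [set segment_point x y t | t in [set t : R | 0 < t < 1]].

Definition affine_hull C : set V :=
  [set x | exists n (p : 'I_n -> V) (c : 'I_n -> R),
    [/\ forall i, C (p i), \sum_(i < n) c i = 1
      & x = \sum_(i < n) c i *: p i]].

Definition relint C : set V :=
  [set x | C x /\ \forall y \near x, affine_hull C y -> C y].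

Definition is_face C F :=
  [/\ F !=set0, convex_set (F : set (convex_lmodType V)), F `<=` C
    & forall x y, closed_segment x y `<=` C ->
        (open_segment x y `&` F) !=set0 -> closed_segment x y `<=` F].

Definition face_at C a : set V :=
  xget set0 [set F | is_face C F /\ relint F a].

End convex_geometry.

Section bregman.
Context {disp : measure_display} {Z : measurableType disp} {R : realType}.
Variable mu : {sigma_finite_measure set Z -> \bar R}.
Context {d : nat}.
Variable phi : Z -> 'rV[R]_d.
Implicit Types (beta : Z -> R -> \bar R) (g h : Z -> R) (a theta : 'rV[R]_d).
Implicit Types (F : set 'rV[R]_d).

Definition in_B beta :=
  (forall t, measurable_fun [set: Z] (beta ^~ t)) /\
  (forall z, in_Gamma (beta z)).

(* The library's integral of a function whose positive and negative parts both
   have infinite integral is [-oo]; here it is [+oo]. *)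
Definition cintegral (D : set Z) (f : Z -> \bar R) : \bar R :=
  if (\int[mu]_(z in D) (f^\+ z) == +oo)%E then +oo%E
  else (\int[mu]_(z in D) f z)%E.

Definition bregman_distance beta g h : \bar R :=
  cintegral setT (fun z => bregman_delta (beta z) (g z) (h z)).

Definition bregman_integrand beta h : Z -> R -> \bar R :=
  fun z t => bregman_delta (beta z) t (h z).

Definition momentG : set (Z -> R) :=
  [set g | measurable_fun setT g /\
    forall i, mu.-integrable setT (fun z => (phi z 0 i * g z)%:E)].

Definition moment g : 'rV[R]_d := \row_i \int[mu]_z (phi z 0 i * g z).

Definition momentGa a : set (Z -> R) := [set g | momentG g /\ moment g = a].

Definition nonneg_fun : set (Z -> R) := [set g | forall z, 0 <= g z].

Definition cn : set 'rV[R]_d :=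
  [set moment g | g in momentG `&` nonneg_fun].

Definition Jval beta h a : \bar R :=
  ereal_inf [set bregman_distance beta g h | g in momentGa a `&` nonneg_fun].

Definition domJ beta h : set 'rV[R]_d := [set a | (Jval beta h a < +oo)%E].

Definition is_bregman_projection beta h a g :=
  (momentGa a `&` nonneg_fun) g /\
  forall g', (momentGa a `&` nonneg_fun) g' ->
    (bregman_distance beta g h <= bregman_distance beta g' h)%E.

Definition cvg_locally_in_measure (g_ : nat -> Z -> R) (g : Z -> R) :=
  forall (Y : set Z) (e : R), measurable Y -> (mu Y < +oo)%E -> 0 < e ->
    mu (Y `&` [set z | `|g_ n z - g z| > e]) @[n --> \oo] --> 0%E.

Definition is_generalized_bregman_projection beta h a g :=
  measurable_fun setT g /\
  forall g_ : nat -> Z -> R,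
    (forall n, (momentGa a `&` nonneg_fun) (g_ n)) ->
    bregman_distance beta (g_ n) h @[n --> \oo] --> Jval beta h a ->
    cvg_locally_in_measure g_ g.

(* In the dual problem below, [beta] stands for any integrand of class B. *)

Definition in_cl F : set Z := [set z | closure F (phi z)].

Definition omega F beta : \bar R := cintegral (~` in_cl F) (fun z => beta z 0).

Definition Kfun F beta theta : \bar R :=
  cintegral (in_cl F) (fun z => conjugate (beta z) (dotp theta (phi z))).

Definition dual_obj F beta a theta : \bar R :=
  ((dotp theta a)%:E - Kfun F beta theta)%E.

Definition dual_value F beta a : \bar R :=
  ereal_sup [set dual_obj F beta a theta | theta in [set: 'rV[R]_d]].

Definition is_dual_solution F beta a theta :=
  dual_value F beta a \is a fin_num /\
  dual_obj F beta a theta = dual_value F beta a.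

Definition dual_fun F beta theta : Z -> R := fun z =>
  if `[< in_cl F z /\ ederivable (conjugate (beta z)) (dotp theta (phi z)) >]
  then ederiv (conjugate (beta z)) (dotp theta (phi z)) else 0.

(* The common mu-a.e. value of [dual_fun F beta theta] over all dual solutions
   theta; it is determined up to mu-a.e. equality. *)
Definition is_effective_dual_solution F beta a g :=
  [/\ measurable_fun setT g,
      exists theta, is_dual_solution F beta a theta
    & forall theta, is_dual_solution F beta a theta ->
        g = dual_fun F beta theta %[ae mu]].

End bregman.

(* Main.v *)
(** Proof idea.  The integrand [f z t = Delta_(beta z) (t, h z)] is nonnegative,
    belongs to [Gamma] and is coercive in [t].  Feasible functions vanish a.e.
    where [phi] is outside the closure of the face [F] of [a], so the primal
    value is the constant [omega] plus the value of the problem restricted to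
    [phi \in cl F].  The point of coordinates [a] and that value is separated
    from the convex set of pairs (moment of [g], number above the energy of
    [g]).  The separating functional is not vertical: otherwise modifying one
    feasible [g0] on small sets forces [<theta, phi> >= 0] and
    [<theta, phi> g0 = 0] a.e. on [cl F], so that [theta] supports [F] at [a],
    which contradicts [a \in ri F].  Modifying [g0] towards the pointwise
    maximizers of [<theta, phi> t - f z t] turns the inequality over all [g]
    into a bound on the integral of the conjugate, and [theta] is dual optimal.

    Given a dual solution [theta], the integral of the nonnegative Fenchel gap
    [f (g) + f^* (<theta, phi>) - <theta, phi> g] over [cl F] is the excess of
    the energy of [g] over the primal value.  Along a fast minimizing sequence
    the gaps are summable, hence tend to 0 a.e.; coercivity yields a maximizer
    in the definition of [f^* (<theta, phi>)] and strict convexity makes the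
    sequence converge to it, i.e. to [(f^* )' (<theta, phi>)]. *)
Require Import Defs.
From mathcomp Require Import all_boot all_order all_algebra.
From mathcomp Require Import all_classical all_reals all_analysis measurable_realfun.
From mathcomp Require Import finmap ring lra.
Import Order.TTheory GRing.Theory Num.Theory.
Import numFieldNormedType.Exports.
Local Open Scope classical_set_scope.
Local Open Scope ring_scope.

Set Implicit Arguments.
Unset Strict Implicit.
Unset Printing Implicit Defensive.

(** * Functions of the class Gamma *)

(** Neither the moment cone nor the convex set that is separated need be closed or have interior
    points. The separation is therefore only proper, and this suffices because [a] is an interior
    point of its face relative to the span of that face. The separating functional is tested with
    functions that differ from one feasible function only on sets of finite measure where all data
    are bounded: this guarantees a moment and a finite energy, and monotone convergence removes the
    bounds afterwards.

    A vanishing Fenchel gap does not by itself make a sequence converge: at an end point of the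
    domain of the conjugate the sequence may run to infinity. Fatou's lemma applied to the energies
    supplies, for almost every point, a subsequence of bounded energy on which coercivity can act.
    The maximizer found in this way makes the conjugate finite near the point and differentiable
    there, so dual solutions need no separate study of their domain. The same limits provide a
    measurable version of the effective dual solution. *)

Lemma chord_lipschitz {R : realType} (d D cs ct cp cm : R) : 0 < d -> 0 <= D ->
  d * cs <= D * cm + (d - D) * ct -> (D + d) * ct <= d * cs + D * cp ->
  `|ct - cs| * d <= D * (`|cp - ct| + `|ct - cm|).
Proof.
(* For a convex function with values [cm], [cs], [ct], [cp] at [t - d], [t - D], [t], [t + d], the
   hypotheses are two chord inequalities cleared of denominators. The mirror image exchanges [cm]
   and [cp]. *)
move=> d0 D0 h1 h2.
rewrite -[X in _ * X](gtr0_norm d0) -normrM ler_norml.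
have k1 := ler_wpM2l D0 (ler_norm (cp - ct)).
have k2 : D * (ct - cm) >= - (D * `|ct - cm|).
  by rewrite -mulrN ler_wpM2l// lerNl -normrN ler_norm.
have k3 : 0 <= D * `|cp - ct| by rewrite mulr_ge0.
have k4 : 0 <= D * `|ct - cm| by rewrite mulr_ge0.
by move: k1 k2 k3 k4; set C1 := `|cp - ct|; set C2 := `|_| => *; apply/andP; split; lra.
Qed.

Lemma near_dist_lt {R : realType} (t e : R) : 0 < e ->
  \forall s \near t, `|t - s| < e.
Proof. by move=> e0; apply/nbhs_ballP; exists e. Qed.

Section strictly_convex.
Context {R : realType}.
Variable f : R -> \bar R.
Hypothesis fG : in_Gamma f.
Implicit Types r s t u w x y z e : R.
Local Notation c := (fine \o f).

Lemma Gamma_pos_fin t : 0 < t -> f t \is a fin_num.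
Proof. by case: fG => _ + _ _ _; exact. Qed.

Lemma Gamma_fin_ge0 t : f t \is a fin_num -> 0 <= t.
Proof.
by case: fG => _ _ _ fN _; rewrite leNgt; apply: contraTN => /fN ->.
Qed.

Let chord_pos x y z : 0 < x -> x < y -> y < z ->
  (z - x) * c y < (z - y) * c x + (y - x) * c z.
Proof.
move=> x0 xy yz; case: fG => _ _ sc _ _.
have xz := lt_trans xy yz.
have y0 := lt_trans x0 xy; have z0 := lt_trans y0 yz.
have zx0 : 0 < z - x by rewrite subr_gt0.
have l01 : 0 < (z - y) / (z - x) < 1.
  by rewrite divr_gt0 ?subr_gt0//= ltr_pdivrMr// mul1r ltrD2l ltrN2.
have := sc x z _ x0 z0 (negbT (lt_eqF xz)) l01.
have -> : (z - y) / (z - x) * x + (1 - (z - y) / (z - x)) * z = y.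
  by field; rewrite gt_eqF.
rewrite -(fineK (Gamma_pos_fin x0)) -(fineK (Gamma_pos_fin y0)).
rewrite -(fineK (Gamma_pos_fin z0)) -!EFinM -EFinD lte_fin -/(c x) -/(c y) -/(c z).
rewrite -(ltr_pM2l zx0) => /lt_le_trans; apply.
rewrite le_eqVlt; apply/orP; left; apply/eqP; rewrite /=; field; by rewrite gt_eqF.
Qed.

Let cvg0 : f 0 \is a fin_num -> c t @[t --> 0^'+] --> c 0.
Proof.
move=> f0; case: fG => _ _ _ _ /=.
by rewrite -(fineK f0) => /fine_cvg.
Qed.

(** The left end may be 0, where strict convexity is not part of the definition. The limit at 0
    gives only a weak inequality, used at [0 < y / 2 < z]; strictness comes back from the points
    [y / 2 < y < z]. *)
Lemma Gamma_chord x y z : f x \is a fin_num -> x < y -> y < z ->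
  (z - x) * c y < (z - y) * c x + (y - x) * c z.
Proof.
move=> fx xy yz; have := Gamma_fin_ge0 fx.
rewrite le_eqVlt => /predU1P[x0|x0]; last exact: chord_pos.
subst x; have z0 := lt_trans xy yz.
have weak w : 0 < w -> w < z -> z * c w <= (z - w) * c 0 + w * c z.
  move=> w0 wz; rewrite -subr_le0.
  have cvgl : (z - t) * c w - ((z - w) * c t + (w - t) * c z) @[t --> 0^'+] -->
      (z - 0) * c w - ((z - w) * c 0 + (w - 0) * c z).
    have idc : t @[t --> (0:R)^'+] --> (0:R) by exact/cvg_at_right_filter/cvg_id.
    apply: cvgB; first by apply: cvgMl; apply: cvgB => //; exact: cvg_cst.
    apply: cvgD; first by apply: cvgMr; exact: cvg0.
    by apply: cvgMl; apply: cvgB => //; exact: cvg_cst.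
  rewrite !subr0 in cvgl.
  apply: (cvgr_to_le cvgl).
  by near=> t; rewrite subr_le0; apply/ltW/chord_pos.
have y20 : 0 < y / 2 by rewrite divr_gt0.
have y2z : y / 2 < z by lra.
have h1 := chord_pos y20 (_ : y / 2 < y) yz.
have h2 := weak _ y20 y2z.
have {h1} h1 := h1 ltac:(lra).
have zy : 0 < z - y / 2 by rewrite subr_gt0.
rewrite -(ltr_pM2l zy) !subr0.
rewrite -(ltr_pM2l z0) in h1.
rewrite -(ler_pM2l (_ : 0 < z - y)) ?subr_gt0// in h2.
by nra.
Unshelve. all: by end_near. Qed.

Lemma Gamma_continuous_pos t : 0 < t -> f s @[s --> t] --> f t.
Proof.
move=> t0; have ft := Gamma_pos_fin t0.
rewrite -(fineK ft); apply/fine_cvgP; split.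
  near=> s; apply: Gamma_pos_fin; near: s; exact: lt_nbhsr.
have t20 : 0 < t / 2 by rewrite divr_gt0.
pose K := `|c (t + t / 2) - c t| + `|c t - c (t / 2)|.
have K0 : 0 <= K by rewrite addr_ge0.
apply/cvgrPdist_le => e e0.
near=> s.
have sd : `|t - s| < t / 2.
  by near: s; apply: near_dist_lt.
have sK : `|t - s| * K <= e * (t / 2).
  have : `|t - s| < e * (t / 2) / (K + 1).
    near: s; apply: near_dist_lt.
    by rewrite divr_gt0 ?mulr_gt0// ltr_wpDl.
  rewrite ltr_pdivlMr ?ltr_wpDl// => /ltW; apply: le_trans.
  by rewrite ler_wpM2l// lerDl.
move: sd; rewrite ltr_norml => /andP[sd1 sd2].
have s0 : 0 < s by lra.
rewrite -(ler_pM2r t20); apply: le_trans sK.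
have [st|ts|<-] := ltgtP s t; last by rewrite !subrr !normr0 !mul0r.
- rewrite (gtr0_norm (_ : 0 < t - s)) ?subr_gt0//.
  have h1 := chord_pos t20 (_ : t / 2 < s) st.
  have {}h1 := h1 ltac:(lra).
  have h2 := chord_pos s0 st (_ : t < t + t / 2).
  have {}h2 := h2 ltac:(lra).
  by rewrite /K; apply: chord_lipschitz => //; [lra|move: h1 => /=; lra|move: h2 => /=; lra].
- rewrite (distrC t s) (gtr0_norm (_ : 0 < s - t)) ?subr_gt0//.
  have h1 := chord_pos t20 (_ : t / 2 < t) ts.
  have {}h1 := h1 ltac:(lra).
  have h2 := chord_pos t0 ts (_ : s < t + t / 2).
  have {}h2 := h2 ltac:(lra).
  rewrite /K [X in _ <= _ * X]addrC (distrC (c t) (c (t / 2))) (distrC (c (t + t / 2))).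
  by apply: chord_lipschitz => //; [lra|move: h2 => /=; lra|move: h1 => /=; lra].
Unshelve. all: by end_near. Qed.

Lemma Gamma_right_continuous t : 0 <= t -> f s @[s --> t^'+] --> f t.
Proof.
rewrite le_eqVlt => /predU1P[<-|t0]; first by case: fG.
by apply: cvg_at_right_filter; exact: Gamma_continuous_pos.
Qed.

Lemma Gamma_lsc : lower_semicontinuous f.
Proof.
case: (fG) => fNy _ _ fneg _ t y yft.
have [t0|t0|t0] := ltgtP t 0.
- exists [set s | s < 0]; first exact: lt_nbhsl.
  by move=> s /= /fneg ->; rewrite ltry.
- exists [set s | (y%:E < f s)%E] => //.
  have /(_ [set u | (y%:E < u)%E]) := Gamma_continuous_pos t0.
  by apply; apply: open_nbhs_nbhs; split => //; exact: open_ereal_gt_ereal.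
- subst t; have := Gamma_right_continuous (lexx 0).
  move=> /(_ [set u | (y%:E < u)%E]).
  have /[swap]/[apply] : nbhs (f 0) [set u | (y%:E < u)%E].
    apply: open_nbhs_nbhs; split => //; exact: open_ereal_gt_ereal.
  move=> nr.
  exists [set s | (y%:E < f s)%E] => //.
  have : \forall s \near (0:R)^'+, (y%:E < f s)%E by exact: nr.
  rewrite /at_right near_withinE => H; near=> s.
  have [s0|s0|->//] := ltgtP s 0; first by rewrite /= fneg// ltry.
  by rewrite /=; move: s0; near: s.
Unshelve. all: by end_near. Qed.

End strictly_convex.

(** * Conjugates near an attained supremum *)

Section conjugate_maximizer.
Context {R : realType}.
Variable f : R -> \bar R.
Hypothesis fG : in_Gamma f.
Implicit Types r s t u w x y z e : R.
Local Notation c := (fine \o f).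

Lemma conjugate_ge r t : ((r * t)%:E - f t <= conjugate f r)%E.
Proof. by apply: ereal_sup_ubound; exists t. Qed.

Variables (r t0 : R).
Hypotheses (ft0 : f t0 \is a fin_num).
Hypothesis t0_max : forall t, f t \is a fin_num -> r * t - c t <= r * t0 - c t0.

(** Strict convexity at the midpoint, which is positive because two distinct nonnegative points
    cannot both be 0. *)
Lemma maximizer_strict t : f t \is a fin_num -> t != t0 -> r * t - c t < r * t0 - c t0.
Proof.
move=> ft tt0; rewrite lt_neqAle t0_max// andbT; apply/eqP => E.
have mfin : f ((t + t0) / 2) \is a fin_num.
  apply: (Gamma_pos_fin fG); have t_ge0 := Gamma_fin_ge0 fG ft.
  have t0_ge0 := Gamma_fin_ge0 fG ft0.
  suff : t + t0 != 0 by move=> ?; rewrite divr_gt0// lt_neqAle eq_sym; apply/andP; split; rewrite ?addr_ge0.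
  by rewrite paddr_eq0//; apply: contra tt0 => /andP[/eqP -> /eqP ->].
have := t0_max mfin.
have [lt|lt|eq] := ltgtP t t0; last by rewrite eq eqxx in tt0.
- have := Gamma_chord fG ft (_ : t < (t + t0) / 2) (_ : (t + t0) / 2 < t0).
  move=> /(_ ltac:(lra) ltac:(lra)); move: E => /=; move: (fine (f _)) (fine _) (fine _) => a b d E h1 h2.
  by nra.
- have := Gamma_chord fG ft0 (_ : t0 < (t + t0) / 2) (_ : (t + t0) / 2 < t).
  move=> /(_ ltac:(lra) ltac:(lra)); move: E => /=; move: (fine (f _)) (fine _) (fine _) => a b d E h1 h2.
  by nra.
Qed.

(** The deficit is convex, vanishes at [t0] and is positive at distance [e], so beyond that distance
    it grows at least linearly. Linear growth, and not mere positivity, is what absorbs a change of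
    [r] uniformly in [t]. *)
Lemma maximizer_growth e : 0 < e -> exists2 eta, 0 < eta &
  forall t, f t \is a fin_num -> e <= `|t - t0| ->
    eta * `|t - t0| <= (r * t0 - c t0) - (r * t - c t).
Proof.
move=> e0.
have t0_ge0 := Gamma_fin_ge0 fG ft0.
have [eta1 eta10 H1] : exists2 eta, 0 < eta &
    forall t, f t \is a fin_num -> t0 + e <= t ->
    eta * (t - t0) <= (r * t0 - c t0) - (r * t - c t).
  have fp : f (t0 + e) \is a fin_num by apply: (Gamma_pos_fin fG); rewrite ltr_wpDl.
  have h := maximizer_strict fp (_ : t0 + e != t0).
  have {}h := h ltac:(by rewrite gt_eqF// ltrDl).
  exists (((r * t0 - c t0) - (r * (t0 + e) - c (t0 + e))) / e).
    by rewrite divr_gt0// subr_gt0.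
  move=> t ft; rewrite le_eqVlt => /predU1P[<-|et].
    by rewrite (_ : t0 + e - t0 = e) ?divfK ?gt_eqF//; ring.
  rewrite mulrAC ler_pdivrMr//.
  have := Gamma_chord fG ft0 (_ : t0 < t0 + e) et.
  move=> /(_ ltac:(by rewrite ltrDl)) /=.
  by move: (fine _) (fine _) (fine _) => A B C; nra.
have [eta2 eta20 H2] : exists2 eta, 0 < eta &
    forall t, f t \is a fin_num -> t <= t0 - e ->
    eta * (t0 - t) <= (r * t0 - c t0) - (r * t - c t).
  (* If [f] is infinite at [t0 - e], no point of its domain lies at or below [t0 - e], and any
     constant will do. *)
  have [fp|fp] := boolP (f (t0 - e) \is a fin_num); last first.
    exists 1 => // t ft; rewrite le_eqVlt => /predU1P[te|te].
      by rewrite -te ft in fp.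
    have := Gamma_fin_ge0 fG ft => t_ge0; move: fp.
    by rewrite (Gamma_pos_fin fG)// (le_lt_trans t_ge0).
  have h := maximizer_strict fp (_ : t0 - e != t0).
  have {}h := h ltac:(by rewrite lt_eqF// ltrBlDr ltrDl).
  exists (((r * t0 - c t0) - (r * (t0 - e) - c (t0 - e))) / e).
    by rewrite divr_gt0// subr_gt0.
  move=> t ft; rewrite le_eqVlt => /predU1P[->|et].
    by rewrite (_ : t0 - (t0 - e) = e) ?divfK ?gt_eqF//; ring.
  rewrite mulrAC ler_pdivrMr//.
  have := Gamma_chord fG ft et (_ : t0 - e < t0).
  move=> /(_ ltac:(by rewrite ltrBlDr ltrDl)) /=.
  by move: (fine _) (fine _) (fine _) => A B C; nra.
exists (Num.min eta1 eta2); first by rewrite lt_min eta10.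
move=> t ft; have [tt0|tt0] := leP t0 t.
  rewrite ger0_norm ?subr_ge0// => et.
  apply: le_trans (H1 _ ft _); last by rewrite -lerBrDl.
  by rewrite ler_wpM2r ?subr_ge0// ge_min lexx.
rewrite distrC ger0_norm ?subr_ge0 ?(ltW tt0)// => et.
apply: le_trans (H2 _ ft _); last by rewrite lerBrDr -lerBrDl.
by rewrite ler_wpM2r ?subr_ge0 ?(ltW tt0)// ge_min lexx orbT.
Qed.

Lemma conjugate_maximizer : conjugate f r = (r * t0 - c t0)%:E.
Proof.
apply/eqP; rewrite eq_le; apply/andP; split; last first.
  by have := conjugate_ge r t0; rewrite -{1}(fineK ft0).
apply: ge_ereal_sup => _ [t _ <-].
have [ft|] := boolP (f t \is a fin_num).
  by rewrite -(fineK ft) -EFinB lee_fin t0_max.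
case: fG => fNy _ _ _ _; move: (fNy t); case: (f t) => //= _ _; by rewrite leNye.
Qed.

(** For [r'] close to [r], the points farther than [e] from [t0] lose more by the growth of the
    deficit than they gain from the new slope, and the points within [e] gain at most
    [e * |r' - r|]. Finiteness near [r] and differentiability at [r] both follow. *)
Lemma conjugate_near e : 0 < e -> exists2 eta, 0 < eta &
  forall r', `|r' - r| <= eta -> conjugate f r' \is a fin_num /\
    0 <= fine (conjugate f r') - fine (conjugate f r) - (r' - r) * t0
      <= e * `|r' - r|.
Proof.
move=> e0; have [eta eta0 H] := maximizer_growth e0.
exists eta => // r' r'r.
have lb := conjugate_ge r' t0; rewrite -(fineK ft0) -EFinB in lb.
have ub : (conjugate f r' <= (r * t0 - c t0 + (r' - r) * t0 + e * `|r' - r|)%:E)%E.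
  apply: ge_ereal_sup => _ [t _ <-].
  have [ft|] := boolP (f t \is a fin_num); last first.
    by case: fG => fNy _ _ _ _; move: (fNy t); case: (f t) => //= _ _; rewrite leNye.
  rewrite -(fineK ft) -EFinB lee_fin.
  have t0m := t0_max ft.
  have p0 : 0 <= `|r' - r| by [].
  have h1 : (r' - r) * (t - t0) <= `|r' - r| * `|t - t0| by rewrite -normrM ler_norm.
  have [te|te] := leP e `|t - t0|.
    have := H _ ft te => h.
    have h2 : `|r' - r| * `|t - t0| <= eta * `|t - t0| by rewrite ler_wpM2r.
    have : 0 <= e * `|r' - r| by rewrite mulr_ge0// ltW.
    by move: h h1 h2 => /=; move: (`|_|) (`|_|) (fine _) (fine _) => A B C D; lra.
  have h2 : `|r' - r| * `|t - t0| <= `|r' - r| * e by rewrite ler_wpM2l// ltW.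
  by move: h1 h2 t0m => /=; move: (`|_|) (`|_|) (fine _) (fine _) => A B C D; lra.
have fin : conjugate f r' \is a fin_num.
  by apply: fin_real; rewrite (lt_le_trans _ lb) ?ltNyr//= (le_lt_trans ub) ?ltry.
split=> //; move: lb ub; rewrite conjugate_maximizer -(fineK fin) !lee_fin /=.
by move: (fine _) (fine _) (`|_|) => A B C; lra.
Qed.

Lemma conjugate_is_derive : is_derive r 1 (fine \o conjugate f) t0.
Proof.
have cv : (h^-1 *: ((fine \o conjugate f) (h *: 1 + r) - (fine \o conjugate f) r))
    @[h --> 0^'] --> t0.
  apply/cvgrPdist_le => e e0.
  have [eta eta0 H] := conjugate_near e0.
  near=> h.
  have h0 : h != 0 by near: h; exact: nbhs_dnbhs_neq.
  have hn : `|(h *: 1 + r) - r| <= eta.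
    rewrite /GRing.scale /= mulr1 addrK.
    near: h; apply: dnbhs0_le => //.
  have [_] := H _ hn.
  rewrite /GRing.scale /= mulr1 addrK.
  set D := (X in 0 <= X - _ <= _) => /andP[D1 D2].
  rewrite -(ler_pM2l (_ : 0 < `|h|)) ?normr_gt0// -normrM mulrBr mulVKf//.
  by rewrite distrC ger0_norm// [leRHS]mulrC.
by split; [apply/cvg_ex; exists t0|exact/cvg_lim].
Unshelve. all: by end_near. Qed.

Lemma conjugate_ederiv : ederivable (conjugate f) r /\ ederiv (conjugate f) r = t0.
Proof.
have [dv v] := conjugate_is_derive.
split; last by rewrite /ederiv derive1E.
split=> //.
have [eta eta0 H] := conjugate_near ltr01.
near=> s; have [] := H s; first (rewrite distrC; near: s; by apply: filterS (near_dist_lt r eta0) => s /ltW); by [].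
Unshelve. all: by end_near. Qed.

End conjugate_maximizer.

(** * Sequences with vanishing Fenchel gap *)

Section fenchel_gap.
Context {R : realType}.
Variable f : R -> \bar R.
Hypothesis fG : in_Gamma f.
Hypothesis f_coercive : forall M : R, exists T : R, forall t, (f t <= M%:E)%E -> t <= T.
Implicit Types r s t x y z e : R.
Local Notation c := (fine \o f).
Variables (r : R) (u : nat -> R).
Hypothesis conj_fin : conjugate f r \is a fin_num.
Hypothesis gap0 :
  (f (u j) + conjugate f r - (r * u j)%:E)%E @[j --> \oo] --> 0%E.
Hypothesis f_bounded : exists M : R,
  forall N : nat, exists2 j, (N <= j)%N & (f (u j) <= M%:E)%E.

Let k := fine (conjugate f r).

Let gap_lt e : 0 < e -> exists N : nat, forall j, (N <= j)%N ->
  f (u j) \is a fin_num /\ c (u j) + k - r * u j < e.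
Proof.
move=> e0; have : nbhs (0 : \bar R)%E [set x | (x < e%:E)%E].
  by apply: open_nbhs_nbhs; split; [exact: open_ereal_lt_ereal|rewrite /= lte_fin].
move=> /gap0 [N _ H]; exists N => j Nj; have := H j Nj => /=.
rewrite -(fineK conj_fin) -/k.
by case: fG => fNy _ _ _ _; have := fNy (u j); case: (f (u j)).
Qed.

(** Coercivity confines a subsequence of bounded energy to a compact interval. At a cluster point,
    lower semicontinuity turns the vanishing gap into the bound that characterizes a maximizer. *)
Let maximizer_exists : exists t0, f t0 \is a fin_num /\ c t0 <= r * t0 - k.
Proof.
have [M HM] := f_bounded.
have [T HT] := f_coercive M.
pose n_ N := projT1 (cid2 (HM N)).
have n_ge N : (N <= n_ N)%N by rewrite /n_; case: cid2.
have n_le N : (f (u (n_ N)) <= M%:E)%E by rewrite /n_; case: cid2.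
pose v := u \o n_.
have vT N : v N \in `[0, T].
  rewrite in_itv /= (HT _ (n_le N)) andbT leNgt; apply/negP => v0.
  by have := n_le N; case: fG => _ _ _ fneg _; rewrite fneg.
have [] := @segment_compact _ 0 T (v N @[N --> \oo]) _.
  by exists 0%N => // N _; exact: vT.
move=> t0 [_ cl]; exists t0.
suff le : (f t0 <= (r * t0 - k)%:E)%E.
  have ff : f t0 \is a fin_num.
    case: fG => fNy _ _ _ _; have := fNy t0; move: le; by case: (f t0).
  by split=> //; rewrite -lee_fin (fineK ff).
rewrite leNgt; apply/negP => lt.
have [y [ly yf]] : exists y, r * t0 - k < y /\ (y%:E < f t0)%E.
  move: lt; case: (f t0) => //= [b|_].
    rewrite lte_fin => h; exists ((r * t0 - k + b) / 2); rewrite lte_fin; split; lra.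
  by exists (r * t0 - k + 1); rewrite ltry ltrDl.
have [V nV HV] := Gamma_lsc fG yf.
(* Half of the excess of [y] over [r * t0 - k]: one half is spent on the gap, the other on
   [r * (v j - t0)]. *)
pose eta := (y - (r * t0 - k)) / 2.
have eta0 : 0 < eta by rewrite divr_gt0// subr_gt0.
have [N HN] := gap_lt eta0.
have nW : nbhs t0 (V `&` [set s | `|t0 - s| < eta / (`|r| + 1)]).
  apply: filterI => //; apply: near_dist_lt; by rewrite divr_gt0// ltr_wpDl.
have FB : nbhs (v N @[N --> \oo]) [set v j | j in [set j | (N <= j)%N]].
  by exists N => // j /= Nj; exists j.
have [_ [[j /= Nj <-] [Vj /= dj]]] := cl _ _ FB nW.
have [ff gap] := HN _ (leq_trans Nj (n_ge j)).
have := HV _ Vj; rewrite -[f _](fineK ff) lte_fin => yc.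
have rv : r * v j <= r * t0 + eta.
  rewrite -lerBlDl -mulrBr (le_trans (ler_norm _))// normrM distrC.
  move: dj; rewrite ltr_pdivlMr ?ltr_wpDl// => /ltW; apply: le_trans.
  by rewrite mulrC ler_wpM2l// lerDl.
move: gap yc rv; rewrite /eta /v /=; move: (fine _) (r * u _) => A B; lra.
Qed.

(** Once a maximizer exists, the growth of the deficit keeps the whole sequence near it, not only
    the bounded subsequence that produced it. *)
Lemma fenchel_gap_cvg : ederivable (conjugate f) r /\
  u j @[j --> \oo] --> ederiv (conjugate f) r.
Proof.
have [t0 [ft0 ct0]] := maximizer_exists.
have kE : conjugate f r = k%:E by rewrite fineK.
have t0_max t : f t \is a fin_num -> r * t - c t <= r * t0 - c t0.
  move=> ft; apply: (@le_trans _ _ k); last by lra.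
  by have := conjugate_ge f r t; rewrite kE -(fineK ft) -EFinB lee_fin.
have [dv ->] := conjugate_ederiv fG ft0 t0_max; split => //.
have k0 : k = r * t0 - c t0 by rewrite /k (conjugate_maximizer fG ft0 t0_max).
apply/cvgrPdist_lt => e e0.
have [eta eta0 H] := maximizer_growth fG ft0 t0_max e0.
have [N HN] := gap_lt (mulr_gt0 eta0 e0).
exists N => // j /= Nj; have [fj gj] := HN j Nj.
rewrite distrC ltNge; apply/negP => ej.
have := H _ fj ej; apply/negP; rewrite -ltNge.
apply: lt_le_trans (_ : eta * e <= _); last by rewrite ler_wpM2l// ltW.
by move: gj; rewrite k0 /=; lra.
Qed.

End fenchel_gap.

(** * One-sided derivatives and the pointwise Bregman integrand *)

Section one_sided_derivatives.
Context {R : realType}.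
Variable gamma : R -> \bar R.
Hypothesis gammaG : in_Gamma gamma.
Implicit Types s t u w x y z e p m : R.
Local Notation c := (fine \o gamma).

Definition slope t e := (c (t + e) - c t) / e.

Lemma slope_lt t e e' : gamma t \is a fin_num -> gamma (t + e) \is a fin_num ->
  e < e' -> e != 0 -> e' != 0 -> slope t e < slope t e'.
Proof.
move=> gt gte ee' e0 e'0; rewrite /slope.
have [e'_lt0|e'_gt0|/eqP] := ltgtP e' 0; last by rewrite (negbTE e'0).
  have e_lt0 := lt_trans ee' e'_lt0.
  rewrite -[X in X < _]mulrNN -[X in _ < X]mulrNN -!invrN.
  rewrite ltr_pdivrMr ?oppr_gt0// mulrAC ltr_pdivlMr ?oppr_gt0//.
  have := Gamma_chord gammaG gte (_ : t + e < t + e') (_ : t + e' < t).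
  by move=> /(_ ltac:(lra) ltac:(lra)) /=; move: (fine _) (fine _) (fine _) => a b d; lra.
have [e_lt0|e_gt0|/eqP] := ltgtP e 0; last by rewrite (negbTE e0).
  rewrite -[X in X < _]mulrNN -invrN.
  rewrite ltr_pdivrMr ?oppr_gt0// mulrAC ltr_pdivlMr//.
  have := Gamma_chord gammaG gte (_ : t + e < t) (_ : t < t + e').
  by move=> /(_ ltac:(lra) ltac:(lra)) /=; move: (fine _) (fine _) (fine _) => a b d; lra.
rewrite ltr_pdivrMr// mulrAC ltr_pdivlMr//.
have := Gamma_chord gammaG gt (_ : t < t + e) (_ : t + e < t + e').
by move=> /(_ ltac:(lra) ltac:(lra)) /=; move: (fine _) (fine _) (fine _) => a b d; lra.
Qed.

Lemma diff_quotE t e : gamma t \is a fin_num -> gamma (t + e) \is a fin_num ->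
  diff_quot gamma t e = (slope t e)%:E.
Proof. by move=> gt gte; rewrite /diff_quot -(fineK gt) -(fineK gte) -EFinB -EFinM. Qed.

(** Convergence is recorded with the value because [lim] means nothing without it. The limit is the
    infimum of the increasing slopes; halving the increment makes the comparisons strict. *)
Lemma right_deriv_pos t : 0 < t -> exists p,
  [/\ right_deriv gamma t = p%:E,
      diff_quot gamma t e @[e --> 0^'+] --> p%:E,
      (forall e, 0 < e -> p < slope t e)
    & forall e, e < 0 -> gamma (t + e) \is a fin_num -> slope t e < p].
Proof.
move=> t0; have gt := Gamma_pos_fin gammaG t0.
have gte e : 0 < e -> gamma (t + e) \is a fin_num.
  by move=> e0; apply: (Gamma_pos_fin gammaG); rewrite addr_gt0.
pose S := slope t @` [set` `]0, +oo[].
have lbS w e : w < 0 -> gamma (t + w) \is a fin_num -> 0 < e -> slope t w <= slope t e.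
  by move=> w0 gw e0; rewrite ltW// slope_lt//; [exact: lt_trans e0|rewrite lt_eqF|rewrite gt_eqF].
have t2f : gamma (t - t / 2) \is a fin_num by apply: (Gamma_pos_fin gammaG); lra.
have hlb : has_lbound S.
  exists (slope t (- (t / 2))) => _ [e /= e0 <-]; apply: lbS => //; first by lra.
  by move: e0; rewrite in_itv /= andbT.
have cv : slope t e @[e --> 0^'+] --> inf S.
  apply: (@nondecreasing_at_right_cvgr _ _ _ (BInfty R false)) => // x y.
  rewrite !in_itv/= !andbT => x0 y0; rewrite le_eqVlt => /predU1P[->//|xy].
  by rewrite ltW// slope_lt ?gte// gt_eqF.
have cvE : diff_quot gamma t e @[e --> 0^'+] --> (inf S)%:E.
  apply: (@cvg_trans _ ((slope t e)%:E @[e --> 0^'+])).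
    apply: near_eq_cvg; near=> e; rewrite diff_quotE ?gte//.
  by apply: cvg_EFin; [exact: nearW|].
have leS e : 0 < e -> inf S <= slope t e.
  by move=> e0; apply: ge_inf => //; exists e => //=; rewrite in_itv/= e0.
have geS e : e < 0 -> gamma (t + e) \is a fin_num -> slope t e <= inf S.
  move=> e0 ge; apply: lb_le_inf; first by exists (slope t 1), 1 => //=; rewrite in_itv/= ltr01.
  by move=> _ [w /= w0 <-]; apply: lbS => //; move: w0; rewrite in_itv/= andbT.
exists (inf S); split=> //.
- by rewrite /right_deriv t0; exact/cvg_lim.
- move=> e e0; apply: (le_lt_trans (leS (e / 2) _)); first by rewrite divr_gt0.
  by apply: slope_lt; rewrite ?gte ?divr_gt0 ?gt_eqF ?divr_gt0//; lra.
- move=> e e0 ge; apply: lt_le_trans (geS (e / 2) _ _); last 2 first.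
  + by lra.
  + by apply: (Gamma_pos_fin gammaG); have := Gamma_fin_ge0 gammaG ge; lra.
  by apply: slope_lt; rewrite ?lt_eqF//; lra.
Unshelve. all: by end_near. Qed.

Lemma left_deriv_pos t : 0 < t -> exists m,
  [/\ left_deriv gamma t = m%:E,
      diff_quot gamma t e @[e --> 0^'-] --> m%:E,
      (forall e, 0 < e -> m <= slope t e)
    & forall e, e < 0 -> gamma (t + e) \is a fin_num -> slope t e < m].
Proof.
move=> t0; have gt := Gamma_pos_fin gammaG t0.
have gte e : 0 < e -> gamma (t + e) \is a fin_num.
  by move=> e0; apply: (Gamma_pos_fin gammaG); rewrite addr_gt0.
have gtN e : e < t -> gamma (t - e) \is a fin_num.
  by move=> et; apply: (Gamma_pos_fin gammaG); rewrite subr_gt0.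
pose S := (fun e => slope t (- e)) @` [set` `]0, t[].
have ubS w e : w < 0 -> gamma (t + w) \is a fin_num -> 0 < e -> slope t w <= slope t e.
  by move=> w0 gw e0; rewrite ltW// slope_lt//; [exact: lt_trans e0|rewrite lt_eqF|rewrite gt_eqF].
have hub : has_ubound S.
  exists (slope t 1) => _ [e /= + <-]; rewrite in_itv/= => /andP[e0 et].
  by apply: ubS => //; [rewrite oppr_lt0|exact: gtN].
have cv : slope t (- e) @[e --> 0^'+] --> sup S.
  apply: (@nonincreasing_at_right_cvgr _ _ _ (BLeft t)) => // x y.
  rewrite !in_itv/= => /andP[x0 xt] /andP[y0 yt]; rewrite le_eqVlt => /predU1P[->//|xy].
  by rewrite ltW// slope_lt ?gtN ?oppr_eq0 ?gt_eqF// ltrN2.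
have cvE : diff_quot gamma t e @[e --> 0^'-] --> (sup S)%:E.
  apply/cvg_at_leftNP; rewrite oppr0.
  apply: (@cvg_trans _ ((slope t (- e))%:E @[e --> 0^'+])).
    apply: near_eq_cvg; near=> e; rewrite /= diff_quotE ?gtN//.
  by apply: cvg_EFin; [exact: nearW|].
have S0 : S !=set0.
  by exists (slope t (- (t / 2))), (t / 2) => //=; rewrite in_itv/=; apply/andP; split; lra.
have geS e : e < 0 -> 0 < t + e -> slope t e <= sup S.
  move=> e0 te; apply: ub_le_sup => //; exists (- e); rewrite ?opprK//= in_itv/=.
  by apply/andP; split; lra.
exists (sup S); split=> //.
- by rewrite /left_deriv t0; exact/cvg_lim.
- move=> e e0; apply: ge_sup => // _ [w /= + <-]; rewrite in_itv/= => /andP[w0 wt].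
  by apply: ubS => //; [rewrite oppr_lt0|exact: gtN].
- move=> e e0 ge; have te := Gamma_fin_ge0 gammaG ge.
  apply: lt_le_trans (geS (e / 2) _ _); [|lra|lra].
  by apply: slope_lt; rewrite ?lt_eqF//; lra.
Unshelve. all: by end_near. Qed.

End one_sided_derivatives.

Section bregman_pointwise.
Context {R : realType}.
Variable gamma : R -> \bar R.
Hypothesis gammaG : in_Gamma gamma.
Implicit Types s t u w x y z e p m : R.
Local Notation c := (fine \o gamma).
Local Notation inner u := (lim (diff_quot gamma u e @[e --> 0^'+])).

Lemma inner_right_deriv u : 0 < u -> inner u = right_deriv gamma u.
Proof. by rewrite /right_deriv => ->. Qed.

Lemma right_deriv_nd u w : 0 < u -> u < w -> (right_deriv gamma u <= right_deriv gamma w)%E.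
Proof.
move=> u0 uw; have w0 := lt_trans u0 uw.
have [p [-> _ H _]] := right_deriv_pos gammaG u0.
have [q [-> _ _ K]] := right_deriv_pos gammaG w0.
rewrite lee_fin ltW//; apply: lt_trans (H (w - u) _) _; first by rewrite subr_gt0.
have wu : w + (u - w) = u by ring.
apply: le_lt_trans (K (u - w) _ _); last 2 first.
  by rewrite subr_lt0.
  by rewrite wu (Gamma_pos_fin gammaG).
rewrite /slope wu (_ : u + (w - u) = w); last by ring.
by rewrite -[u - w]opprB invrN mulrN -mulNr opprB.
Qed.

(** Monotonicity makes the nested [lim] at 0 a genuine limit in the extended reals, possibly
    [-oo]. *)
Lemma right_deriv0_cvg : right_deriv gamma u @[u --> 0^'+] --> right_deriv gamma 0.
Proof.
have cv : right_deriv gamma u @[u --> 0^'+] -->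
    ereal_inf (right_deriv gamma @` [set` `]0, +oo[]).
  apply: (@nondecreasing_at_right_cvge _ _ _ (BInfty R false)) => // x y.
  rewrite !in_itv/= !andbT => x0 y0; rewrite le_eqVlt => /predU1P[->//|xy].
  exact: right_deriv_nd.
rewrite {2}/right_deriv ltxx.
have cvi : inner u @[u --> 0^'+] -->
    ereal_inf (right_deriv gamma @` [set` `]0, +oo[]).
  apply: cvg_trans cv; apply: near_eq_cvg.
  by near=> u; rewrite inner_right_deriv.
by rewrite (cvg_lim _ cvi).
Unshelve. all: by end_near. Qed.

Lemma right_deriv0_le u : 0 < u -> (right_deriv gamma 0 <= right_deriv gamma u)%E.
Proof.
move=> u0; apply: (cvge_to_le right_deriv0_cvg).
near=> w; apply: right_deriv_nd => //; near: w; exact: nbhs_right_lt.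
Unshelve. all: by end_near. Qed.

(** At [h = 0] the hypothesis excludes the derivative [-oo]. A finite derivative [p] bounds
    [gamma u], for [u] between 0 and [t], by an affine function of [u], and letting [u] tend to 0
    shows that [gamma 0] is finite. In that case [m] is a dummy, since nothing finite lies to the
    left of 0. *)
Lemma Gamma_support (h : R) : 0 <= h ->
  (right_deriv gamma 0 = -oo%E -> 0 < h) -> exists p m,
  [/\ gamma h \is a fin_num, right_deriv gamma h = p%:E,
      0 < h -> left_deriv gamma h = m%:E & m <= p] /\
  ((forall t, h < t -> p * (t - h) < c t - c h) /\
   (forall t, t < h -> gamma t \is a fin_num -> m * (t - h) < c t - c h)).
Proof.
move=> h0 hpos; have [h_gt0|] := ltP 0 h.
  have gh := Gamma_pos_fin gammaG h_gt0.
  have [p [pE pcv H1 H2]] := right_deriv_pos gammaG h_gt0.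
  have [m [mE _ H3 H4]] := left_deriv_pos gammaG h_gt0.
  exists p, m; split; [split=> //|split].
  - rewrite -lee_fin; apply: (cvge_to_ge pcv); near=> e.
    rewrite diff_quotE ?(Gamma_pos_fin gammaG) ?addr_gt0//.
    by rewrite lee_fin H3.
  - move=> t ht; have := H1 (t - h); rewrite subr_gt0 => /(_ ht).
    by rewrite /slope ltr_pdivlMr ?subr_gt0// (_ : h + (t - h) = t)//; ring.
  - move=> t ht gt; have := H4 (t - h); rewrite subr_lt0 (_ : h + (t - h) = t); last by ring.
    move=> /(_ ht gt); rewrite /slope (_ : h + (t - h) = t); last by ring.
    by rewrite ltr_ndivrMr ?subr_lt0.
move=> hle; have {h0 hle}hE : h = 0 by apply/eqP; rewrite eq_le h0 hle.
subst h; have d0 : right_deriv gamma 0 != -oo%E.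
  by apply/eqP => /hpos; rewrite ltxx.
have := right_deriv0_le ltr01.
have [p1 [-> _ _ _]] := right_deriv_pos gammaG ltr01.
case E : (right_deriv gamma 0) d0 => [p| |] // _ _.
have supp u t : 0 < u -> u < t -> p * (t - u) < c t - c u.
  move=> u0 ut; have [q [qE _ H _]] := right_deriv_pos gammaG u0.
  have := right_deriv0_le u0; rewrite E qE lee_fin => pq.
  have := H (t - u); rewrite subr_gt0 => /(_ ut).
  rewrite /slope ltr_pdivlMr ?subr_gt0// (_ : u + (t - u) = t)//; last by ring.
  by apply: le_lt_trans; rewrite ler_wpM2r// subr_ge0 ltW.
have ubd : forall t, 0 < t -> (gamma 0 <= (c t - p * t)%:E)%E.
  move=> t t0; have cg : gamma u @[u --> 0^'+] --> gamma 0 by case: gammaG.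
  have cl : (c t - p * (t - u))%:E @[u --> 0^'+] --> (c t - p * (t - 0))%:E.
    apply: cvg_EFin; first exact: nearW.
    apply: cvgB; first exact: cvg_cst.
    apply: cvgMr; apply: cvgB; first exact: cvg_cst.
    exact/cvg_at_right_filter/cvg_id.
  rewrite subr0 in cl.
  apply: (lee_cvg_to cg cl); near=> u.
  have u0 : 0 < u by [].
  rewrite -(fineK (Gamma_pos_fin gammaG u0)) lee_fin.
  have ut : u < t by near: u; exact: nbhs_right_lt.
  by have := supp _ _ u0 ut => /=; lra.
have g0 : gamma 0 \is a fin_num.
  by case: gammaG => /(_ 0) + _ _ _ _; have := ubd _ ltr01; case: (gamma 0).
have le0 t : 0 < t -> p * t <= c t - c 0.
  by move=> t0; have := ubd _ t0; rewrite -(fineK g0) lee_fin /=; lra.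
exists p, p; split; first by split=> //; rewrite ltxx.
split=> t t0; last by move=> /(Gamma_fin_ge0 gammaG); rewrite leNgt t0.
rewrite subr0; have := supp (t / 2) t; have := le0 (t / 2).
rewrite divr_gt0// => /(_ isT) A /(_ isT) B; have {}B := B ltac:(lra).
by move: A B => /=; lra.
Unshelve. all: by end_near. Qed.

End bregman_pointwise.

Section bregman_integrand_pointwise.
Context {R : realType}.
Variable gamma : R -> \bar R.
Hypothesis gammaG : in_Gamma gamma.
Variable h : R.
Hypothesis h0 : 0 <= h.
Hypothesis h_gt0 : right_deriv gamma 0 = -oo%E -> 0 < h.
Implicit Types s t u w x y z e p m : R.
Local Notation c := (fine \o gamma).

Lemma bregman_deltaE : exists p m,
  [/\ m <= p,
      forall t, bregman_delta gamma t h =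
        (gamma t - (c h + (if h <= t then p else m) * (t - h))%:E)%E,
      forall t, h < t -> p * (t - h) < c t - c h
    & forall t, t < h -> gamma t \is a fin_num -> m * (t - h) < c t - c h].
Proof.
have [p [m [[gh pE mE mp] [H1 H2]]]] := Gamma_support gammaG h0 h_gt0.
exists p, m; split=> // t; rewrite /bregman_delta.
have [t0|t0] := ltP t 0 => /=.
  by case: gammaG => _ _ _ /(_ _ t0) ->; rewrite addye.
rewrite (ltNge h) h0/= pE /= /sgn_deriv subr_ge0.
have [ht|ht] := leP h t; rewrite ?pE ?mE ?(le_lt_trans t0 ht)//;
  by rewrite opprD [in RHS]EFinD [in RHS]EFinN [in RHS]EFinN [in RHS]EFinM (fineK gh) addeA.
Qed.

Lemma bregman_delta_ge0 t : (0 <= bregman_delta gamma t h)%E.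
Proof.
have [p [m [mp -> H1 H2]]] := bregman_deltaE.
have [gt|] := boolP (gamma t \is a fin_num); last first.
  by case: gammaG => /(_ t) + _ _ _ _; case: (gamma t) => // _ _; rewrite addye.
rewrite -(fineK gt) -EFinB lee_fin; case: (ltgtP h t) => [ht|ht|<-].
- by have := H1 _ ht => /=; lra.
- by have := H2 _ ht gt => /=; lra.
by rewrite /= subrr mulr0 addr0 subrr.
Qed.

Lemma bregman_deltaxx : bregman_delta gamma h h = 0%E.
Proof.
have [p [m [[gh _ _ _] _]]] := Gamma_support gammaG h0 h_gt0.
have [q [n [_ -> _ _]]] := bregman_deltaE.
by rewrite lexx subrr mulr0 addr0 -(fineK gh) -EFinB subrr.
Qed.

(** The subtracted function is itself convex, with a kink at [h], so strict convexity is in doubt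
    only across [h]. There the integrand vanishes at [h] and is positive elsewhere: a point between
    [s] and [t] is compared with [h] and the end on its own side, and positivity at the other end
    gives strictness. *)
Lemma bregman_delta_Gamma : in_Gamma (fun t => bregman_delta gamma t h).
Proof.
have [p [m [mp fE H1 H2]]] := bregman_deltaE.
case: (gammaG) => gNy gfin gsc gneg gcv.
have [_ [_ [[gh _ _ _] _]]] := Gamma_support gammaG h0 h_gt0.
split.
- by move=> t; rewrite gt_eqF// (lt_le_trans _ (bregman_delta_ge0 t))// ltNyr.
- by move=> t t0; rewrite fE fin_numB (gfin _ t0).
- have wlog_sc s t l : 0 < s -> s < t -> 0 < l < 1 ->
      (bregman_delta gamma (l * s + (1 - l) * t)%R h <
       l%:E * bregman_delta gamma s h + (1 - l)%:E * bregman_delta gamma t h)%E.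
    move=> s0 st /andP[l0 l1]; have t0 := lt_trans s0 st.
    have gsf := gfin _ s0; have gtf := gfin _ t0.
    set x := l * s + _.
    have sx : s < x by rewrite /x; nra.
    have xt : x < t by rewrite /x; nra.
    have x0 : 0 < x := lt_trans s0 sx; have gxf := gfin _ x0.
    have lin : c x < l * c s + (1 - l) * c t.
      have := gsc s t l s0 t0 (negbT (lt_eqF st)); rewrite l0 l1 => /(_ isT).
      by rewrite -/x -(fineK gsf) -(fineK gtf) -(fineK gxf) -!EFinM -EFinD lte_fin.
    rewrite !fE -(fineK gsf) -(fineK gtf) -(fineK gxf) -!EFinB -!EFinM -EFinD lte_fin.
    have [hs|sh] := leP h s.
      rewrite (le_trans hs (ltW sx)) (le_trans hs (ltW st)).
      have xE : p * (x - h) = l * (p * (s - h)) + (1 - l) * (p * (t - h)) by rewrite /x; ring.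
      move: lin; rewrite xE /=; move: (fine _) (fine _) (fine _) (fine _) => A B C D; lra.
    have [ht|th] := leP h t; last first.
      rewrite leNgt (lt_trans xt th)/=.
      have xE : m * (x - h) = l * (m * (s - h)) + (1 - l) * (m * (t - h)) by rewrite /x; ring.
      move: lin; rewrite xE /=; move: (fine _) (fine _) (fine _) (fine _) => A B C D; lra.
    have Fs := H2 s sh gsf.
    have Ft : p * (t - h) <= c t - c h.
      by move: ht; rewrite le_eqVlt => /predU1P[->|/H1/ltW//]; rewrite !subrr mulr0.
    have [hx|xh] := leP h x.
      have h1 : (t - h) * c x <= (t - x) * c h + (x - h) * c t.
        move: hx; rewrite le_eqVlt => /predU1P[->|hx].
          by rewrite subrr mul0r addr0.
        exact/ltW/Gamma_chord.
      have th : 0 < t - h by rewrite subr_gt0 (le_lt_trans hx).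
      have h2 : x - h < (1 - l) * (t - h) by rewrite /x; nra.
      rewrite -(ltr_pM2l th).
      move: h1 h2 Fs Ft => /=; set A := fine (gamma x); set B := fine (gamma s).
      set C := fine (gamma t); set D := fine (gamma h) => h1 h2 Fs Ft.
      have k1 : (x - h) * (C - D - p * (t - h)) <= (1 - l) * (t - h) * (C - D - p * (t - h)).
        by rewrite ler_wpM2r ?(ltW h2)//; lra.
      have k2 : 0 < (t - h) * (l * (B - D - m * (s - h))).
        by rewrite !mulr_gt0//; lra.
      by lra.
    have h1 : (h - s) * c x <= (h - x) * c s + (x - s) * c h by exact/ltW/Gamma_chord.
    have sh0 : 0 < h - s by rewrite subr_gt0.
    have h2 : h - x <= l * (h - s) by rewrite /x; nra.
    rewrite -(ltr_pM2l sh0).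
    have l1' : 0 < 1 - l by rewrite subr_gt0.
    have [/eqP htE|htn] := boolP (h == t).
      subst t; move: lin; rewrite subrr mulr0 addr0 => lin.
      move: lin Fs => /=; set A := fine (gamma x); set B := fine (gamma s).
      set D := fine (gamma h) => lin Fs.
      rewrite ltr_pM2l// /x; lra.
    have {}Ft : p * (t - h) < c t - c h by apply: H1; rewrite lt_neqAle htn.
    move: h1 h2 Fs Ft => /=; set A := fine (gamma x); set B := fine (gamma s).
    set C := fine (gamma t); set D := fine (gamma h) => h1 h2 Fs Ft.
    have k1 : (h - x) * (B - D - m * (s - h)) <= l * (h - s) * (B - D - m * (s - h)).
      by rewrite ler_wpM2r//; lra.
    have k2 : 0 < (h - s) * ((1 - l) * (C - D - p * (t - h))).
      by rewrite !mulr_gt0//; lra.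
    by lra.
  move=> s t l s0 t0 st l01; have [ss|ss|/eqP] := ltgtP s t.
  + exact: wlog_sc.
  + rewrite addrC addeC.
    have := wlog_sc t s (1 - l) t0 ss; rewrite opprB addrCA subrr addr0; apply.
    by move: l01 => /andP[l0 l1]; apply/andP; split; lra.
  + by rewrite (negbTE st).
- by move=> t t0; rewrite fE gneg// addye.
- rewrite fE.
  have -> : (fun t => bregman_delta gamma t h) = (fun t => (gamma t -
      (c h + (if h <= t then p else m) * (t - h))%:E)%E) by apply/funext.
  apply: (@cvgeB _ _ _ _ gamma (fun t =>
    (c h + (if h <= t then p else m) * (t - h))%:E)) => //.
    by rewrite fin_num_adde_defl.
  apply: cvg_EFin; first exact: nearW.
  apply: cvgD; first exact: cvg_cst.
  have idc : t - h @[t --> (0:R)^'+] --> 0 - h.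
    by apply: cvgB; [exact/cvg_at_right_filter/cvg_id|exact: cvg_cst].
  move: h0; rewrite le_eqVlt => /predU1P[hE|hgt].
    have h0' : (h <= 0) by rewrite -hE.
    rewrite h0'; apply: (@cvg_trans _ (p * (t - h) @[t --> 0^'+])).
      by apply: near_eq_cvg; near=> t; rewrite (le_trans h0' (ltW _)).
    exact: cvgMr.
  rewrite (leNgt h 0) hgt/=; apply: (@cvg_trans _ (m * (t - h) @[t --> 0^'+])).
    apply: near_eq_cvg; near=> t.
    have th : t < h by near: t; exact: nbhs_right_lt.
    by rewrite leNgt th.
  exact: cvgMr.
Unshelve. all: by end_near. Qed.

End bregman_integrand_pointwise.

(** Strict convexity and [f h = 0] make [f (h + 1)] positive, and beyond [h + 1] the function grows
    at least with this slope. *)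
Lemma Gamma_coercive {R : realType} (f : R -> \bar R) (h : R) : in_Gamma f ->
  (forall t, (0 <= f t)%E) -> f h = 0%E ->
  forall M : R, exists T : R, forall t, (f t <= M%:E)%E -> t <= T.
Proof.
move=> fG f0 fh M; have fhf : f h \is a fin_num by rewrite fh.
have h0 := Gamma_fin_ge0 fG fhf.
have ff t : h < t -> f t \is a fin_num.
  by move=> ht; apply: (Gamma_pos_fin fG); exact: le_lt_trans ht.
have chord x y : h < x -> x < y -> (y - h) * fine (f x) < (x - h) * fine (f y).
  by move=> hx xy; have := Gamma_chord fG fhf hx xy; rewrite /= fh /= mulr0 add0r.
have w0 : 0 < fine (f (h + 1)).
  have := @chord (h + 2^-1) (h + 1) ltac:(lra) ltac:(lra).
  have -> : h + 1 - h = 1 by rewrite addrAC subrr add0r.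
  have -> : h + 2^-1 - h = 2^-1 by rewrite addrAC subrr add0r.
  rewrite mul1r -ltr_pdivrMl ?invr_gt0//; apply: le_lt_trans.
  by rewrite mulr_ge0 ?invr_ge0// fine_ge0.
exists (h + 1 + `|M| / fine (f (h + 1))) => t ft.
rewrite leNgt; apply/negP => tT.
have th : h + 1 < t by apply: le_lt_trans tT; rewrite lerDl divr_ge0// ltW.
have := chord (h + 1) t ltac:(lra) th; move: ft.
rewrite -(fineK (ff t _)); last by lra.
rewrite lee_fin => ft; have -> : h + 1 - h = 1 by rewrite addrAC subrr add0r.
rewrite mul1r; apply/negP; rewrite -leNgt; apply: (le_trans ft).
apply: (le_trans (ler_norm M)).
rewrite -ler_pdivrMr//; lra.
Qed.

(** * Measurability of the Bregman integrand *)

Lemma harmonic_at_right {R : realType} : @harmonic R n @[n --> \oo] --> (0:R)^'+.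
Proof.
move=> A; rewrite /at_right /within /= => nA.
have [N _ H] := @cvg_harmonic R _ nA.
by exists N => // n Nn; apply: (H n Nn); rewrite /harmonic /= invr_gt0.
Qed.

Section measurability.
Context {disp : measure_display} {Z : measurableType disp} {R : realType}.
Variable beta : Z -> R -> \bar R.
Hypothesis betaB : in_B beta.

(* The grid points lie to the right of [g], since members of [Gamma] are only
   right-continuous at 0. *)
Let step_measurable (n : nat) (g : Z -> R) : measurable_fun setT g ->
  (forall z, 0 <= g z) ->
  measurable_fun setT (fun z => beta z ((Num.truncn (n.+1%:R * g z)).+1%:R / n.+1%:R)).
Proof.
move=> mg g0 _ Y mY; rewrite setTI.
pose S k := (fun z => n.+1%:R * g z) @^-1` `[k%:R, k.+1%:R[%classic.
have mS k : measurable (S k).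
  rewrite -[S k]setTI; apply: measurable_funM => //; exact: measurable_itv.
rewrite (_ : _ @^-1` Y =
  \bigcup_k (S k `&` (fun z => beta z (k.+1%:R / n.+1%:R)) @^-1` Y)).
  apply: bigcup_measurable => k _; apply: measurableI => //.
  by rewrite -[X in measurable X]setTI; apply: betaB.1.
have ng z : 0 <= n.+1%:R * g z by rewrite mulr_ge0.
apply/seteqP; split=> z /=.
  move=> Yz; exists (Num.truncn (n.+1%:R * g z)) => //; split=> //.
  by rewrite /S /= in_itv/= truncn_itv.
move=> [k _ [Sk Yk]].
suff -> : Num.truncn (n.+1%:R * g z) = k by [].
by apply: truncn_def; move: Sk; rewrite /S /= in_itv/=.
Qed.

Let measurable_comp_ge0 (g : Z -> R) : measurable_fun setT g ->
  (forall z, 0 <= g z) -> measurable_fun setT (fun z => beta z (g z)).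
Proof.
move=> mg g0.
apply: (@emeasurable_fun_cvg _ _ _ _ _ _ (fun n => step_measurable n mg g0)).
move=> z _; have := Gamma_right_continuous (betaB.2 z) (g0 z).
have cvs : (Num.truncn (n.+1%:R * g z)).+1%:R / n.+1%:R @[n --> \oo] --> (g z)^'+.
  move=> A; rewrite /at_right /within /= => -[e /= e0 eA].
  have [N _ HN] := @cvgr_dist_lt _ _ _ _ _ _ _ (@cvg_harmonic R) _ e0.
  exists N => // n Nn /=; apply: eA => /=; last first.
    by rewrite ltr_pdivlMr// mulrC; have /andP[] := truncn_itv (mulr_ge0 (ler0n R n.+1) (g0 z)).
  have /andP[h1 h2] := truncn_itv (mulr_ge0 (ler0n R n.+1) (g0 z)).
  have h3 := HN n Nn; rewrite /= sub0r normrN gtr0_norm// in h3.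
  rewrite distrC ger0_norm; last by rewrite subr_ge0 ler_pdivlMr// mulrC ltW.
  apply: le_lt_trans h3; rewrite /harmonic -[leRHS]mul1r lerBlDr.
  rewrite ler_pdivrMr// mulrDl divfK ?pnatr_eq0// -natr1 addrC lerD2l.
  by rewrite [g z * _]mulrC; exact: h1.
exact: cvg_comp.
Qed.

Lemma in_B_measurable_comp (g : Z -> R) : measurable_fun setT g ->
  measurable_fun setT (fun z => beta z (g z)).
Proof.
move=> mg.
rewrite (_ : (fun z => _) = fun z => if g z < 0 then +oo%E else beta z (Num.max (g z) 0)).
  apply: measurable_fun_ifT => //.
    by apply: measurable_fun_ltr => //; exact: measurable_cst.
  apply: measurable_comp_ge0; last by move=> z; rewrite le_max lexx orbT.
  by apply: measurable_maxr.
apply/funext => z; case: ltP => [g0|//].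
by case: (betaB.2 z) => _ _ _ /(_ _ g0) ->.
Qed.

Lemma measurable_diff_quot (u : Z -> R) (e : R) : measurable_fun setT u ->
  measurable_fun setT (fun z => diff_quot (beta z) (u z) e).
Proof.
move=> mu; apply: emeasurable_funM; last exact: measurable_cst.
apply: emeasurable_funB; last exact: in_B_measurable_comp.
by apply: in_B_measurable_comp; apply: measurable_funD => //; exact: measurable_cst.
Qed.

Lemma measurable_right_deriv (u : Z -> R) : measurable_fun setT u ->
  (forall z, 0 < u z) ->
  measurable_fun setT (fun z => right_deriv (beta z) (u z)).
Proof.
move=> mu u0.
apply: (@emeasurable_fun_cvg _ _ _ _ (fun n z => diff_quot (beta z) (u z) n.+1%:R^-1)).
  by move=> n; exact: measurable_diff_quot.
move=> z _; have [p [-> cv _ _]] := right_deriv_pos (betaB.2 z) (u0 z).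
exact: cvg_comp harmonic_at_right cv.
Qed.

Lemma measurable_left_deriv (u : Z -> R) : measurable_fun setT u ->
  (forall z, 0 < u z) ->
  measurable_fun setT (fun z => left_deriv (beta z) (u z)).
Proof.
move=> mu u0.
apply: (@emeasurable_fun_cvg _ _ _ _ (fun n z => diff_quot (beta z) (u z) (- n.+1%:R^-1))).
  by move=> n; exact: measurable_diff_quot.
move=> z _; have [p [-> /cvg_at_leftNP cv _ _]] := left_deriv_pos (betaB.2 z) (u0 z).
rewrite oppr0 in cv; have := cvg_comp _ _ harmonic_at_right cv.
exact.
Qed.

Variable h : Z -> R.
Hypothesis mh : measurable_fun setT h.
Hypothesis h0 : forall z, 0 <= h z.
Hypothesis h_gt0 : forall z, right_deriv (beta z) 0 = -oo%E -> 0 < h z.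

(** A positive substitute for [h], at which one-sided derivatives are measurable. Where [h] vanishes
    the derivative at 0 is selected instead, so the value 1 is never read. *)
Let h1 z := if 0 < h z then h z else 1.

Let h1_gt0 z : 0 < h1 z. Proof. by rewrite /h1; case: ifP. Qed.

Let m0h : measurable_fun setT (fun z => 0 < h z).
Proof. by apply: measurable_fun_ltr => //; exact: measurable_cst. Qed.

Let mh1 : measurable_fun setT h1.
Proof. by apply: measurable_fun_ifT => //; exact: measurable_cst. Qed.

Lemma bregman_integrand_B : in_B (bregman_integrand beta h).
Proof.
split; last first.
  by move=> z; apply: bregman_delta_Gamma => //; [exact: betaB.2|exact: h_gt0].
move=> s; rewrite /bregman_integrand.
have [s0|s0] := ltP s 0.
  rewrite (_ : (fun z => _) = cst +oo%E); first exact: measurable_cst.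
  by apply/funext => z; rewrite /bregman_delta s0.
pose rd z := if 0 < h z then right_deriv (beta z) (h1 z) else right_deriv (beta z) 0.
pose D z := if h z <= s then rd z else left_deriv (beta z) (h1 z).
have mD : measurable_fun setT D.
  apply: measurable_fun_ifT.
  - by apply: measurable_fun_ler => //; exact: measurable_cst.
  - apply: measurable_fun_ifT => //; first exact: measurable_right_deriv.
    apply: (@emeasurable_fun_cvg _ _ _ _ (fun n z => right_deriv (beta z) n.+1%:R^-1)).
      by move=> n; apply: measurable_right_deriv => // z; rewrite invr_gt0.
    move=> z _; exact: cvg_comp harmonic_at_right (right_deriv0_cvg (betaB.2 z)).
  - exact: measurable_left_deriv.
rewrite (_ : (fun z => _) = fun z => (beta z s - beta z (h z) - D z * (s - h z)%:E)%E).
  apply: emeasurable_funB.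
    apply: emeasurable_funB; [exact: betaB.1|exact: in_B_measurable_comp].
  apply: emeasurable_funM => //; apply/measurable_EFinP.
  by apply: measurable_funB => //; exact: measurable_cst.
apply/funext => z; rewrite /bregman_delta (ltNge s) s0 (ltNge (h z)) h0/=.
have [p [m [[_ pE _ _] _]]] := Gamma_support (betaB.2 z) (h0 z) (@h_gt0 z).
rewrite {1}pE /=; congr (_ - _ * _)%E; rewrite /sgn_deriv /D /rd /h1 subr_ge0.
case: (ltP 0 (h z)) => // hz.
have -> : h z = 0 by apply/eqP; rewrite eq_le hz h0.
by rewrite s0.
Qed.

End measurability.

(** * Separation of convex sets *)

Section dot_product.
Context {R : realType} {d : nat}.
Implicit Types x y z : 'rV[R]_d.

Lemma dotpE x y : dotp x y = (x *m y^T) 0 0.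
Proof. by rewrite mxE; apply: eq_bigr => i _; rewrite mxE. Qed.

Lemma dotpC x y : dotp x y = dotp y x.
Proof. by apply: eq_bigr => i _; rewrite mulrC. Qed.

Lemma dotpDr x y z : dotp x (y + z) = dotp x y + dotp x z.
Proof. by rewrite -big_split; apply: eq_bigr => i _; rewrite mxE mulrDr. Qed.

Lemma dotpZr (k : R) x y : dotp x (k *: y) = k * dotp x y.
Proof. by rewrite mulr_sumr; apply: eq_bigr => i _; rewrite mxE mulrCA. Qed.

Lemma dotpNr x y : dotp x (- y) = - dotp x y.
Proof. by rewrite -scaleN1r dotpZr mulN1r. Qed.

Lemma dotpBr x y z : dotp x (y - z) = dotp x y - dotp x z.
Proof. by rewrite dotpDr dotpNr. Qed.

Lemma dotpDl x y z : dotp (x + y) z = dotp x z + dotp y z.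
Proof. by rewrite dotpC dotpDr !(dotpC z). Qed.

Lemma dotpZl (k : R) x y : dotp (k *: x) y = k * dotp x y.
Proof. by rewrite dotpC dotpZr dotpC. Qed.

Lemma dotpNl x y : dotp (- x) y = - dotp x y.
Proof. by rewrite dotpC dotpNr dotpC. Qed.

Lemma dotpBl x y z : dotp (x - y) z = dotp x z - dotp y z.
Proof. by rewrite dotpC dotpBr !(dotpC z). Qed.

Lemma dotp0l x : dotp 0 x = 0.
Proof. by rewrite -(scale0r 0) dotpZl mul0r. Qed.

Lemma dotp_ge0 x : 0 <= dotp x x.
Proof. by apply: sumr_ge0 => i _; rewrite -expr2 sqr_ge0. Qed.

Lemma dotp_gt0 x : x != 0 -> 0 < dotp x x.
Proof.
move=> x0; rewrite lt_neqAle dotp_ge0 andbT eq_sym; apply: contra x0.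
rewrite psumr_eq0 => [/allP H|i _]; last by rewrite -expr2 sqr_ge0.
apply/eqP/rowP => i; have := H i (mem_index_enum _); rewrite mxE => /eqP/eqP.
by rewrite mulf_eq0 orbb => /eqP.
Qed.

Lemma dotp_sqrD x y (t : R) : dotp (x + t *: y) (x + t *: y) =
  dotp x x + t * (2 * dotp x y + t * dotp y y).
Proof.
by rewrite dotpDl !dotpDr !dotpZl !dotpZr [dotp y x]dotpC; ring.
Qed.

Lemma dotp_continuous (y : 'rV[R]_d) : continuous (fun x : 'rV[R]_d => dotp x y).
Proof.
apply: continuous_big => [|i _ x]; first by move=> p; exact: add_continuous.
by apply: continuousM; [exact: coord_continuous|exact: cst_continuous].
Qed.

End dot_product.

Section convex_sets.
Context {R : realType} {n : nat}.
Implicit Types E S : set 'rV[R]_n.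

(** A basis of the linear span of [S] with elements in [S]: take a matrix of maximal rank among
    those with rows in [S] and keep independent rows. *)
Lemma spanning_rows S : exists k (M : 'M[R]_(k, n)),
  [/\ row_free M, forall i, S (row i M) & forall x, S x -> (x <= M)%MS].
Proof.
pose P r := `[< exists m (M : 'M[R]_(m, n)), (forall i, S (row i M)) /\ \rank M = r >].
have P0 : exists r, P r.
  by exists 0%N; apply/asboolP; exists 0%N, 0; split; [case|rewrite mxrank0].
have Pn r : P r -> (r <= n)%N.
  by move=> /asboolP[m [M [_ <-]]]; exact: rank_leq_col.
case: (ex_maxnP P0 Pn) => r /asboolP[m [M [MS rM]]] rmax.
exists (\rank M), (rowsub (maxrankfun M) M); split.
- exact: maxrowsub_free.
- by move=> i; rewrite row_rowsub; exact: MS.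
- move=> x Sx; rewrite eq_maxrowsub.
  apply: submx_trans (_ : (col_mx M x <= M)%MS); first by rewrite -addsmxE addsmxSr.
  have sub : (M <= col_mx M x)%MS by rewrite -addsmxE addsmxSl.
  rewrite -(geq_leqif (mxrank_leqif_sup sub)) rM; apply: rmax; apply/asboolP.
  exists (m + 1)%N, (col_mx M x); split=> // i.
  by case: (split_ordP i) => j ->; rewrite ?rowKu ?rowKd// (ord1 j) row_id.
Qed.

Definition convexV E := forall x y t, E x -> E y -> 0 < t < 1 ->
  E ((1 - t) *: x + t *: y).

Lemma convexV_comb E m (c : 'I_m -> R) (x : 'I_m -> 'rV[R]_n) : convexV E ->
  (forall i, 0 <= c i) -> \sum_i c i = 1 -> (forall i, E (x i)) ->
  E (\sum_i c i *: x i).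
Proof.
move=> cE; elim: m c x => [|m IH] c x c0 c1 Ex.
  by move: c1; rewrite big_ord0 => /eqP; rewrite eq_sym oner_eq0.
move: c1; rewrite !big_ord_recl => c1.
have s0 : 0 <= \sum_(i < m) c (lift ord0 i) by apply: sumr_ge0.
have [s00|sn0] := eqVneq (\sum_(i < m) c (lift ord0 i)) 0.
  rewrite (big1 _ _ (fun i => c (lift ord0 i) *: _)).
    by move: c1; rewrite s00 addr0 => ->; rewrite scale1r addr0.
  move=> i _; move/eqP: s00; rewrite psumr_eq0// => /allP /(_ i (mem_index_enum _)) /eqP ->.
  by rewrite scale0r.
have cE0 : c ord0 = 1 - \sum_(i < m) c (lift ord0 i) by rewrite -c1 addrK.
set s := \sum_(i < m) c (lift ord0 i) in s0 sn0 cE0 c1 *.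
have sgt : 0 < s by rewrite lt_neqAle eq_sym sn0.
have E1 : E (\sum_(i < m) (c (lift ord0 i) / s) *: x (lift ord0 i)).
  apply: IH => [i||i] //; first by rewrite divr_ge0.
  by rewrite -mulr_suml divff.
have := c0 ord0; rewrite le_eqVlt => /predU1P[c00|c0gt].
  have s1 : s = 1 by move: c1; rewrite -c00 add0r.
  rewrite -c00 scale0r add0r; move: E1; rewrite s1.
  by under eq_bigr do rewrite divr1.
have -> : \sum_(i < m) c (lift ord0 i) *: x (lift ord0 i) =
    s *: \sum_(i < m) (c (lift ord0 i) / s) *: x (lift ord0 i).
  rewrite scaler_sumr; apply: eq_bigr => i _.
  by rewrite scalerA mulrC divfK.
by rewrite cE0; apply: cE => //; rewrite sgt/=; lra.
Qed.

End convex_sets.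

Section separation.
Context {R : realType}.

Definition simplex m : set 'rV[R]_m :=
  [set v : 'rV[R]_m | forall i, v ord0 i \in `[0, 1]] `&` [set v : 'rV[R]_m | dotp v (const_mx 1) = 1].

Arguments simplex : clear implicits.

Lemma compact_simplex m : compact (simplex m).
Proof.
have c01 : compact [set v : 'rV[R]_m | forall i, v ord0 i \in `[0, 1]].
  apply: (@rV_compact R m (fun=> `[0, 1]%classic)).
  by move=> _; exact: segment_compact.
apply: compact_closedI => //.
apply: (@closed_comp _ _ (fun v : 'rV[R]_m => dotp v (const_mx 1)) [set x | x = 1]).
  by move=> v _; exact: dotp_continuous.
exact: closed_eq.
Qed.

Lemma simplexP m (v : 'rV[R]_m) :
  simplex m v <-> (forall i, 0 <= v 0 i) /\ \sum_i v 0 i = 1.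
Proof.
have E : dotp v (const_mx 1) = \sum_i v 0 i.
  by apply: eq_bigr => i _; rewrite mxE mulr1.
rewrite /simplex /= E; split=> -[v0 v1]; split=> // i.
  by have := v0 i; rewrite in_itv/= => /andP[].
rewrite in_itv/= v0/= -v1 (bigD1 i)//= lerDl; exact: sumr_ge0.
Qed.

(* [y] is the point of minimal norm in the convex hull of the rows. *)
Lemma gordan m d (X : 'M[R]_(m, d)) : (0 < m)%N ->
  (forall c : 'rV[R]_m, simplex m c -> c *m X != 0) ->
  exists y : 'rV[R]_d, forall i, 0 < dotp y (row i X).
Proof.
move=> m0 X0; pose q (c : 'rV[R]_m) := dotp (c *m X) (c *m X).
have delta_simplex i : simplex m (delta_mx 0 i).
  apply/simplexP; split=> [j|]; first by rewrite mxE eqxx; case: (j == i).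
  rewrite (bigD1 i)//= mxE !eqxx big1 ?addr0// => j ji.
  by rewrite mxE (negbTE ji) andbF.
have ne : simplex m !=set0 by exists (delta_mx 0 (Ordinal m0)).
have cq : continuous q.
  apply: continuous_big => [|i _ x]; first by move=> p; exact: add_continuous.
  have h : continuous (fun c : 'rV[R]_m => (c *m X) 0 i).
    rewrite (_ : (fun c => _) = fun c => dotp c (row i X^T)).
      exact: dotp_continuous.
    by apply/funext => c; rewrite mxE; apply: eq_bigr => j _; rewrite !mxE.
  by apply: continuousM; exact: h.
have [c0 /set_mem c0s c0min] :=
  EVT_min_rV ne (@compact_simplex m) (continuous_subspaceT cq).
exists (c0 *m X) => i.
have y0 := dotp_gt0 (X0 _ c0s).
set y := c0 *m X in y0 *; set x := row i X.
apply: (lt_le_trans y0).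
(* A move from the minimizer towards the vertex [i] cannot decrease the norm. Divided by [t], the
   change of the squared norm shows that [dotp y (x - y)] is not negative. *)
have key t : 0 < t -> t <= 1 -> 0 <= 2 * dotp y (x - y) + t * dotp (x - y) (x - y).
  move=> t0 t1; pose c := (1 - t) *: c0 + t *: delta_mx 0 i.
  have cs : simplex m c.
    have [c00 c01] := (simplexP c0).1 c0s.
    have [e00 e01] := (simplexP _).1 (delta_simplex i).
    apply/simplexP; split=> [j|].
      have -> : c 0 j = (1 - t) * c0 0 j + t * (delta_mx 0 i : 'rV[R]_m) 0 j.
        by rewrite !mxE.
      by rewrite addr_ge0// mulr_ge0// ?subr_ge0// ltW.
    transitivity (\sum_j ((1 - t) * c0 0 j + t * (delta_mx 0 i : 'rV[R]_m) 0 j)).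
      by apply: eq_bigr => j _; rewrite !mxE.
    by rewrite big_split/= -!mulr_sumr c01 e01 !mulr1 subrK.
  have := c0min c (mem_set cs).
  have cX : c *m X = y + t *: (x - y).
    rewrite mulmxDl -!scalemxAl -rowE scalerBr scalerBl scale1r /y /x.
    by rewrite -addrA [- _ + _]addrC.
  by rewrite /q cX -/y dotp_sqrD lerDl pmulr_rge0.
rewrite -subr_ge0 -dotpBr leNgt; apply/negP => neg.
set u := dotp y (x - y) in key neg; set v := dotp (x - y) (x - y) in key.
have v0 : 0 <= v := dotp_ge0 _.
(* This [t] is small enough to make [2 * u + t * v] negative when [u] is. *)
have t0 : 0 < Num.min 1 (- u / (v + 1)).
  by rewrite lt_min ltr01 divr_gt0// ?oppr_gt0// ltr_wpDl.
have := key _ t0 _; rewrite ge_min lexx => /(_ isT).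
have : Num.min 1 (- u / (v + 1)) * (v + 1) <= - u.
  by rewrite -ler_pdivlMr ?ltr_wpDl// ge_min lexx orbT.
by move: t0; set t := Num.min _ _; lra.
Qed.

(* Finitely many points of [E] are handled by Gordan's theorem; normalizing the
   functional to have coordinates in a simplex with respect to a basis taken
   from [E] gives compactness, and forces it to be positive on a basis vector. *)
Lemma proper_separation d (E : set 'rV[R]_d) : convexV E -> E !=set0 -> ~ E 0 ->
  exists theta, (forall x, E x -> 0 <= dotp theta x) /\
    exists2 x, E x & 0 < dotp theta x.
Proof.
move=> cE [x0 Ex0] E0.
have [k [M [Mfree ME Mspan]]] := spanning_rows E.
have k0 : (0 < k)%N.
  case: k M Mfree ME Mspan => // M _ _ /(_ _ Ex0)/submxP[D]; rewrite [M]flatmx0 mulmx0 => x00.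
  by rewrite x00 in Ex0.
pose c (x : 'rV[R]_d) := x *m pinvmx M.
have cK x : E x -> c x *m M = x by move=> Ex; rewrite /c mulmxKpV// Mspan.
have comp := @compact_simplex k; rewrite compact_In0 in comp.
have [||eta etaE] := comp 'rV[R]_d E
    (fun x => simplex k `&` [set eta | 0 <= dotp eta (c x)]).
- exists (fun x => [set eta | 0 <= dotp eta (c x)]) => // x _.
  apply: (@closed_comp _ _ (fun v : 'rV[R]_k => dotp v (c x)) [set x | 0 <= x]).
    by move=> v _; exact: dotp_continuous.
  exact: closed_ge.
- move=> D DE; pose s := finmap.enum_fset D.
  (* Stacking the basis on the finite family makes [y] positive on every basis row, so its values
     there can be rescaled to a point of the simplex. *)
  pose X := col_mx M (\matrix_(i < size s) s`_i).
  have XE i : E (row i X).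
    case: (split_ordP i) => j ->; rewrite ?rowKu ?rowKd//.
    rewrite rowK; apply/set_mem/DE; exact: mem_nth.
  have [|v vs|y yX] := @gordan _ _ X.
  + by rewrite addn_gt0 k0.
  + apply/eqP => vX; apply: E0; rewrite -vX mulmx_sum_row.
    have [v0 v1] := (simplexP v).1 vs; exact: convexV_comb.
  have yM i : 0 < dotp y (row i M) by have := yX (lshift _ i); rewrite rowKu.
  have yD x : x \in D -> 0 < dotp y x.
    move=> xD; have xs : (index x s < size s)%N by rewrite index_mem.
    have := yX (rshift _ (Ordinal xs)); rewrite rowKd rowK /= nth_index//.
  pose w := \sum_i dotp y (row i M).
  have w0 : 0 < w.
    rewrite /w (bigD1 (Ordinal k0))//= ltr_wpDr// sumr_ge0// => i _; exact: ltW.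
  pose eta := \row_i (dotp y (row i M) / w).
  have es : simplex k eta.
    apply/simplexP; split=> [i|]; first by rewrite mxE divr_ge0// ltW.
    under eq_bigr do rewrite mxE.
    by rewrite -mulr_suml divff// gt_eqF.
  exists eta => x xD; split=> //=.
  have Ex : E x by apply/set_mem/DE.
  suff -> : dotp eta (c x) = dotp y x / w by rewrite divr_ge0// ltW// yD.
  have -> : dotp y x = \sum_i c x 0 i * dotp y (row i M).
    rewrite -{1}(cK x Ex) mulmx_sum_row dotpC.
    elim/big_rec2 : _ => [|i a b _ <-]; first by rewrite dotp0l.
    by rewrite dotpDl dotpZl (dotpC (row i M)).
  rewrite mulr_suml; apply: eq_bigr => i _; rewrite mxE; lra.
exists (eta *m (pinvmx M)^T).
have dE x : dotp (eta *m (pinvmx M)^T) x = dotp eta (c x).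
  by rewrite !dotpE /c [(x *m _)^T]trmx_mul mulmxA.
split=> [x Ex|]; first by rewrite dE; have [] := etaE x Ex.
have [e0 e1] := (simplexP eta).1 (etaE x0 Ex0).1.
have [i ei] : exists i, 0 < eta 0 i.
  apply: contrapT => /forallNP H.
  have : \sum_i eta 0 i <= 0 by apply: sumr_le0 => i _; rewrite leNgt; apply/negP/H.
  by rewrite e1 ler10.
exists (row i M) => //; rewrite dE /c rowE -mulmxA mulmxVp// mulmx1.
rewrite /dotp (bigD1 i)//= big1 => [|j ji]; last by rewrite mxE (negbTE ji) andbF mulr0.
by rewrite mxE !eqxx mulr1 addr0.
Qed.

End separation.

(** * Faces of the moment cone *)

Section faces_of_cones.
Context {R : realType} {d : nat}.
Implicit Types (C F S : set 'rV[R]_d) (x y m w a : 'rV[R]_d).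

Lemma closure_orthogonal S w : (forall x, S x -> dotp x w = 0) ->
  forall v, closure S v -> dotp v w = 0.
Proof.
move=> Sw v; have cl : closed [set x | dotp x w = 0].
  apply: (@closed_comp _ _ (fun v : 'rV[R]_d => dotp v w) [set x | x = 0]).
    by move=> u _; exact: dotp_continuous.
  exact: closed_eq.
have sub : S `<=` [set x | dotp x w = 0] by move=> x /Sw.
by move=> /(closureS sub); rewrite -((closure_id _).1 cl).
Qed.

Lemma near_forall_dotp k (P : 'M[R]_(d, k)) a (e : R) : 0 < e ->
  \forall y \near a, forall i, `|((y - a) *m P) 0 i| < e.
Proof.
move=> e0.
apply: (@filter_forall _ 'I_k (fun i y => `|((y - a) *m P) 0 i| < e) (nbhs a)) => i.
have cv := @dotp_continuous R d (row i P^T) a.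
have near_e : \forall y \near a, `|dotp a (row i P^T) - dotp y (row i P^T)| < e.
  exact: (@cvgr_dist_lt _ _ _ _ _ _ _ cv _ e0).
apply: (@filterS _ (nbhs a)) near_e => y.
rewrite -dotpBl /=.
have -> : ((y - a) *m P) 0 i = - dotp (a - y) (row i P^T).
  rewrite -[a - y]opprB dotpNl opprK mxE.
  by apply: eq_bigr => j _; rewrite !mxE.
by rewrite normrN.
Qed.

(** Since [S] contains 0, the weight [s] that a linear combination lacks can be placed on 0. *)
Lemma span_affine_hull S k (M : 'M[R]_(k, d)) x : S 0 -> (forall i, S (row i M)) ->
  (x <= M)%MS -> affine_hull S x.
Proof.
move=> S0 SM /submxP[D ->].
exists k.+1, (fun i => oapp (fun j => row j M) 0 (unlift ord0 i)).
pose s : R := 1 - \sum_j D 0 j.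
exists (fun i => oapp (fun j => D 0 j) s (unlift ord0 i)).
split.
- by move=> i; case: (unlift ord0 i).
- rewrite big_ord_recl unlift_none (eq_bigr (fun j => D 0 j)) => [|j _].
    by rewrite /= /s subrK.
  by rewrite liftK.
- rewrite big_ord_recl unlift_none [oapp _ _ None]/= scaler0 add0r mulmx_sum_row.
  by apply: eq_bigr => i _; rewrite liftK.
Qed.

Lemma affine_hull_span S k (M : 'M[R]_(k, d)) y :
  (forall x, S x -> (x <= M)%MS) -> affine_hull S y -> (y <= M)%MS.
Proof.
move=> SM [n [p [c [Sp _ ->]]]]; apply: summx_sub => i _.
by apply: scalemx_sub; exact: SM.
Qed.

Lemma segment_pointE x y (t : R) : segment_point x y t = (1 - t) *: x + t *: y.
Proof. by []. Qed.

Variable C : set 'rV[R]_d.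
Hypothesis C0 : C 0.
Hypothesis CD : forall x y, C x -> C y -> C (x + y).
Hypothesis CZ : forall (t : R) x, 0 <= t -> C x -> C (t *: x).

Let closed_segment_cone x y : C x -> C y -> closed_segment x y `<=` C.
Proof.
move=> Cx Cy _ [t /= /andP[t0 t1] <-]; apply: CD; apply: CZ => //.
by rewrite subr_ge0.
Qed.

(** The face consists of the points dominated by a multiple of [a] in the order of the cone. Each
    row of a basis taken from it satisfies such a bound, so a small perturbation of [a] within the
    span is dominated by [2 *: a] and stays in the cone. *)
Lemma cone_face_exists a : C a -> exists F, is_face C F /\ relint F a.
Proof.
move=> Ca; pose F := [set x | C x /\ exists2 l : R, 0 < l & C (l *: a - x)].
have Fa : F a.
  by split=> //; exists 2 => //; rewrite scaler_nat mulr2n addrK.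
have F0 : F 0 by split=> //; exists 1 => //; rewrite scale1r subr0.
have FZ (t : R) x : 0 <= t -> F x -> F (t *: x).
  move=> t0 [Cx [l l0 Cl]]; split; first exact: CZ.
  exists (t * l + 1); first by rewrite ltr_wpDl// mulr_ge0// ltW.
  rewrite scalerDl scale1r addrAC -scalerA -scalerBr; apply: CD => //; exact: CZ.
have FD x y : F x -> F y -> F (x + y).
  move=> [Cx [l l0 Cl]] [Cy [l' l'0 Cl']]; split; first exact: CD.
  exists (l + l'); first exact: addr_gt0.
  by rewrite scalerDl opprD addrACA; exact: CD.
have Fsub x y : C x -> C y -> F (x + y) -> F x.
  move=> Cx Cy [_ [l l0 Cl]]; split=> //; exists l => //.
  by have := CD Cl Cy; rewrite opprD addrA subrK.
exists F; split; last first.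
  split=> //.
  have [k [M [_ MF Mspan]]] := spanning_rows F.
  have lamP i : exists l : R, 0 < l /\ C (l *: a - row i M).
    by have [_ [l l0 Cl]] := MF i; exists l.
  pose lam i := sval (cid (lamP i)).
  have lam0 i : 0 < lam i by rewrite /lam; case: cid => ? [].
  have Clam i : C (lam i *: a - row i M) by rewrite /lam; case: cid => ? [].
  (* Coordinates below [L^-1] make the sum of the [|c 0 i| * lam i] at most 1, which leaves a
     nonnegative multiple of [a]. The added 1 keeps [L] positive for an empty basis. *)
  pose L := \sum_i lam i + 1.
  have L0 : 0 < L by rewrite ltr_wpDl// sumr_ge0// => i _; exact: ltW.
  have e0 : 0 < L^-1 by rewrite invr_gt0.
  near=> y => affy.
  have c_lt : forall i, `|((y - a) *m pinvmx M) 0 i| < L^-1.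
    by near: y; exact: near_forall_dotp.
  pose c := (y - a) *m pinvmx M.
  rewrite -/c in c_lt; have cM : c *m M = y - a.
    apply: mulmxKpV; apply: addmx_sub; first exact: affine_hull_span affy.
    by rewrite eqmx_opp; exact: Mspan.
  (* One sign puts [y] in the cone, the other puts [2 *: a - y] there. *)
  have key (s : bool) : C (a + (-1) ^+ s *: (y - a)).
    rewrite -cM mulmx_sum_row scaler_sumr.
    have -> : a + \sum_(i < k) (-1) ^+ s *: (c 0 i *: row i M) =
        (1 - \sum_i `|c 0 i| * lam i) *: a +
        \sum_i (`|c 0 i| * lam i) *: a + \sum_(i < k) (-1) ^+ s *: (c 0 i *: row i M).
      by rewrite -scaler_suml -scalerDl subrK scale1r.
    rewrite -addrA -big_split /=; apply: CD.
      apply: CZ => //; rewrite subr_ge0.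
      apply: (@le_trans _ _ (\sum_i L^-1 * lam i)).
        by apply: ler_sum => i _; rewrite ler_wpM2r// ltW.
      by rewrite -mulr_sumr mulrC ler_pdivrMr// mul1r lerDl.
    elim/big_ind : _ => // i _.
    rewrite scalerA; have [si|si] := leP 0 ((-1) ^+ s * c 0 i).
      apply: CD; apply: CZ => //; first by rewrite mulr_ge0// ltW.
      by have [] := MF i.
    have -> : (-1) ^+ s * c 0 i = - `|c 0 i|.
      have := ltr0_norm si; rewrite normrM normr_sign mul1r => ->.
      by rewrite opprK.
    by rewrite -scalerA scaleNr -scalerBr; exact: CZ.
  split; first by have := key false; rewrite expr0 scale1r addrC subrK.
  exists 2 => //; have := key true; rewrite expr1 scaleN1r opprB.
  by rewrite scaler_nat mulr2n addrA.
split.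
- by exists a.
- move=> x y l /set_mem Fx /set_mem Fy; apply/mem_set.
  have l0 : 0 <= (l%:inum : R) by [].
  have l1 : 0 <= 1 - (l%:inum : R) by rewrite subr_ge0.
  exact: FD (FZ _ x l0 Fx) (FZ _ y l1 Fy).
- by move=> x [].
- move=> x y xyC [_ [[t /= /andP[t0 t1] <-] Fz]].
  have Cx : C x by apply: xyC; exists 0; rewrite /= ?lexx ?ler01// segment_pointE subr0 scale1r scale0r addr0.
  have Cy : C y by apply: xyC; exists 1; rewrite /= ?lexx ?ler01// segment_pointE subrr scale1r scale0r add0r.
  have t1' : 0 < 1 - t by rewrite subr_gt0.
  have Fx : F x.
    have /Fsub : C ((1 - t) *: x) by apply: CZ => //; exact: ltW.
    move=> /(_ (t *: y) (CZ (ltW t0) Cy) Fz) /(FZ (1 - t)^-1).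
    by rewrite invr_ge0 ltW// => /(_ isT); rewrite scalerA mulVf ?gt_eqF// scale1r.
  have Fy : F y.
    have /Fsub : C (t *: y) by apply: CZ => //; exact: ltW.
    rewrite segment_pointE addrC in Fz.
    move=> /(_ ((1 - t) *: x) (CZ (ltW t1') Cx) Fz) /(FZ t^-1).
    by rewrite invr_ge0 ltW// => /(_ isT); rewrite scalerA mulVf ?gt_eqF// scale1r.
  by move=> _ [s /= /andP[s0 s1] <-]; apply: FD; apply: FZ => //; rewrite subr_ge0.
Unshelve. all: by end_near. Qed.

Variables (F : set 'rV[R]_d).
Hypothesis Fface : is_face C F.

(** The point [x + y] is the midpoint of [2 *: x] and [2 *: y], so [2 *: x] lies in the face. The
    segment from 0 to [3 *: z], with [2 *: z] inside, then brings [2 *: z] down to [z]. *)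
Lemma face_add x y : C x -> C y -> F (x + y) -> F x.
Proof.
case: Fface => _ _ FC seg Cx Cy Fxy.
have seg2 : closed_segment 0 (2 *: (x + y)) `<=` F.
  apply: seg; first by apply: closed_segment_cone => //; apply: CZ => //; exact: CD.
  exists (x + y); split=> //; exists 2^-1 => /=; first by lra.
  by rewrite segment_pointE scaler0 add0r scalerA mulVf ?scale1r.
have F0 : F 0.
  by apply: seg2; exists 0; rewrite /= ?lexx ?ler01// segment_pointE scaler0 scale0r addr0.
have F2 z : F (2 *: z) -> F z.
  move=> F2z; apply: (seg 0 (3 *: z)).
  - apply: closed_segment_cone => //.
    have -> : 3 *: z = (3 / 2 : R) *: (2 *: z) by rewrite scalerA divfK.
    by apply: CZ; [lra|exact: FC].
  - exists (2 *: z); split=> //; exists (2 / 3); first by rewrite /=; lra.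
    by rewrite segment_pointE scaler0 add0r scalerA divfK.
  - exists (1 / 3); first by rewrite /=; lra.
    by rewrite segment_pointE scaler0 add0r scalerA divfK// scale1r.
apply: F2; apply: (seg (2 *: x) (2 *: y)).
- by apply: closed_segment_cone; apply: CZ.
- exists (x + y); split=> //; exists 2^-1; first by rewrite /=; lra.
  rewrite segment_pointE !scalerA mulVf// mulrBl mulVf// mul1r.
  by rewrite (_ : 2 - 1 = 1 :> R) ?scale1r//; ring.
- by exists 0; rewrite /= ?lexx ?ler01// segment_pointE subr0 scale0r addr0 scale1r.
Qed.

Lemma face0 : F 0.
Proof.
case: Fface => -[x Fx] _ FC _; have Cx := FC _ Fx.
by apply: (@face_add 0 x) => //; rewrite add0r.
Qed.

(** The segment from 0 to [(t + 2) *: x] contains [t *: x] and has [x] in its interior, even for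
    [t = 0]. *)
Lemma faceZ (t : R) x : 0 <= t -> F x -> F (t *: x).
Proof.
move=> t0 Fx; case: Fface => _ _ FC seg; have Cx := FC _ Fx.
have t1 : 0 < t + 1 by rewrite ltr_wpDl.
have t2 : 1 < t + 2 by lra.
have t20 : 0 < t + 2 by lra.
apply: (seg 0 ((t + 2) *: x)).
- by apply: closed_segment_cone => //; apply: CZ => //; exact: ltW.
- exists x; split=> //; exists (t + 2)^-1 => /=.
    by rewrite invr_gt0 t20/= invf_lt1.
  by rewrite segment_pointE scaler0 add0r scalerA mulVf ?gt_eqF// scale1r.
- exists (t / (t + 2)) => /=.
    by rewrite divr_ge0 ?(ltW t20)//= ler_pdivrMr// mul1r lerDl.
  by rewrite segment_pointE scaler0 add0r scalerA divfK ?gt_eqF.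
Qed.

Variable a : 'rV[R]_d.
Hypothesis Fa : relint F a.

(** The hypothesis says that [m] lies in the span of [F], in a form that can be checked under an
    integral. As [F] contains 0, moving from [a] along [m] stays in the affine hull, and a short
    enough move stays in [F]. *)
Lemma relint_sub m : (forall w, (forall x, F x -> dotp x w = 0) -> dotp m w = 0) ->
  exists2 e : R, 0 < e & F (a - e *: m).
Proof.
move=> mF; have [Fa' nF] := Fa.
have [k [M [_ MF Mspan]]] := spanning_rows F.
have mM : (m <= M)%MS.
  rewrite submxE; apply/eqP/rowP => j; rewrite [in RHS]mxE.
  have -> : (m *m cokermx M) 0 j = dotp m (row j (cokermx M)^T).
    by rewrite mxE; apply: eq_bigr => i _; rewrite !mxE.
  apply: mF => x /Mspan; rewrite submxE => /eqP/rowP/(_ j).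
  rewrite [in RHS]mxE => <-.
  by rewrite mxE; apply: eq_bigr => i _; rewrite !mxE.
have cv : a - e *: m @[e --> (0 : R)^'+] --> a - 0 *: m.
  apply: cvgB; first exact: cvg_cst.
  by apply: cvgZr_tmp; exact/cvg_at_right_filter/cvg_id.
rewrite scale0r subr0 in cv.
have near_e : \forall e \near (0 : R)^'+, affine_hull F (a - e *: m) -> F (a - e *: m).
  exact: cv nF.
have [e [e0 He]] : exists e, 0 < e /\ (affine_hull F (a - e *: m) -> F (a - e *: m)).
  near (0 : R)^'+ => e; exists e; split => //; near: e; exact: near_e.
exists e => //; apply: He; apply: (span_affine_hull face0 MF).
apply: addmx_sub; first exact: Mspan.
by rewrite eqmx_opp; exact: scalemx_sub.
Unshelve. all: by end_near. Qed.

End faces_of_cones.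

(** * Moments and the moment cone *)

Section moments.
Context {disp : measure_display} {Z : measurableType disp} {R : realType}.
Variable mu : {sigma_finite_measure set Z -> \bar R}.
Context {d : nat}.
Variable phi : Z -> 'rV[R]_d.
Hypothesis phi_meas : forall i, measurable_fun setT (fun z => phi z 0 i).
Implicit Types (g : Z -> R) (A : set Z).
Local Notation momentG := (momentG mu phi).
Local Notation moment := (moment mu phi).

Lemma momentG_comb (s t : R) g g' : momentG g -> momentG g' ->
  momentG (fun z => s * g z + t * g' z) /\
  moment (fun z => s * g z + t * g' z) = s *: moment g + t *: moment g'.
Proof.
move=> [mg ig] [mg' ig'].
have E i : (fun z => phi z 0 i * (s * g z + t * g' z)) =
    (fun z => s * (phi z 0 i * g z) + t * (phi z 0 i * g' z)).
  by apply/funext => z; ring.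
have iZ (k : R) f : mu.-integrable setT (EFin \o f) ->
    mu.-integrable setT (EFin \o (fun z => k * f z)).
  by move=> /(integrableZl measurableT k); apply: eq_integrable.
split; first split.
- by apply: measurable_funD; apply: measurable_funM => //; exact: measurable_cst.
- move=> i.
  have := integrableD measurableT (iZ s _ (ig i)) (iZ t _ (ig' i)).
  by apply: eq_integrable => // z _; rewrite /= -EFinD; congr EFin; ring.
- apply/rowP => i; rewrite !mxE E.
  rewrite (RintegralD measurableT (iZ s _ (ig i)) (iZ t _ (ig' i))).
  by rewrite (RintegralZl _ measurableT (ig i)) (RintegralZl _ measurableT (ig' i)).
Qed.

Lemma momentG0 : momentG (cst 0) /\ moment (cst 0) = 0.
Proof.
have E i : (fun z => phi z 0 i * cst 0 z) = cst 0 by apply/funext => z; rewrite mulr0.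
split; first split.
- exact: measurable_cst.
- move=> i; rewrite (_ : (fun z => _) = cst 0%E); first exact: integrable0.
  by apply/funext => z; rewrite /= mulr0.
- apply/rowP => i; rewrite !mxE E /Rintegral.
  by rewrite (eq_integral (cst 0%E))// integral0.
Qed.

Lemma momentG_restrict g A : measurable A -> momentG g -> momentG (g \_ A).
Proof.
move=> mA [mg ig].
have mgA : measurable_fun setT (g \_ A).
  by apply/(measurable_restrictT _ mA); exact: measurable_funTS.
split=> // i; apply: le_integrable (ig i) => //.
  by apply/measurable_EFinP; apply: measurable_funM.
by move=> z _; rewrite lee_fin !normrM ler_wpM2l// patchE; case: ifP; rewrite // normr0.
Qed.

Lemma dotp_moment g (theta : 'rV[R]_d) : momentG g ->
  mu.-integrable setT (fun z => (dotp theta (phi z) * g z)%:E) /\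
  (\int[mu]_z (dotp theta (phi z) * g z)%:E = (dotp theta (moment g))%:E)%E.
Proof.
move=> [mg ig].
have E : (fun z => (dotp theta (phi z) * g z)%:E) =
    (fun z => \sum_(i < d) (theta 0 i)%:E * (phi z 0 i * g z)%:E)%E.
  apply/funext => z; under eq_bigr do rewrite -EFinM.
  by rewrite sumEFin /dotp mulr_suml; congr EFin; apply: eq_bigr => i _; ring.
have iZ i : mu.-integrable setT (fun z => (theta 0 i)%:E * (phi z 0 i * g z)%:E)%E.
  exact: integrableZl.
rewrite E; split; first exact: integrable_sum.
rewrite integral_sum//.
rewrite /dotp -sumEFin; apply: eq_bigr => i _.
rewrite integralZl// EFinM /moment mxE; congr (_ * _)%E.
by rewrite /Rintegral fineK//; exact: integrable_fin_num.
Qed.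

Lemma measurable_dotp (theta : 'rV[R]_d) :
  measurable_fun setT (fun z => dotp theta (phi z)).
Proof.
rewrite /dotp; apply: measurable_sum => i.
by apply: measurable_funM => //; exact: measurable_cst.
Qed.

Lemma moment_ae g g' : measurable_fun setT g' -> g = g' %[ae mu] -> momentG g ->
  momentG g' /\ moment g' = moment g.
Proof.
move=> mg' gg' [mg ig].
have mphi f i : measurable_fun setT f ->
    measurable_fun setT (fun z => (phi z 0 i * f z)%:E).
  by move=> mf; apply/measurable_EFinP; exact: measurable_funM.
have aeE i : ae_eq mu setT (fun z => (phi z 0 i * g z)%:E) (fun z => (phi z 0 i * g' z)%:E).
  by apply: filterS gg' => z /= + _ => ->.
split; first split => // i.
  have := ig i; move=> /integrableP[mi fi]; apply/integrableP; split; first exact: mphi.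
  suff <- : (\int[mu]_z `|(phi z 0 i * g z)%:E| = \int[mu]_z `|(phi z 0 i * g' z)%:E|)%E.
    by [].
  apply: ae_eq_integral => //.
  - by apply: measurableT_comp => //; exact: mphi.
  - by apply: measurableT_comp => //; exact: mphi.
  - by apply: filterS (aeE i) => z /(_ I) + _ => ->.
apply/rowP => i; rewrite !mxE /Rintegral; congr fine.
apply: ae_eq_integral => //; [exact: mphi|exact: mphi|].
exact: ae_eq_sym.
Qed.

Let C := cn mu phi.

Lemma cn0 : C 0.
Proof.
by have [G0 m0] := momentG0; exists (cst 0) => //; split=> // z; exact: lexx.
Qed.

Lemma cnZD (s t : R) x y : 0 <= s -> 0 <= t -> C x -> C y -> C (s *: x + t *: y).
Proof.
move=> s0 t0 [g [Gg g0] <-] [g' [Gg' g'0] <-].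
have [G E] := momentG_comb s t Gg Gg'.
exists (fun z => s * g z + t * g' z) => //; split=> // z.
by rewrite addr_ge0// mulr_ge0.
Qed.

Lemma cnD x y : C x -> C y -> C (x + y).
Proof. by move=> Cx Cy; rewrite -[x]scale1r -[y]scale1r; exact: cnZD. Qed.

Lemma cnZ (t : R) x : 0 <= t -> C x -> C (t *: x).
Proof.
by move=> t0 Cx; rewrite -[_ *: _]addr0 -(scale0r x); exact: cnZD.
Qed.

Lemma face_atP a : C a -> is_face C (face_at C a) /\ relint (face_at C a) a.
Proof.
move=> Ca; apply: (@xgetPex _ set0 [set F | is_face C F /\ relint F a]).
apply: cone_face_exists => //; [exact: cn0|exact: cnD|exact: cnZ].
Qed.

End moments.

(** * Functions whose moment lies in a face *)

Section rational_boxes.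
Context {R : realType} {d : nat}.
Variable F : set 'rV[R]_d.
Implicit Types (p : 'rV[rat]_d * rat) (v : 'rV[R]_d).

(** The factor 1/2 keeps a mean of [phi] over the half box strictly inside the open box that avoids
    [F]. *)
Definition half_box p : set 'rV[R]_d :=
  [set v | forall i, `|v 0 i - ratr (p.1 0 i)| <= ratr p.2 / 2].

(* The half boxes of the rational boxes that avoid [F] cover the complement of
   [closure F]: this reduces statements a.e. outside [cl F] to countably many
   boxes. *)
Definition avoiding p := 0 < ratr p.2 :> R /\
  forall x, F x -> ~ forall i, `|x 0 i - ratr (p.1 0 i)| < ratr p.2.

Lemma not_closureP v : ~ closure F v <-> exists2 p, avoiding p & half_box p v.
Proof.
split.
  move=> ncl; have [e e0 He] : exists2 e : R, 0 < e &
      forall x, F x -> ~ forall i, `|v 0 i - x 0 i| < e.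
    apply: contrapT => H; apply: ncl => B /nbhs_ballP[e /= e0 eB].
    apply: contrapT => FB; apply: H; exists e => // x Fx xe; apply: FB.
    by exists x; split=> //; apply: eB; split=> // i j; rewrite (ord1 i); exact: xe.
  have e20 : 0 < e / 2 by rewrite divr_gt0.
  have [rho] := rat_in_itvoo e20.
  rewrite in_itv/= => /andP[rho0 rhoe].
  have qP i : exists q : rat, `|v 0 i - ratr q| <= ratr rho / 2.
    have lt : v 0 i - ratr rho / 2 < v 0 i by lra.
    have [q] := rat_in_itvoo lt.
    rewrite in_itv/= => /andP[q1 q2]; exists q.
    by rewrite ger0_norm; [lra|rewrite subr_ge0 ltW].
  exists (\row_i sval (cid (qP i)), rho).
    split=> //= x Fx xq; apply: (He x Fx) => i.
    have := xq i; rewrite mxE; case: cid => q /= vq xq'.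
    rewrite (le_lt_trans (ler_distD (ratr q) _ _))// (distrC (ratr q)).
    by lra.
  by move=> i /=; rewrite mxE; case: cid.
move=> [[q rho] [/= rho0 av] vb] cl.
have nB : nbhs v [set y : 'rV[R]_d | forall i, `|v 0 i - y 0 i| < ratr rho / 2].
  apply/nbhs_ballP; exists (ratr rho / 2) => /=; first by rewrite divr_gt0.
  by move=> y [_ vy] i; exact: vy.
have [x [Fx /= vx]] := cl _ nB; apply: (av x Fx) => i.
rewrite (le_lt_trans (ler_distD (v 0 i) _ _))// (distrC (x 0 i)).
by have := vx i; have := vb i => /=; lra.
Qed.

End rational_boxes.

Section face_support.
Context {disp : measure_display} {Z : measurableType disp} {R : realType}.
Variable mu : {sigma_finite_measure set Z -> \bar R}.
Context {d : nat}.
Variable phi : Z -> 'rV[R]_d.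
Hypothesis phi_meas : forall i, measurable_fun setT (fun z => phi z 0 i).
Implicit Types (g : Z -> R) (A : set Z) (p : 'rV[rat]_d * rat).
Local Notation momentG := (momentG mu phi).
Local Notation moment := (moment mu phi).
Variable F : set 'rV[R]_d.
Local Notation D := (in_cl phi F).

Let B p : set Z := phi @^-1` half_box p.

Let measurable_B p : measurable (B p).
Proof.
rewrite (_ : B p = \bigcap_(i in [set: 'I_d])
    (fun z => `|phi z 0 i - ratr (p.1 0 i)|) @^-1` [set x | x <= ratr p.2 / 2]); last first.
  by apply/seteqP; split=> z H i; [move=> _; exact: H|exact: (H i I)].
apply: fin_bigcap_measurable => // i _.
rewrite -[X in measurable X]setTI.
have := @measurable_fun_ler _ _ _ setT (fun z => `|phi z 0 i - ratr (p.1 0 i)|)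
  (cst (ratr p.2 / 2)).
move=> /(_ _ (measurable_cst _) measurableT [set true] I); apply.
apply: measurableT_comp => //; apply: measurable_funB => //; exact: measurable_cst.
Qed.

Let nth_box (k : nat) : set Z :=
  if @choice.unpickle ('rV[rat]_d * rat)%type k is Some p then
    if `[< avoiding F p >] then B p else set0 else set0.

Let nth_boxE : ~` D = \bigcup_k nth_box k.
Proof.
apply/seteqP; split=> z.
  move=> /not_closureP[p ap bp]; exists (choice.pickle p) => //.
  by rewrite /nth_box choice.pickleK; case: asboolP.
move=> [k _]; rewrite /nth_box; case: choice.unpickle => // p.
by case: asboolP => // ap bp; apply/not_closureP; exists p.
Qed.

Let measurable_nth_box k : measurable (nth_box k).
Proof. by rewrite /nth_box; case: choice.unpickle => // p; case: ifP. Qed.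

Lemma measurable_in_cl : measurable D.
Proof.
rewrite -[D]setCK; apply: measurableC; rewrite nth_boxE.
exact: bigcupT_measurable.
Qed.

Hypothesis Fface : is_face (cn mu phi) F.

(* Otherwise the mean of [phi] with respect to [g \_ A] is a point of the cone
   [F] in the box [p]. *)
Let box_integral0 p g A : avoiding F p -> measurable A -> A `<=` B p ->
  momentG g -> (forall z, 0 <= g z) -> F (moment (g \_ A)) ->
  mu.-integrable setT (EFin \o (g \_ A)) -> \int[mu]_z (g \_ A) z = 0.
Proof.
move=> [rho0 av] mA AB Gg g0 FA iA; set G := g \_ A in FA iA *.
have G0 z : 0 <= G z by rewrite /G patchE; case: ifP.
have [_ iGA] := momentG_restrict phi_meas mA Gg; rewrite -/G in iGA.
have : 0 <= \int[mu]_z G z by apply: Rintegral_ge0.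
rewrite le_eqVlt => /predU1P[<-//|w0]; exfalso.
set w := \int[mu]_z G z in w0.
apply: (av (w^-1 *: moment G)).
  apply: (faceZ (@cn0 _ _ _ mu _ phi) (@cnD _ _ _ mu _ phi) (@cnZ _ _ _ mu _ phi) Fface) => //.
  by rewrite invr_ge0 ltW.
move=> i; rewrite !mxE; set q : R := ratr _.
have iqG : mu.-integrable setT (EFin \o (fun z => q * G z)).
  by have := integrableZl measurableT q iA; apply: eq_integrable.
have irG : mu.-integrable setT (EFin \o (fun z => ratr p.2 / 2 * G z)).
  by have := integrableZl measurableT (ratr p.2 / 2) iA; apply: eq_integrable.
have -> : w^-1 * \int[mu]_z (phi z 0 i * G z) - q =
    w^-1 * \int[mu]_z (phi z 0 i * G z - q * G z).
  rewrite (RintegralB measurableT (iGA i) iqG) (RintegralZl _ measurableT iA) -/w.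
  by field; rewrite gt_eqF.
rewrite normrM ger0_norm ?invr_ge0 ?(ltW w0)// mulrC ltr_pdivrMr//.
have iB : mu.-integrable setT (EFin \o (fun z => phi z 0 i * G z - q * G z)).
  by have := integrableB measurableT (iGA i) iqG; apply: eq_integrable.
apply: (le_lt_trans (le_normr_Rintegral measurableT iB)).
have le1 : \int[mu]_z `|phi z 0 i * G z - q * G z| <= \int[mu]_z (ratr p.2 / 2 * G z).
  apply: le_Rintegral => //; first exact: (integrable_norm iB).
  move=> z _; rewrite -mulrBl normrM (ger0_norm (G0 z)).
  rewrite /G patchE; case: ifPn => [/set_mem/AB zB|_]; last by rewrite !mulr0.
  by rewrite ler_wpM2r//; exact: zB.
apply: (le_lt_trans le1); rewrite (RintegralZl _ measurableT iA) -/w.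
by rewrite ltr_pM2r//; lra.
Qed.

(** Split [g] into its parts on [A] and off [A]: both moments lie in the cone and their sum lies in
    [F], so [F] contains the moment of [g \_ A]. When [phi] maps [A] into a half box avoiding [F],
    this forces [g] to vanish a.e. on [A]. *)
Lemma face_support g : momentG g -> (forall z, 0 <= g z) -> F (moment g) ->
  {ae mu, forall z, ~ D z -> g z = 0}.
Proof.
move=> Gg g0 Fg; have [mg _] := Gg.
have FA A : measurable A -> F (moment (g \_ A)).
  move=> mA; have mAc := measurableC mA.
  have GA := momentG_restrict phi_meas mA Gg.
  have GAc := momentG_restrict phi_meas mAc Gg.
  have [_ E] := momentG_comb 1 1 GA GAc.
  have gE : (fun z => 1 * (g \_ A) z + 1 * (g \_ (~` A)) z) = g.
    apply/funext => z; rewrite !mul1r !patchE in_setC.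
    by case: (z \in A); rewrite /= ?addr0 ?add0r.
  have C' A' : momentG (g \_ A') -> cn mu phi (moment (g \_ A')).
    by move=> G; exists (g \_ A') => //; split=> // z; rewrite patchE; case: ifP.
  rewrite gE !scale1r in E.
  apply: (face_add (@cn0 _ _ _ mu _ phi) (@cnD _ _ _ mu _ phi)
    (@cnZ _ _ _ mu _ phi) Fface (C' _ GA) (C' _ GAc)).
  by rewrite -E.
have [S [ST Snd Sfin]] := (sigma_finiteP setT mu).1 (sigma_finiteT mu).
(* The bound on [g] and the finite measure of [S n] make [g] integrable on each piece, as
   [box_integral0] requires. These countably many pieces exhaust the points outside [cl F] where [g]
   is positive. *)
have neg k n : mu.-negligible (nth_box k `&` [set z | 0 < g z] `&` [set z | g z <= n%:R] `&` S n).
  rewrite /nth_box; case: (choice.unpickle k) => [p|]; last by rewrite !set0I; exact: negligible_set0.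
  case: asboolP => [ap|_]; last by rewrite !set0I; exact: negligible_set0.
  set A := (_ `&` S n).
  have mA : measurable A.
    apply: measurableI; last exact: (Sfin n).1.
    apply: measurableI; first apply: measurableI => //.
      rewrite -[X in measurable X]setTI.
      have := @measurable_fun_ltr _ _ _ setT (cst 0) g (measurable_cst _) mg.
      by move=> /(_ measurableT [set true] I); rewrite /preimage /=.
    rewrite -[X in measurable X]setTI.
    have := @measurable_fun_ler _ _ _ setT g (cst n%:R) mg (measurable_cst _).
    by move=> /(_ measurableT [set true] I); rewrite /preimage /=.
  have mgA : measurable_fun setT (g \_ A).
    by apply/(measurable_restrictT _ mA); exact: measurable_funTS.
  have iA : mu.-integrable setT (EFin \o (g \_ A)).
    have i1 : mu.-integrable setT (fun z => n%:R%:E * (\1_(S n) z)%:E)%E.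
      apply: integrableZl => //; apply/integrableP; split.
        by apply/measurable_EFinP/measurable_indic; exact: (Sfin n).1.
      under eq_integral do rewrite gee0_abs ?lee_fin//.
      by rewrite integral_indic// ?setIT; [exact: (Sfin n).2|exact: (Sfin n).1].
    apply: le_integrable i1 => //; first exact/measurable_EFinP.
    move=> z _; rewrite /= lee_fin patchE indicE; case: ifPn => [/set_mem[[_ /= gn] Sn]|_].
      by rewrite (mem_set Sn) mulr1 !ger0_norm.
    by rewrite normr0.
  have gA0 z : 0 <= (g \_ A) z by rewrite patchE; case: ifP.
  have int0 := box_integral0 ap mA (fun z h => h.1.1.1) Gg g0 (FA _ mA) iA.
  have ae0 : ae_eq mu setT (EFin \o (g \_ A)) (cst 0%E).
    apply/(ae_eq_integral_abs mu measurableT); first exact/measurable_EFinP.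
    under eq_integral do rewrite gee0_abs ?lee_fin ?gA0//.
    by rewrite -(fineK (integrable_fin_num measurableT iA)) -[fine _]/(\int[mu]_z (g \_ A) z) int0.
  apply: negligibleS ae0 => z /= Az.
  move=> /(_ I); rewrite patchE (mem_set Az) => -[]; have [[[_ +] _] _] := Az => /=.
  by move=> + gz0; rewrite gz0 ltxx.
have negU : mu.-negligible (\bigcup_k \bigcup_n (nth_box k `&` [set z | 0 < g z] `&` [set z | g z <= n%:R] `&` S n)).
  by apply: negligible_bigcup => k; apply: negligible_bigcup => n; exact: neg.
apply: negligibleS negU => z /= /not_implyP[nD /eqP gz].
have : (~` D) z by []; rewrite nth_boxE => -[k _ kz]; exists k => //.
have [m _ Sm] : (\bigcup_i S i) z by rewrite -ST.
pose n := maxn m (Num.truncn (g z)).+1; exists n => //; split; first split; first split => //.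
- by rewrite /= lt_neqAle eq_sym gz g0.
- rewrite /= (le_trans (ltW (truncnS_gt (g z))))// ler_nat; exact: leq_maxr.
- by have /subsetPset := Snd _ _ (leq_maxl m (Num.truncn (g z)).+1); apply.
Qed.

End face_support.

(** * Existence of a dual solution *)

Lemma dotp_row_mx {R : realType} d (theta : 'rV[R]_(d + 1)) (x : 'rV[R]_d) (c : R) :
  dotp theta (row_mx x (const_mx c)) = dotp (lsubmx theta) x + theta 0 (rshift d 0) * c.
Proof.
rewrite /dotp big_split_ord /= big_ord1; congr (_ + _).
  by apply: eq_bigr => i _; rewrite row_mxEl mxE.
by rewrite row_mxEr mxE.
Qed.

Lemma Gamma_convex {R : realType} (f : R -> \bar R) (x y t : R) : in_Gamma f ->
  (forall s, (0 <= f s)%E) -> 0 < t < 1 ->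
  (f ((1 - t) * x + t * y)%R <= (1 - t)%:E * f x + t%:E * f y)%E.
Proof.
move=> fG f0 /andP[t0 t1]; have t1' : 0 < 1 - t by rewrite subr_gt0.
have [fx|] := boolP (f x \is a fin_num); last first.
  rewrite ge0_fin_numE// -leNgt leye_eq => /eqP ->.
  rewrite gt0_muley ?lte_fin// addye ?leey// gt_eqF//.
  by rewrite (@lt_le_trans _ _ 0%E) ?ltNyr// mule_ge0// lee_fin ltW.
have [fy|] := boolP (f y \is a fin_num); last first.
  rewrite ge0_fin_numE// -leNgt leye_eq => /eqP ->.
  rewrite (@gt0_muley _ t%:E) ?lte_fin// addey ?leey// gt_eqF//.
  by rewrite (@lt_le_trans _ _ 0%E) ?ltNyr// mule_ge0// lee_fin ltW.
have lt_case u v s : f u \is a fin_num -> f v \is a fin_num -> 0 < s -> s < 1 -> u < v ->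
    (f ((1 - s) * u + s * v)%R <= (1 - s)%:E * f u + s%:E * f v)%E.
  move=> fu fv s0 s1 uv; set w := _ + _.
  have uw : u < w by rewrite /w; nra.
  have wv : w < v by rewrite /w; nra.
  have w0 : 0 < w := le_lt_trans (Gamma_fin_ge0 fG fu) uw.
  have fw := Gamma_pos_fin fG w0.
  rewrite -(fineK fu) -(fineK fv) -(fineK fw) -!EFinM -EFinD lee_fin.
  have uv0 : 0 < v - u by rewrite subr_gt0.
  rewrite -(ler_pM2l uv0); have := Gamma_chord fG fu uw wv.
  have -> : v - w = (1 - s) * (v - u) by rewrite /w; ring.
  have -> : w - u = s * (v - u) by rewrite /w; ring.
  by move=> /ltW /le_trans; apply; rewrite le_eqVlt; apply/orP; left; apply/eqP => /=; ring.
have [xy|yx|->] := ltgtP x y.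
- exact: lt_case.
- have := lt_case y x (1 - t) fy fx t1' ltac:(lra) yx.
  by rewrite opprB addrCA subrr addr0 addrC addeC.
- rewrite -mulrDl subrK mul1r -(fineK fy) -!EFinM -EFinD -mulrDl subrK mul1r//.
Qed.

Section attainment.
Context {disp : measure_display} {Z : measurableType disp} {R : realType}.
Variable mu : {sigma_finite_measure set Z -> \bar R}.
Context {d : nat}.
Variable phi : Z -> 'rV[R]_d.
Hypothesis phi_meas : forall i, measurable_fun setT (fun z => phi z 0 i).
Variable f : Z -> R -> \bar R.
Hypothesis fB : in_B f.
Hypothesis f_ge0 : forall z t, (0 <= f z t)%E.
Variables (F : set 'rV[R]_d) (a : 'rV[R]_d).
Hypothesis Fface : is_face (cn mu phi) F.
Hypothesis Fa : relint F a.
Implicit Types (g : Z -> R) (A : set Z).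
Local Notation D := (in_cl phi F).
Local Notation momentG := (momentG mu phi).
Local Notation momentGa := (momentGa mu phi).
Local Notation moment := (moment mu phi).

Lemma measurable_integrand g A : measurable_fun setT g ->
  measurable_fun A (fun z => f z (g z)).
Proof. by move=> mg; apply: measurable_funTS; exact: in_B_measurable_comp. Qed.

Let mD : measurable D := measurable_in_cl phi_meas F.

Lemma feasible_support g : (momentGa a `&` nonneg_fun) g ->
  {ae mu, forall z, ~ D z -> g z = 0}.
Proof.
move=> [[Gg ga] g0]; apply: (face_support phi_meas Fface) => //.
by rewrite ga; have [] := Fa.
Qed.

Definition outer_energy := (\int[mu]_(z in ~` D) f z 0)%E.

Lemma outer_ge0 : (0 <= outer_energy)%E.
Proof. exact: integral_ge0. Qed.

Lemma integral_split g : measurable_fun setT g -> {ae mu, forall z, ~ D z -> g z = 0} ->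
  (\int[mu]_z f z (g z) = outer_energy + \int[mu]_(z in D) f z (g z))%E.
Proof.
move=> mg g0; rewrite -(setUv D) ge0_integral_setU//; last 3 first.
- exact: measurableC.
- exact: measurable_integrand.
- by rewrite disj_set2E setICr.
rewrite addeC; congr (_ + _)%E; apply: ae_eq_integral.
- exact: measurableC.
- exact: measurable_integrand.
- by apply: measurable_funTS; exact: (fB.1 0).
- by apply: filterS g0 => z /= H Dz; rewrite H.
Qed.

(** The moment is left free, since these functions are the competitors in the separation. They
    vanish everywhere off [cl F], not just a.e., so that their moments are integrals over [cl F]. *)
Definition admissible g := [/\ momentG g, forall z, 0 <= g z,
  forall z, ~ D z -> g z = 0 & (\int[mu]_(z in D) f z (g z) < +oo)%E].

Local Notation inner g := (\int[mu]_(z in D) f z (g z))%E.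

Lemma inner_ge0 g : (0 <= inner g)%E.
Proof. exact: integral_ge0. Qed.

Lemma admissible_fin g : admissible g -> inner g \is a fin_num.
Proof. by move=> [_ _ _ I]; rewrite ge0_fin_numE// inner_ge0. Qed.

Lemma admissible_conv g g' t : admissible g -> admissible g' -> 0 < t < 1 ->
  let k := fun z => (1 - t) * g z + t * g' z in
  [/\ admissible k, moment k = (1 - t) *: moment g + t *: moment g'
    & (inner k <= (1 - t)%:E * inner g + t%:E * inner g')%E].
Proof.
move=> [Gg g0 gD gI] [Gg' g'0 g'D g'I] t01 k.
have [t0 t1] := andP t01.
have t1' : 0 <= 1 - t by rewrite subr_ge0 ltW.
have [Gk mk] := momentG_comb (1 - t) t Gg Gg'.
have mg := Gg.1; have mg' := Gg'.1.
have le : (inner k <= (1 - t)%:E * inner g + t%:E * inner g')%E.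
  have p g1 s : 0 <= s -> forall z, D z -> (0 <= s%:E * f z (g1 z))%E.
    by move=> s0 z _; rewrite mule_ge0// lee_fin.
  have m g1 s : measurable_fun setT g1 -> measurable_fun D (fun z => s%:E * f z (g1 z))%E.
    by move=> mg1; apply: measurable_funeM; exact: measurable_integrand.
  rewrite -(ge0_integralZl _ mD)//; last exact: measurable_integrand.
  rewrite -(ge0_integralZl _ mD)//; [|exact: measurable_integrand|exact: ltW].
  rewrite -(ge0_integralD mu mD (p _ _ t1') (m _ _ mg) (p _ _ (ltW t0)) (m _ _ mg')).
  apply: ge0_le_integral => //.
  - apply: measurable_integrand; exact: Gk.1.
  - by apply: emeasurable_funD; exact: m.
  - by move=> z _; apply: Gamma_convex => //; exact: fB.2.
split=> //; split=> //.
- by move=> z; rewrite addr_ge0// mulr_ge0// ltW.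
- by move=> z nD; rewrite /k gD// g'D// !mulr0 addr0.
- apply: (le_lt_trans le); rewrite lte_add_pinfty// lte_mul_pinfty//.
  by rewrite lee_fin ltW.
Qed.

(* The separation takes place in ['rV_(d + 1)], the last coordinate carrying the
   energy relative to [jF]. *)
Variable jF : R.
Hypothesis jF_le : forall g, admissible g -> moment g = a -> (jF%:E <= inner g)%E.
Variable g0 : Z -> R.
Hypothesis g0_adm : admissible g0.
Hypothesis g0_a : moment g0 = a.

(** In the degenerate case [tau = 0], properness survives as a strict inequality in the moment
    alone; [nonproper_separation] refutes it. *)
Lemma separating_functional : exists (theta : 'rV[R]_d) (tau : R),
  [/\ 0 <= tau,
      forall g, admissible g ->
        0 <= dotp theta (moment g - a) + tau * (fine (inner g) - jF)
    & tau = 0 -> exists2 g, admissible g & 0 < dotp theta (moment g - a)].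
Proof.
(* With [s] strictly above the energy, [jF_le] keeps the origin, that is moment [a] and level [jF],
   out of [E]. *)
pose E := [set v : 'rV[R]_(d + 1) | exists g s, [/\ admissible g,
  (inner g < s%:E)%E & v = row_mx (moment g - a) (const_mx (s - jF))]].
have cE : convexV E.
  move=> x y t [g [s [ag gs ->]]] [g' [s' [ag' gs' ->]]] t01.
  have [ak mk Ik] := admissible_conv ag ag' t01.
  have [t0 t1] := andP t01.
  exists (fun z => (1 - t) * g z + t * g' z), ((1 - t) * s + t * s'); split=> //.
    apply: (le_lt_trans Ik).
    rewrite -[ltRHS]/((1 - t)%:E * s%:E + t%:E * s'%:E)%E.
    by apply: lteD; rewrite lte_pmul2l// lte_fin// subr_gt0.
  rewrite mk !scale_row_mx add_row_mx; congr row_mx.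
    by rewrite !scalerBr addrACA -opprD -scalerDl subrK scale1r.
  by apply/rowP => i; rewrite !mxE; ring.
have E0 : ~ E 0.
  move=> [g [s [ag gs /esym/eqP]]]; rewrite -row_mx0 => /eqP /eq_row_mx[/eqP].
  rewrite subr_eq0 => /eqP ga /rowP /(_ 0); rewrite !mxE => /eqP; rewrite subr_eq0 => /eqP sj.
  by have := jF_le ag ga; rewrite leNgt -sj gs.
have fin_lt g : admissible g -> forall e, 0 < e -> (inner g < (fine (inner g) + e)%:E)%E.
  by move=> ag e e0; rewrite -{1}(fineK (admissible_fin ag)) lte_fin ltrDl.
have Ene : E !=set0.
  exists (row_mx (moment g0 - a) (const_mx (fine (inner g0) + 1 - jF))).
  by exists g0, (fine (inner g0) + 1); split=> //; exact: fin_lt.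
have [theta [th0 [v [g1 [s1 [ag1 gs1 ->]]] th1]]] := proper_separation cE Ene E0.
rewrite dotp_row_mx in th1.
set th := lsubmx theta in th1; set tau := theta 0 (rshift d 0) in th1.
have sep g e : admissible g -> 0 < e ->
    0 <= dotp th (moment g - a) + tau * (fine (inner g) + e - jF).
  move=> ag e0; rewrite -dotp_row_mx; apply: th0.
  by exists g, (fine (inner g) + e); split=> //; exact: fin_lt.
have tau0 : 0 <= tau.
  rewrite leNgt; apply/negP => tau0.
  set A := dotp th (moment g0 - a) + tau * (fine (inner g0) - jF).
  (* For a negative [tau], raising the level by this amount changes the functional by [- (|A| + 1)]
     and makes it negative. *)
  have e0 : 0 < (`|A| + 1) / - tau by rewrite divr_gt0 ?oppr_gt0// ltr_wpDl.
  have := sep g0 _ g0_adm e0.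
  rewrite addrAC mulrDr addrA -/A.
  have -> : tau * ((`|A| + 1) / - tau) = - (`|A| + 1) by field; rewrite lt_eqF.
  by have := ler_norm A; lra.
exists th, tau; split=> //.
  move=> g ag; apply/ler_addgt0Pl => e e0.
  have e'0 : 0 < e / (tau + 1) by rewrite divr_gt0// ltr_wpDl.
  have := sep g _ ag e'0 => h; apply: (le_trans h).
  rewrite addrAC mulrDr addrA addrC lerD2r.
  rewrite mulrCA ler_piMr ?(ltW e0)// ler_pdivrMr ?ltr_wpDl// mul1r lerDl//.
move=> t0; exists g1 => //; by move: th1; rewrite t0 mul0r addr0.
Qed.

End attainment.

Lemma measurable_mem_set {disp : measure_display} {Z : measurableType disp} (T : set Z) :
  measurable T -> measurable_fun setT (fun z => z \in T).
Proof.
move=> mT; apply: (measurable_fun_bool true); rewrite setTI.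
by rewrite (_ : _ @^-1` _ = T)//; apply/seteqP; split=> z; [exact: set_mem|exact: mem_set].
Qed.

(** * Measurable approximate maximizers *)

Section running_maximizer.
Context {disp : measure_display} {Z : measurableType disp} {R : realType}.
Variable f : Z -> R -> \bar R.
Hypothesis fB : in_B f.
Implicit Types (r s : Z -> R) (n : nat).

(* Enumerates the positive rationals, with the dummy value 1 elsewhere. *)
Definition posrat n : R :=
  if @choice.unpickle rat n is Some q then (if 0 < (ratr q : R) then ratr q else 1) else 1.

Arguments posrat : simpl never.

Lemma posrat_gt0 n : 0 < posrat n.
Proof. by rewrite /posrat; case: choice.unpickle => // q; case: ifP. Qed.

Definition payoff r s z := r z * s z - fine (f z (s z)).

(** A greedy choice among [s] and the first [n] enumerated rationals; it is measurable because it
    only compares finite payoffs. Starting from [s] keeps the energy finite wherever that of [s] is,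
    so that [fine] in [payoff] loses nothing there. *)
Fixpoint running_max r s n : Z -> R := if n is n'.+1 then
    fun z => if payoff r (running_max r s n') z < payoff r (cst (posrat n')) z
             then posrat n' else running_max r s n' z
  else s.

Lemma measurable_payoff r s : measurable_fun setT r -> measurable_fun setT s ->
  measurable_fun setT (payoff r s).
Proof.
move=> mr ms; apply: measurable_funB; first exact: measurable_funM.
by apply: measurableT_comp => //; exact: in_B_measurable_comp.
Qed.

Lemma measurable_running_max r s n : measurable_fun setT r -> measurable_fun setT s ->
  measurable_fun setT (running_max r s n).
Proof.
move=> mr ms; elim: n => [//|n IH] /=.
apply: measurable_fun_ifT => //.
by apply: measurable_fun_ltr; apply: measurable_payoff => //; exact: measurable_cst.
Qed.

Lemma running_max_ge0 r s n z : 0 <= s z -> 0 <= running_max r s n z.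
Proof. by move=> s0; elim: n => //= n IH; case: ifP => // _; exact/ltW/posrat_gt0. Qed.

Lemma running_max_fin r s n z : f z (s z) \is a fin_num ->
  f z (running_max r s n z) \is a fin_num.
Proof.
move=> sf; elim: n => //= n IH; case: ifP => // _.
by apply: (Gamma_pos_fin (fB.2 z)); exact: posrat_gt0.
Qed.

Lemma payoff_running_max_nd r s z :
  {homo (fun n => payoff r (running_max r s n) z) : n m / (n <= m)%N >-> n <= m}.
Proof.
apply: homo_leq => [//|x y w|n]; first exact: le_trans.
rewrite {2}/payoff /= -/(payoff r (running_max r s n) z).
by case: ifP => // /ltW; rewrite {2}/payoff.
Qed.

Lemma payoff_running_max_ge r s n z :
  payoff r (cst (posrat n)) z <= payoff r (running_max r s n.+1) z.
Proof.
rewrite [leRHS]/payoff /=; case: ifPn => [_|]; first by [].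
by rewrite -leNgt.
Qed.

(** Right continuity on the domain, including 0, lets positive rationals just above [t] approximate
    the payoff at [t]. Hence a countable supremum gives the conjugate. *)
Lemma payoff_running_max_cvg r s z : f z (s z) \is a fin_num ->
  (payoff r (running_max r s n) z)%:E @[n --> \oo] --> conjugate (f z) (r z).
Proof.
move=> sf; set u := fun n => _.
have nd : nondecreasing_seq u.
  by move=> n m nm; rewrite lee_fin; exact: payoff_running_max_nd.
have -> : conjugate (f z) (r z) = ereal_sup (range u).
  apply/eqP; rewrite eq_le; apply/andP; split; last first.
    apply: ge_ereal_sup => _ [n _ <-]; rewrite /u /payoff EFinB fineK; last exact: running_max_fin.
    exact: conjugate_ge.
  apply: ge_ereal_sup => _ [t _ <-].
  have fG := fB.2 z.
  have [ft|] := boolP (f z t \is a fin_num); last first.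
    case: fG => /(_ t) + _ _ _ _; case: (f z t) => //= _ _; by rewrite leNye.
  have t0 := Gamma_fin_ge0 fG ft.
  rewrite -(fineK ft) -EFinB; apply/lee_subgt0Pr => e e0.
  have cv : r z * w - fine (f z w) @[w --> t^'+] --> r z * t - fine (f z t).
    apply: cvgB.
      by apply: cvgMr; exact/cvg_at_right_filter/cvg_id.
    have := Gamma_right_continuous fG t0; rewrite -(fineK ft) => /fine_cvg; exact.
  have near_w : \forall w \near t^'+, r z * t - fine (f z t) - e < r z * w - fine (f z w).
    by apply: cvgr_gt cv _ _; rewrite ltrBlDr ltrDl.
  have : nbhs t^'+ [set w | r z * t - fine (f z t) - e < r z * w - fine (f z w)] by exact: near_w.
  rewrite /at_right /within /= => -[eta /= eta0 Heta].
  have tlt : t < t + eta by rewrite ltrDl.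
  have [q] := rat_in_itvoo tlt; rewrite in_itv/= => /andP[tq qt].
  have q0 : 0 < (ratr q : R) := le_lt_trans t0 tq.
  have := Heta (ratr q); rewrite /= distrC gtr0_norm ?subr_gt0// ltrBlDl => /(_ qt tq) lt.
  (* The rational [q] enters the comparison at step [pickle q], so its payoff is attained from the
     next index on. *)
  apply: le_trans (_ : (u (choice.pickle q).+1 <= _)%E); last first.
    by apply: ereal_sup_ubound; exists (choice.pickle q).+1.
  rewrite -EFinB lee_fin; apply: (le_trans (ltW lt)).
  have := payoff_running_max_ge r s (choice.pickle q) z.
  by rewrite {1}/payoff /= /posrat choice.pickleK q0.
exact: ereal_nondecreasing_cvgn.
Qed.

Lemma measurable_conjugate r : measurable_fun setT r ->
  measurable_fun setT (fun z => conjugate (f z) (r z)).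
Proof.
move=> mr.
apply: (@emeasurable_fun_cvg _ _ _ _
  (fun n z => (payoff r (running_max r (cst 1) n) z)%:E)).
  move=> n; apply/measurable_EFinP; apply: measurable_payoff => //.
  by apply: measurable_running_max => //; exact: measurable_cst.
move=> z _; apply: payoff_running_max_cvg.
by apply: (Gamma_pos_fin (fB.2 z)); exact: ltr01.
Qed.

End running_maximizer.

(** * Exchanging a feasible function on small sets *)

Section exchange.
Context {disp : measure_display} {Z : measurableType disp} {R : realType}.
Variable mu : {sigma_finite_measure set Z -> \bar R}.
Context {d : nat}.
Variable phi : Z -> 'rV[R]_d.
Hypothesis phi_meas : forall i, measurable_fun setT (fun z => phi z 0 i).
Variable f : Z -> R -> \bar R.
Hypothesis fB : in_B f.
Hypothesis f_ge0 : forall z t, (0 <= f z t)%E.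
Variables (F : set 'rV[R]_d) (a : 'rV[R]_d).
Implicit Types (g : Z -> R) (A : set Z) (theta : 'rV[R]_d).
Local Notation D := (in_cl phi F).
Local Notation momentG := (momentG mu phi).
Local Notation moment := (moment mu phi).
Local Notation inner g := (\int[mu]_(z in D) f z (g z))%E.
Local Notation adm := (admissible mu phi f F).
Local Notation fr g z := (fine (f z (g z))).

Let mD : measurable D := measurable_in_cl phi_meas F.

Variable g0 : Z -> R.
Hypothesis g0_adm : adm g0.
Hypothesis g0_a : moment g0 = a.
Hypothesis g0_fin : forall z, D z -> f z (g0 z) \is a fin_num.

Lemma integral_in_cl (u : Z -> \bar R) : (forall z, ~ D z -> u z = 0%E) ->
  (\int[mu]_z u z = \int[mu]_(z in D) u z)%E.
Proof.
move=> u0; rewrite [RHS]integral_mkcond; apply: eq_integral => z _.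
by rewrite patchE; case: ifPn => // /negP nz; rewrite u0// => Dz; apply/nz/mem_set.
Qed.

Lemma measurable_fr g A : measurable_fun setT g -> measurable_fun A (fun z => fr g z).
Proof.
move=> mg; apply: measurable_funTS.
by apply: measurableT_comp => //; exact: in_B_measurable_comp.
Qed.

Lemma integrable_fr g : adm g -> (forall z, D z -> f z (g z) \is a fin_num) ->
  mu.-integrable D (EFin \o (fun z => fr g z)) /\ \int[mu]_(z in D) fr g z = fine (inner g).
Proof.
move=> [Gg _ _ fin] ff.
have E : {in D, (fun z => f z (g z)) =1 EFin \o (fun z => fr g z)}.
  by move=> z /set_mem /ff fz; rewrite /= fineK.
split.
  apply/integrableP; split; first by apply/measurable_EFinP/measurable_fr; exact: Gg.1.
  rewrite (eq_integral (fun z => f z (g z))) // => z zD.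
  by rewrite -E// gee0_abs.
by rewrite /Rintegral; congr fine; apply: eq_integral => z zD; rewrite E.
Qed.

Section mask.
Variables (theta : 'rV[R]_d) (tau : R).
Local Notation r z := (dotp theta (phi z)).
Hypothesis tau_ge0 : 0 <= tau.
Variable jF : R.
Hypothesis sep : forall g, adm g ->
  0 <= dotp theta (moment g - a) + tau * (fine (inner g) - jF).
Variable g1 : Z -> R.
Hypothesis mg1 : measurable_fun setT g1.
Hypothesis g1_ge0 : forall z, 0 <= g1 z.
Hypothesis g1_fin : forall z, D z -> f z (g1 z) \is a fin_num.

(** The pointwise decrease of the separating functional when [g0] is replaced by [g1]. *)
Let e z := - (r z * (g1 z - g0 z) + tau * (fr g1 z - fr g0 z)).
Hypothesis e_ge0 : forall z, D z -> 0 <= e z.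

(** A single quantity whose bound controls [phi], [g1] and the energy density of [g1] at once. *)
Let N z := \sum_i `|phi z 0 i| + g1 z + fr g1 z.

Let fr_ge0 g z : 0 <= fr g z. Proof. exact: fine_ge0. Qed.

Let mg0 : measurable_fun setT g0. Proof. by case: g0_adm => -[]. Qed.

Let mN : measurable_fun setT N.
Proof.
apply: measurable_funD; last exact: measurable_fr.
apply: measurable_funD => //; apply: measurable_sum => i.
exact: measurableT_comp.
Qed.

Let me : measurable_fun setT e.
Proof.
apply: measurableT_comp => //; apply: measurable_funD.
  by apply: measurable_funM; [exact: measurable_dotp|exact: measurable_funB].
apply: measurable_funM; first exact: measurable_cst.
by apply: measurable_funB; exact: measurable_fr.
Qed.

Let mask_set (S : set Z) (n : nat) := D `&` S `&` [set z | N z <= n%:R].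

(** The competitor equals [g1] on the mask and [g0] elsewhere. The mask has finite measure and
    bounded data, so the competitor is admissible; the integral of [e] over the mask is the decrease
    of the separating functional, which [sep] limits to its value at [g0]. *)
Let restricted_bound (S : set Z) (n : nat) : measurable S -> (mu S < +oo)%E ->
  (\int[mu]_(z in D) ((e \_ (mask_set S n)) z)%:E <=
    (tau * (fine (inner g0) - jF))%:E)%E.
Proof.
move=> mS Sfin; set T := mask_set S n.
have [G0 g00 g0D g0I] := g0_adm.
have mT : measurable T.
  apply: measurableI; first exact: measurableI.
  rewrite -[X in measurable X]setTI.
  have := @measurable_fun_ler _ _ _ setT N (cst n%:R) mN (measurable_cst _).
  by move=> /(_ measurableT [set true] I); rewrite /preimage /=.
pose g z := if z \in T then g1 z else g0 z.
have TD z : T z -> D z by move=> [[]].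
have gD z : ~ D z -> g z = 0.
  by move=> nD; rewrite /g ifF ?g0D//; apply/negP => /set_mem/TD.
have mg : measurable_fun setT g by apply: measurable_fun_ifT => //; exact: measurable_mem_set.
have Tb z : T z -> [/\ forall i, `|phi z 0 i| <= n%:R, g1 z <= n%:R & fr g1 z <= n%:R].
  move=> [_ /= Nz]; have s0 i : 0 <= \sum_(j | j != i) `|phi z 0 j| by exact: sumr_ge0.
  have g10 := g1_ge0 z; have f10 := fr_ge0 g1 z.
  have sum0 : 0 <= \sum_i `|phi z 0 i| by exact: sumr_ge0.
  rewrite /N in Nz; move: f10 Nz; set c := fine _ => f10 Nz.
  split=> [i| |]; [|move: sum0 Nz; set B := \sum_i _; lra|move: sum0 Nz; set B := \sum_i _; lra].
  have := s0 i; set A := \sum_(j | j != i) _ => A0.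
  by move: Nz; rewrite (bigD1 i)//= -/A; lra.
have iS (k : R) : mu.-integrable setT (fun z => k%:E * (\1_S z)%:E)%E.
  apply: integrableZl => //; apply/integrableP; split.
    by apply/measurable_EFinP/measurable_indic.
  under eq_integral do rewrite gee0_abs ?lee_fin//.
  by rewrite integral_indic// ?setIT.
have TS z : T z -> \1_S z = 1 :> R by move=> [[_ Sz] _]; rewrite indicE mem_set.
have Gg : momentG g.
  split=> // i.
  have ib := integrableD measurableT (iS (n%:R * n%:R)) (integrable_abse (G0.2 i)).
  apply: le_integrable ib => //; first by apply/measurable_EFinP; exact: measurable_funM.
  move=> z _; rewrite /= lee_fin /g; case: ifPn => [/set_mem Tz|_].
    have [b1 b2 _] := Tb z Tz; rewrite (TS _ Tz) mulr1 [leRHS]ger0_norm ?addr_ge0 ?mulr_ge0//.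
    rewrite normrM (ger0_norm (g1_ge0 z)) (le_trans (ler_pM _ _ (b1 i) b2))//.
    by rewrite lerDl.
  rewrite [leRHS]ger0_norm ?addr_ge0 ?mulr_ge0// lerDr !mulr_ge0//.
have gfin z : D z -> f z (g z) \is a fin_num.
  by move=> Dz; rewrite /g; case: ifP => _; [exact: g1_fin|exact: g0_fin].
have ag : adm g.
  split=> //; first by move=> z; rewrite /g; case: ifP.
  apply: (@le_lt_trans _ _ (\int[mu]_(z in D) (n%:R%:E * (\1_S z)%:E + f z (g0 z)))%E).
    apply: ge0_le_integral => //.
    - exact: measurable_integrand.
    - apply: emeasurable_funD; last exact: measurable_integrand.
      by apply/measurable_funTS; have /integrableP[] := iS n%:R.
    - move=> z Dz; rewrite /g; case: ifPn => [/set_mem Tz|_].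
        have [_ _ b] := Tb z Tz; rewrite (TS _ Tz) mule1 -(fineK (g1_fin Dz)).
        by rewrite (@le_trans _ _ n%:R%:E) ?lee_fin// leeDl.
      by rewrite leeDr// mule_ge0// lee_fin.
  have p1 z : D z -> (0 <= n%:R%:E * (\1_S z)%:E :> \bar R)%E.
    by move=> _; rewrite mule_ge0// lee_fin.
  have m1 : measurable_fun D (fun z => n%:R%:E * (\1_S z)%:E : \bar R)%E.
    by apply/measurable_funTS; have /integrableP[] := iS n%:R.
  have p2 z : D z -> (0 <= f z (g0 z))%E by [].
  have m2 : measurable_fun D (fun z => f z (g0 z)) by exact: measurable_integrand.
  rewrite (ge0_integralD mu mD p1 m1 p2 m2).
  rewrite lte_add_pinfty//.
  have /integrableP[_] := integrableS measurableT mD (@subsetT _ _) (iS n%:R).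
  by under eq_integral do rewrite gee0_abs ?mule_ge0 ?lee_fin//.
have [ifg Ifg] := integrable_fr ag gfin.
have [ifg0 Ifg0] := integrable_fr g0_adm g0_fin.
have [irg Irg] := dotp_moment theta Gg.
have [irg0 Irg0] := dotp_moment theta G0.
have iD u : mu.-integrable setT u -> mu.-integrable D u by exact: integrableS.
have rD k : (forall z, ~ D z -> k z = 0) -> momentG k ->
    \int[mu]_(z in D) (r z * k z) = dotp theta (moment k).
  move=> kD Gk; have [_ Ik] := dotp_moment theta Gk.
  rewrite /Rintegral -integral_in_cl; first by rewrite Ik.
  by move=> z nD; rewrite kD// mulr0.
have irD : mu.-integrable D (EFin \o (fun z => r z * g z)) by exact: iD.
have irD0 : mu.-integrable D (EFin \o (fun z => r z * g0 z)) by exact: iD.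
have iB : mu.-integrable D (EFin \o (fun z => r z * g z - r z * g0 z)).
  exact: (integrableB mD irD irD0).
have iBf : mu.-integrable D (EFin \o (fun z => fr g z - fr g0 z)).
  exact: (integrableB mD ifg ifg0).
have iBfZ : mu.-integrable D (EFin \o (fun z => tau * (fr g z - fr g0 z))).
  exact: (integrableZl mD tau iBf).
have E : {in D, (fun z => r z * g z - r z * g0 z + tau * (fr g z - fr g0 z)) =1
    (fun z => - (e \_ T) z)}.
  move=> z _; rewrite patchE /g; case: ifP => _; last by rewrite !subrr mulr0 addr0 oppr0.
  by rewrite /e opprK; ring.
have key : \int[mu]_(z in D) - (e \_ T) z =
    dotp theta (moment g - a) + tau * (fine (inner g) - fine (inner g0)).
  transitivity (\int[mu]_(z in D)
      (r z * g z - r z * g0 z + tau * (fr g z - fr g0 z))).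
    by apply: eq_Rintegral => z zD; rewrite E.
  rewrite (RintegralD mD iB iBfZ) (RintegralB mD irD irD0) (RintegralZl _ mD iBf).
  by rewrite (RintegralB mD ifg ifg0) !rD// Ifg Ifg0 dotpBr -g0_a.
have ieT : mu.-integrable D (EFin \o (fun z => (e \_ T) z)).
  have iS' : mu.-integrable D (EFin \o
      (fun z => - (r z * g z - r z * g0 z + tau * (fr g z - fr g0 z)))).
    exact: (integrableN (integrableD mD iB iBfZ)).
  apply: eq_integrable iS' => // z zD /=; congr EFin.
  by have /= -> := E z zD; rewrite opprK.
have : \int[mu]_(z in D) (e \_ T) z <= tau * (fine (inner g0) - jF).
  have -> : \int[mu]_(z in D) (e \_ T) z = - \int[mu]_(z in D) - (e \_ T) z.
    have iN : mu.-integrable D (EFin \o (fun z => - (e \_ T) z)).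
      exact: (integrableN ieT).
    rewrite -mulN1r -(RintegralZl _ mD iN).
    by apply: eq_Rintegral => z _; rewrite mulN1r opprK.
  by rewrite key; have := sep ag; lra.
by rewrite -lee_fin /Rintegral fineK//; exact: integrable_fin_num.
Qed.

(* Replacing [g0] by [g1] on sets where everything is bounded gives admissible
   functions; testing [sep] with them and letting the sets grow bounds the whole
   integral of the gain [e]. *)
Lemma mask_bound : (\int[mu]_(z in D) (e z)%:E <= (tau * (fine (inner g0) - jF))%:E)%E.
Proof.
have [S [ST Snd Sfin]] := (sigma_finiteP setT mu).1 (sigma_finiteT mu).
pose T n := D `&` S n `&` [set z | N z <= n%:R].
have mT n : measurable (T n).
  apply: measurableI; first by apply: measurableI => //; exact: (Sfin n).1.
  rewrite -[X in measurable X]setTI.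
  have := @measurable_fun_ler _ _ _ setT N (cst n%:R) mN (measurable_cst _).
  by move=> /(_ measurableT [set true] I); rewrite /preimage /=.
have Tnd n m z : (n <= m)%N -> T n z -> T m z.
  move=> nm [[Dz Sz] Nz]; split; first split=> //.
    by have /subsetPset := Snd _ _ nm; apply.
  by rewrite /= (le_trans Nz)// ler_nat.
have lim_e z : D z -> (((e \_ (T n)) z)%:E @[n --> \oo] --> (e z)%:E)%E.
  move=> Dz; have [m _ Sm] : (\bigcup_i S i) z by rewrite -ST.
  pose k := maxn m (Num.truncn (N z)).+1.
  have Tk : T k z.
    split; first split=> //.
      by have /subsetPset := Snd _ _ (leq_maxl m (Num.truncn (N z)).+1); apply.
    by rewrite /= (le_trans (ltW (truncnS_gt (N z))))// ler_nat leq_maxr.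
  apply: cvg_near_cst; exists k => // n /= kn.
  by rewrite patchE mem_set//; exact: Tnd Tk.
have -> : (\int[mu]_(z in D) (e z)%:E =
    \int[mu]_(z in D) limn (fun n => ((e \_ (T n)) z)%:E))%E.
  by apply: eq_integral => z /set_mem /lim_e /cvg_lim ->.
have cvg := @cvg_monotone_convergence _ _ _ mu D mD
  (fun n z => ((e \_ (T n)) z)%:E) _ _ _.
apply: (cvge_to_le (cvg _ _ _)).
- move=> n; apply/measurable_EFinP/measurable_funTS.
  by apply/(measurable_restrictT _ (mT n)); exact: measurable_funTS.
- by move=> n z Dz; rewrite lee_fin patchE; case: ifP => // _; exact: e_ge0.
- move=> z Dz n m nm; rewrite lee_fin !patchE.
  case: ifPn => [/set_mem Tn|_]; first by rewrite mem_set//; exact: Tnd Tn.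
  by case: ifP => // _; exact: e_ge0.
- by apply: nearW => n; apply: restricted_bound; [exact: (Sfin n).1|exact: (Sfin n).2].
Qed.

End mask.
End exchange.

(** * Attainment of the dual bound *)

Section dual_attainment.
Context {disp : measure_display} {Z : measurableType disp} {R : realType}.
Variable mu : {sigma_finite_measure set Z -> \bar R}.
Context {d : nat}.
Variable phi : Z -> 'rV[R]_d.
Hypothesis phi_meas : forall i, measurable_fun setT (fun z => phi z 0 i).
Variable f : Z -> R -> \bar R.
Hypothesis fB : in_B f.
Hypothesis f_ge0 : forall z t, (0 <= f z t)%E.
Variables (F : set 'rV[R]_d) (a : 'rV[R]_d).
Hypothesis Fface : is_face (cn mu phi) F.
Hypothesis Fa : relint F a.
Implicit Types (g : Z -> R) (A : set Z) (theta : 'rV[R]_d).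
Local Notation D := (in_cl phi F).
Local Notation momentG := (momentG mu phi).
Local Notation moment := (moment mu phi).
Local Notation inner g := (\int[mu]_(z in D) f z (g z))%E.
Local Notation adm := (admissible mu phi f F).
Local Notation fr g z := (fine (f z (g z))).

Let mD : measurable D := measurable_in_cl phi_meas F.

Variable jF : R.
Hypothesis jF_le : forall g, adm g -> moment g = a -> (jF%:E <= inner g)%E.
Variable g0 : Z -> R.
Hypothesis g0_adm : adm g0.
Hypothesis g0_a : moment g0 = a.
Hypothesis g0_fin : forall z, D z -> f z (g0 z) \is a fin_num.

Let mg0 : measurable_fun setT g0. Proof. by case: g0_adm => -[]. Qed.

Lemma moment_orthogonal g w : momentG g -> (forall z, ~ D z -> g z = 0) ->
  (forall x, F x -> dotp x w = 0) -> dotp (moment g) w = 0.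
Proof.
move=> Gg gD Fw; rewrite dotpC; apply: EFin_inj.
have [_ <-] := dotp_moment w Gg.
rewrite (eq_integral (cst 0%E)) ?integral0// => z _ /=.
have [Dz|nDz] := pselect (D z); last by rewrite gD// mulr0.
by rewrite dotpC (closure_orthogonal Fw Dz) mul0r.
Qed.

(* The test function is [g0 + 1] where [<theta, phi> < 0] and [g0 / 2]
   elsewhere; hence [<theta, phi> >= 0] and [<theta, phi> g0 = 0] a.e. on
   [cl F], and [theta] is nonnegative on [F] and vanishes at [a \in ri F]. *)
Lemma nonproper_separation theta : (forall g, adm g -> 0 <= dotp theta (moment g - a)) ->
  forall g, adm g -> dotp theta (moment g - a) <= 0.
Proof.
move=> sep; pose r z := dotp theta (phi z).
have mr : measurable_fun setT r := measurable_dotp phi_meas theta.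
have [G0 g0_ge0 g0D _] := g0_adm.
pose g1 z := if r z < 0 then g0 z + 1 else g0 z / 2.
have mg1 : measurable_fun setT g1.
  apply: measurable_fun_ifT.
  - by apply: measurable_fun_ltr => //; exact: measurable_cst.
  - by apply: measurable_funD => //; exact: measurable_cst.
  - by apply: measurable_funM => //; exact: measurable_cst.
have g1_ge0 z : 0 <= g1 z by rewrite /g1; case: ifP => _; rewrite ?addr_ge0 ?divr_ge0.
have g1_fin z : D z -> f z (g1 z) \is a fin_num.
  move=> Dz; rewrite /g1; case: ifP => _.
    by apply: (Gamma_pos_fin (fB.2 z)); rewrite ltr_wpDl.
  have := g0_ge0 z; rewrite le_eqVlt => /predU1P[g00|g0gt].
    by rewrite -g00 mul0r g00 g0_fin.
  by apply: (Gamma_pos_fin (fB.2 z)); rewrite divr_gt0.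
(* The instance [tau = 0] of the exchange bound, where the energy drops out and the level 0 is a
   placeholder. *)
have sep' g : adm g -> 0 <= dotp theta (moment g - a) + 0 * (fine (inner g) - 0).
  by move=> ag; rewrite mul0r addr0 sep.
pose e z := if r z < 0 then - r z else r z * (g0 z / 2).
have e_ge0 z : 0 <= e z.
  rewrite /e; case: ltP => rz; first by rewrite oppr_ge0 ltW.
  by rewrite mulr_ge0// divr_ge0.
have eE z : - (r z * (g1 z - g0 z) + 0 * (fr g1 z - fr g0 z)) = e z.
  rewrite mul0r addr0 /g1 /e; case: ifP => _; first by rewrite addrAC subrr add0r mulr1.
  by lra.
have e_ge0' z : D z -> 0 <= - (r z * (g1 z - g0 z) + 0 * (fr g1 z - fr g0 z)).
  by rewrite eE.
have := mask_bound phi_meas fB f_ge0 g0_adm g0_a g0_fin sep' mg1 g1_ge0 g1_fin e_ge0'.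
rewrite mul0r; under eq_integral do rewrite eE.
move=> int_le0.
have me : measurable_fun setT e.
  apply: measurable_fun_ifT.
  - by apply: measurable_fun_ltr => //; exact: measurable_cst.
  - exact: measurableT_comp.
  - apply: measurable_funM => //; apply: measurable_funM => //; exact: measurable_cst.
have ae0 : ae_eq mu D (EFin \o e) (cst 0%E).
  apply/(ae_eq_integral_abs mu mD); first by apply/measurable_EFinP/measurable_funTS.
  apply/eqP; rewrite eq_le integral_ge0// andbT.
  by under eq_integral do rewrite gee0_abs ?lee_fin//.
have r_ge0 : {ae mu, forall z, D z -> 0 <= r z /\ r z * g0 z = 0}.
  apply: filterS ae0 => z + Dz => /(_ Dz) /= -[]; rewrite /e; case: ltP => rz.
    by move=> /eqP; rewrite oppr_eq0 lt_eqF.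
  by move=> e0; split=> //; lra.
have theta_a : dotp theta a = 0.
  apply: EFin_inj; rewrite -g0_a; have [_ <-] := dotp_moment theta G0.
  rewrite (ae_eq_integral (cst 0%E))// ?integral0//.
  - apply/measurable_EFinP; exact: measurable_funM.
  - apply: filterS r_ge0 => z H _ /=.
    have [Dz|nDz] := pselect (D z); last by rewrite g0D// mulr0.
    by have [_ ->] := H Dz.
have pos g : momentG g -> (forall z, 0 <= g z) -> {ae mu, forall z, ~ D z -> g z = 0} ->
    0 <= dotp theta (moment g).
  move=> Gg g_ge0 gD; rewrite -lee_fin; have [_ <-] := dotp_moment theta Gg.
  rewrite (ae_eq_integral (fun z => `|(r z * g z)%:E|%E))//.
  - exact: integral_ge0.
  - by apply/measurable_EFinP; apply: measurable_funM => //; exact: Gg.1.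
  - apply: measurableT_comp => //; apply/measurable_EFinP.
    by apply: measurable_funM => //; exact: Gg.1.
  - apply: filterS2 r_ge0 gD => z H1 H2 _.
    have [Dz|nDz] := pselect (D z); last by rewrite -/(r z) H2// mulr0 abse0.
    by have [rz _] := H1 Dz; rewrite gee0_abs// lee_fin mulr_ge0.
move=> g ag; have [Gg g_ge0 gD _] := ag.
rewrite dotpBr theta_a subr0.
(* The moment of [g] need not lie in [F], only in its span; still [a - eps *: moment g] lies in [F].
   As [theta] is nonnegative there and vanishes at [a], it is at most 0 at the moment of [g]. *)
have [eps eps0 Feps] := relint_sub (@cn0 _ _ _ mu _ phi) (@cnD _ _ _ mu _ phi)
  (@cnZ _ _ _ mu _ phi) Fface Fa (fun w => moment_orthogonal Gg gD (w := w)).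
have [g' [Gg' g'_ge0] mg'] : cn mu phi (a - eps *: moment g) by case: Fface => _ _ + _; apply.
have := pos g' Gg' g'_ge0; rewrite mg' dotpBr theta_a dotpZr sub0r oppr_ge0 pmulr_rle0//.
by apply; apply: (face_support phi_meas Fface) => //; rewrite mg'.
Qed.

(** The exchange is applied with [- theta] and [tau = 1], so that the gains are increments of the
    payoff over that of [g0]; they increase to the conjugate minus the payoff of [g0]. Adding back
    the integral of this payoff, [<theta, a>] minus the energy of [g0], cancels the energy of
    [g0]. *)
Lemma dual_bound theta :
  (forall g, adm g -> dotp theta (moment g - a) <= fine (inner g) - jF) ->
  mu.-integrable D (fun z => conjugate (f z) (dotp theta (phi z))) /\
  (\int[mu]_(z in D) conjugate (f z) (dotp theta (phi z)) <= (dotp theta a - jF)%:E)%E.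
Proof.
move=> sep; pose r z := dotp theta (phi z).
have mr : measurable_fun setT r := measurable_dotp phi_meas theta.
have [G0 g0_ge0 g0D _] := g0_adm.
have sep' g : adm g -> 0 <= dotp (- theta) (moment g - a) + 1 * (fine (inner g) - jF).
  by move=> ag; rewrite dotpNl mul1r addrC subr_ge0 sep.
pose gs := running_max f r g0.
have mgs n : measurable_fun setT (gs n) by exact: measurable_running_max.
have gs_ge0 n z : 0 <= gs n z by exact: running_max_ge0.
have gs_fin n z : D z -> f z (gs n z) \is a fin_num.
  by move=> Dz; apply: running_max_fin => //; exact: g0_fin.
pose e n z := payoff f r (gs n) z - payoff f r g0 z.
have eE n z : - (dotp (- theta) (phi z) * (gs n z - g0 z) + 1 * (fr (gs n) z - fr g0 z)) = e n z.
  by rewrite dotpNl -/(r z) /e /payoff; ring.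
have e_nd z n m : (n <= m)%N -> e n z <= e m z.
  by move=> nm; rewrite lerD2r; exact: payoff_running_max_nd.
have e_ge0 n z : 0 <= e n z by rewrite (le_trans _ (e_nd z _ _ (leq0n n)))// /e subrr.
have bound n : (\int[mu]_(z in D) (e n z)%:E <= (fine (inner g0) - jF)%:E)%E.
  have e_ge0' z : D z -> 0 <= - (dotp (- theta) (phi z) * (gs n z - g0 z) +
      1 * (fr (gs n) z - fr g0 z)) by rewrite eE.
  have := mask_bound phi_meas fB f_ge0 g0_adm g0_a g0_fin sep' (mgs n) (gs_ge0 n)
    (@gs_fin n) e_ge0'.
  by rewrite mul1r; under eq_integral do rewrite eE.
pose K z := conjugate (f z) (r z).
have mK : measurable_fun D K by apply: measurable_funTS; exact: measurable_conjugate.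
pose w z := (K z - (payoff f r g0 z)%:E)%E.
have mpay : measurable_fun setT (payoff f r g0) by exact: measurable_payoff.
have me n : measurable_fun D (fun z => (e n z)%:E).
  by apply/measurable_EFinP/measurable_funTS; apply: measurable_funB => //; exact: measurable_payoff.
have cvw z : D z -> (e n z)%:E @[n --> \oo] --> w z.
  move=> Dz; under eq_fun do rewrite EFinB.
  apply: (@cvgeB _ _ _ _ (fun n => (payoff f r (gs n) z)%:E) (cst (payoff f r g0 z)%:E)).
  - by rewrite fin_num_adde_defl.
  - by apply: payoff_running_max_cvg => //; exact: g0_fin.
  - exact: cvg_cst.
have intw : (\int[mu]_(z in D) w z <= (fine (inner g0) - jF)%:E)%E.
  have -> : (\int[mu]_(z in D) w z = \int[mu]_(z in D) limn (fun n => (e n z)%:E))%E.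
    by apply: eq_integral => z /set_mem /cvw /cvg_lim ->.
  apply: (cvge_to_le (@cvg_monotone_convergence _ _ _ mu D mD (fun n z => (e n z)%:E) _ _ _)).
  - exact: me.
  - by move=> n z _; rewrite lee_fin.
  - by move=> z _ n m nm; rewrite lee_fin e_nd.
  - exact: nearW.
have w_ge0 z : D z -> (0 <= w z)%E.
  move=> Dz; apply: (cvge_to_ge (cvw z Dz)); apply: nearW => n; by rewrite lee_fin.
have mw : measurable_fun D w.
  by apply: emeasurable_funB => //; apply/measurable_EFinP/measurable_funTS.
have iw : mu.-integrable D w.
  apply/integrableP; split=> //.
  rewrite (eq_integral w) => [|z /set_mem Dz]; last by rewrite gee0_abs// w_ge0.
  by rewrite (le_lt_trans intw)// ltry.
have [ifr0 Ifr0] := integrable_fr fB f_ge0 g0_adm g0_fin.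
have [irg0 Irg0] := dotp_moment theta G0.
have irg0D : mu.-integrable D (EFin \o (fun z => r z * g0 z)).
  by apply: integrableS irg0.
have ipay : mu.-integrable D (EFin \o payoff f r g0).
  exact: (integrableB mD irg0D ifr0).
have KE z : D z -> K z = (w z + (payoff f r g0 z)%:E)%E.
  by move=> Dz; rewrite /w subeK.
have iK : mu.-integrable D K.
  by apply: eq_integrable (integrableD mD iw ipay) => // z /set_mem /KE ->.
split=> //.
have -> : (\int[mu]_(z in D) K z = \int[mu]_(z in D) (w z + (payoff f r g0 z)%:E))%E.
  by apply: eq_integral => z /set_mem /KE.
rewrite integralD//.
have -> : (\int[mu]_(z in D) (payoff f r g0 z)%:E = (dotp theta a - fine (inner g0))%:E)%E.
  have -> : (\int[mu]_(z in D) (payoff f r g0 z)%:E =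
      \int[mu]_(z in D) ((r z * g0 z)%:E - (fr g0 z)%:E))%E by [].
  have E1 : (\int[mu]_(z in D) (r z * g0 z)%:E = (dotp theta a)%:E)%E.
    by rewrite -(@integral_in_cl _ _ _ mu) ?Irg0 ?g0_a// => z nD; rewrite g0D// mulr0.
  rewrite integralB_EFin// E1 -Ifr0 EFinB; congr (_ - _)%E.
  by rewrite /Rintegral fineK//; exact: integrable_fin_num.
apply: (le_trans (leeD2r _ intw)).
by rewrite -EFinD lee_fin; lra.
Qed.

Lemma dual_attained : exists theta,
  mu.-integrable D (fun z => conjugate (f z) (dotp theta (phi z))) /\
  (\int[mu]_(z in D) conjugate (f z) (dotp theta (phi z)) <= (dotp theta a - jF)%:E)%E.
Proof.
have [theta [tau [tau_ge0 sep strict]]] :=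
  separating_functional phi_meas fB f_ge0 jF_le g0_adm.
have tau_gt0 : 0 < tau.
  rewrite lt_neqAle tau_ge0 andbT eq_sym; apply/eqP => tau0.
  have [g ag] := strict tau0; apply/negP; rewrite -leNgt.
  by apply: nonproper_separation => // g' /sep; rewrite tau0 mul0r addr0.
(* Dividing by [tau] normalizes the energy coefficient to 1; the sign turns the lower bound of the
   separation into an upper bound on the payoff. *)
exists (- tau^-1 *: theta); apply: dual_bound => g ag.
rewrite dotpZl mulNr -subr_ge0 opprK -(pmulr_rge0 _ tau_gt0) mulrDr mulVKf ?gt_eqF//.
by rewrite addrC; exact: sep.
Qed.

End dual_attainment.

(** * Strong duality *)

Section duality.
Context {disp : measure_display} {Z : measurableType disp} {R : realType}.
Variable mu : {sigma_finite_measure set Z -> \bar R}.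
Context {d : nat}.
Variable phi : Z -> 'rV[R]_d.
Hypothesis phi_meas : forall i, measurable_fun setT (fun z => phi z 0 i).
Variable f : Z -> R -> \bar R.
Hypothesis fB : in_B f.
Hypothesis f_ge0 : forall z t, (0 <= f z t)%E.
Variables (F : set 'rV[R]_d) (a : 'rV[R]_d).
Hypothesis Fface : is_face (cn mu phi) F.
Hypothesis Fa : relint F a.
Implicit Types (g : Z -> R) (A : set Z) (theta : 'rV[R]_d).
Local Notation D := (in_cl phi F).
Local Notation momentGa := (momentGa mu phi).
Local Notation moment := (moment mu phi).
Local Notation total g := (\int[mu]_z f z (g z))%E.
Local Notation inner g := (\int[mu]_(z in D) f z (g z))%E.
Local Notation outer := (outer_energy mu phi f F).
Local Notation adm := (admissible mu phi f F).
Local Notation feasible := (momentGa a `&` nonneg_fun).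
Local Notation conj theta z := (conjugate (f z) (dotp theta (phi z))).

Definition primal_value := ereal_inf [set total g | g in feasible].

Hypothesis primal_lt : (primal_value < +oo)%E.

Let mD : measurable D := measurable_in_cl phi_meas F.

Lemma feasible_split g : feasible g -> (total g = outer + inner g)%E.
Proof.
move=> gf; apply: integral_split => //; first by case: gf => -[[]].
exact: (feasible_support phi_meas Fface Fa).
Qed.

Lemma primal_ge0 : (0 <= primal_value)%E.
Proof. by apply: le_ereal_inf_tmp => _ [g _ <-]; exact: integral_ge0. Qed.

Lemma primal_fin : primal_value \is a fin_num.
Proof. by rewrite ge0_fin_numE// primal_ge0. Qed.

Lemma primal_le g : feasible g -> (primal_value <= total g)%E.
Proof. by move=> gf; apply: ereal_inf_lbound; exists g. Qed.

Lemma outer_fin : outer \is a fin_num.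
Proof.
have [_ [g gf <-] glt] := ereal_inf_lt primal_lt.
rewrite ge0_fin_numE ?outer_ge0//; apply: le_lt_trans glt.
by rewrite (feasible_split gf) leeDl// inner_ge0.
Qed.

Definition inner_value := fine primal_value - fine outer.

Lemma inner_valueE : inner_value%:E = (primal_value - outer)%E.
Proof. by rewrite EFinB !fineK// ?primal_fin ?outer_fin. Qed.

Lemma inner_value_le g : feasible g -> (inner_value%:E <= inner g)%E.
Proof.
move=> gf; rewrite inner_valueE leeBlDr ?outer_fin// addeC -feasible_split//.
exact: primal_le.
Qed.

(** A change on a null set makes the a.e. properties hold everywhere, as the pointwise maximization
    requires. *)
Lemma normalized_feasible : exists g, [/\ adm g, moment g = a &
  forall z, D z -> f z (g z) \is a fin_num].
Proof.
have [_ [g gf <-] glt] := ereal_inf_lt primal_lt.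
have [[Gg ga] g_ge0] := gf; have [mg _] := Gg.
have gD := feasible_support phi_meas Fface Fa gf.
have mf : measurable_fun setT (fun z => f z (g z)) by exact: in_B_measurable_comp.
have ifg : mu.-integrable setT (fun z => f z (g z)).
  by apply/integrableP; split=> //; under eq_integral do rewrite gee0_abs//.
have aefin := integrable_ae measurableT ifg.
(* The value 1 serves as a point where every member of [Gamma] is finite. *)
pose g' z := if z \in D then (if (f z (g z) < +oo)%E then g z else 1) else 0.
have mg' : measurable_fun setT g'.
  apply: measurable_fun_ifT; [exact: measurable_mem_set| |exact: measurable_cst].
  apply: measurable_fun_ifT => //.
  by apply: measurable_fun_lte => //; exact: measurable_cst.
have gg' : g = g' %[ae mu].
  apply: filterS2 aefin gD => z H1 H2 _; rewrite /g'.
  case: ifPn => [_|/negP nD]; last by apply: H2 => Dz; apply: nD; exact: mem_set.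
  by have := H1 I; rewrite ge0_fin_numE// => ->.
have [Gg' mo] := moment_ae phi_meas mg' gg' Gg.
exists g'; split; last 2 first.
- by rewrite mo.
- move=> z Dz; rewrite /g' mem_set//; case: ifP; first by rewrite ge0_fin_numE.
  by move=> _; apply: (Gamma_pos_fin (fB.2 z)).
split=> //.
- by move=> z; rewrite /g'; case: ifP => // _; case: ifP.
- by move=> z nD; rewrite /g'; case: ifPn => // /set_mem.
- have -> : (inner g' = inner g)%E.
    apply: ae_eq_integral => //; [exact: measurable_integrand|exact: measurable_integrand|].
    by apply: filterS gg' => z H Dz; rewrite H.
  by apply: le_lt_trans glt; rewrite (feasible_split gf) leeDr// outer_ge0.
Qed.

Lemma measurable_conj theta A : measurable_fun A (fun z => conj theta z).
Proof.
by apply: measurable_funTS; apply: measurable_conjugate => //; exact: measurable_dotp.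
Qed.

(** Fenchel's inequality at a feasible function of finite energy bounds the conjugate below by an
    integrable payoff. Only its positive part can then have an infinite integral. *)
Lemma integrable_conj theta : Kfun mu phi F f theta != +oo%E ->
  mu.-integrable D (fun z => conj theta z) /\
  Kfun mu phi F f theta = (\int[mu]_(z in D) conj theta z)%E.
Proof.
rewrite /Kfun /cintegral; case: ifPn => // Kpos _; split=> //.
have [g [ag mga gfin]] := normalized_feasible.
have [Gg g_ge0 gD gI] := ag.
have [ifr _] := integrable_fr fB f_ge0 ag gfin.
have [irg _] := dotp_moment theta Gg.
have irgD : mu.-integrable D (EFin \o (fun z => dotp theta (phi z) * g z)).
  by apply: integrableS irg.
have ipay : mu.-integrable D (EFin \o payoff f (fun z => dotp theta (phi z)) g).
  exact: (integrableB mD irgD ifr).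
pose K z := conj theta z.
have ipos : mu.-integrable D (K^\+)%E.
  apply/integrableP; split.
    by apply: measurable_funepos; exact: measurable_conj.
  under eq_integral do rewrite gee0_abs ?funepos_ge0//.
  by rewrite ltey.
apply: le_integrable (integrableD mD ipos (integrable_abse ipay)) => //.
  exact: measurable_conj.
move=> z Dz.
have lb : ((payoff f (fun z => dotp theta (phi z)) g z)%:E <= conj theta z)%E.
  by rewrite /payoff EFinB fineK ?gfin//; exact: conjugate_ge.
rewrite /= [leRHS]gee0_abs ?adde_ge0 ?funepos_ge0//.
have [K0|K0] := leP 0%E (conj theta z).
  by rewrite gee0_abs// funeposE /K max_l// leeDl.
rewrite lte0_abs// funeposE /K max_r ?(ltW K0)// add0e.
have : conj theta z \is a fin_num.
  by apply: fin_real; rewrite (lt_le_trans _ lb) ?ltNyr//= (lt_trans K0) ?ltry.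
move=> Kf; move: lb K0; rewrite -(fineK Kf) lee_fin lte_fin -EFinN lee_fin => lb K0.
by rewrite -normrN (le_trans _ (ler_norm _))// lerN2.
Qed.

Definition gap theta g z := (f z (g z) + conj theta z - (dotp theta (phi z) * g z)%:E)%E.

Lemma conj_neq_Ny theta z : conj theta z != -oo%E.
Proof.
have := conjugate_ge (f z) (dotp theta (phi z)) 1.
have := Gamma_pos_fin (fB.2 z) ltr01; case: (f z 1) => // r _ H.
by apply: contraTN H => /eqP ->; rewrite -EFinB leeNy_eq.
Qed.

Lemma gap_ge0 theta g z : (0 <= gap theta g z)%E.
Proof.
have := conjugate_ge (f z) (dotp theta (phi z)) (g z).
rewrite /gap sube_ge0 ?fin_num//; have := f_ge0 z (g z).
case: (f z (g z)) => [r| |]//.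
- move=> _; case: (conj theta z) (conj_neq_Ny theta z) => [c| |]// _.
    by rewrite -EFinB -EFinD !lee_fin lerBlDl.
  by rewrite addey ?leey.
- by move=> _ _; rewrite addye ?conj_neq_Ny// leey.
Qed.

Lemma integral_gap theta g : Kfun mu phi F f theta != +oo%E -> feasible g ->
  (total g < +oo)%E ->
  (\int[mu]_(z in D) gap theta g z =
   inner g + Kfun mu phi F f theta - (dotp theta a)%:E)%E.
Proof.
move=> KF gf gfin; have [iK KE] := integrable_conj KF.
have [[Gg ga] g_ge0] := gf.
have gD := feasible_support phi_meas Fface Fa gf.
have [irg Irg] := dotp_moment theta Gg.
have irgD : mu.-integrable D (fun z => (dotp theta (phi z) * g z)%:E).
  by apply: integrableS irg.
have ifg : mu.-integrable D (fun z => f z (g z)).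
  apply/integrableP; split; first by apply: measurable_integrand => //; exact: Gg.1.
  under eq_integral do rewrite gee0_abs//.
  by apply: le_lt_trans gfin; rewrite (feasible_split gf) leeDr// outer_ge0.
rewrite /gap integralB//; last exact: integrableD.
rewrite integralD// -KE; congr (_ - _)%E.
have mr : measurable_fun setT (fun z => (dotp theta (phi z) * g z)%:E).
  by have /integrableP[] := irg.
rewrite -ga -Irg [LHS]integral_mkcond; apply: ae_eq_integral => //.
  by apply/(measurable_restrictT _ mD); exact: measurable_funTS.
apply: filterS gD => z H _; rewrite patchE; case: ifPn => // /negP nD.
by rewrite H ?mulr0// => Dz; apply: nD; exact: mem_set.
Qed.

Lemma inner_value_total g : feasible g -> (total g < +oo)%E ->
  (inner g - inner_value%:E = total g - primal_value)%E.
Proof.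
move=> gf gfin.
have tf : total g \is a fin_num by rewrite ge0_fin_numE// integral_ge0.
have inf : inner g \is a fin_num.
  rewrite ge0_fin_numE ?inner_ge0//; apply: le_lt_trans gfin.
  by rewrite (feasible_split gf) leeDr// outer_ge0.
rewrite /inner_value (feasible_split gf) -(fineK inf) -(fineK outer_fin) -(fineK primal_fin).
by rewrite -EFinD -!EFinB /=; congr EFin; ring.
Qed.

Lemma weak_duality theta : (dual_obj mu phi F f a theta <= inner_value%:E)%E.
Proof.
rewrite /dual_obj; have [->|KF] := eqVneq (Kfun mu phi F f theta) +oo%E.
  by rewrite addeNy leNye.
have [iK KE] := integrable_conj KF.
have Kfin : Kfun mu phi F f theta \is a fin_num by rewrite KE; exact: integrable_fin_num.
rewrite inner_valueE leeBrDr ?outer_fin//.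
apply: le_ereal_inf_tmp => _ [g gf <-].
have [tinf|] := ltP (total g) +oo%E; last by rewrite leye_eq => /eqP ->; rewrite leey.
have : (0 <= \int[mu]_(z in D) gap theta g z)%E by apply: integral_ge0 => z _; exact: gap_ge0.
rewrite (integral_gap KF gf tinf) (feasible_split gf).
have inf : inner g \is a fin_num.
  rewrite ge0_fin_numE ?inner_ge0//; apply: le_lt_trans tinf.
  by rewrite (feasible_split gf) leeDr// outer_ge0.
rewrite -(fineK inf) -(fineK Kfin) -(fineK outer_fin) -!EFinD !lee_fin.
by lra.
Qed.

Lemma dual_attained_value : exists theta, dual_obj mu phi F f a theta = inner_value%:E.
Proof.
have [g0 [ag0 mg0 g0fin]] := normalized_feasible.
have jF_le g : adm g -> moment g = a -> (inner_value%:E <= inner g)%E.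
  by move=> [Gg g_ge0 _ _] mg; apply: inner_value_le.
have [theta [iK leK]] :=
  dual_attained phi_meas fB f_ge0 Fface Fa jF_le ag0 mg0 g0fin.
exists theta; apply/eqP; rewrite eq_le weak_duality /=.
have KE : Kfun mu phi F f theta = (\int[mu]_(z in D) conj theta z)%E.
  rewrite /Kfun /cintegral; case: ifPn => // /eqP.
  by have := integral_funepos_lt_pinfty mD iK => /[swap] ->; rewrite ltxx.
have Kfin : (\int[mu]_(z in D) conj theta z)%E \is a fin_num by exact: integrable_fin_num.
rewrite /dual_obj KE; move: leK; rewrite -(fineK Kfin) -EFinB !lee_fin; lra.
Qed.

Lemma dual_valueE : dual_value mu phi F f a = inner_value%:E.
Proof.
apply/eqP; rewrite eq_le; apply/andP; split.
  by apply: ge_ereal_sup => _ [theta _ <-]; exact: weak_duality.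
have [theta <-] := dual_attained_value.
by apply: ereal_sup_ubound; exists theta.
Qed.

Lemma dual_solution_exists : exists theta, is_dual_solution mu phi F f a theta.
Proof.
have [theta E] := dual_attained_value; exists theta; split; first by rewrite dual_valueE.
by rewrite dual_valueE.
Qed.

Lemma omegaE : omega mu phi F f = outer.
Proof.
rewrite /omega /cintegral.
have -> : (fun z => f z 0)^\+%E = (fun z => f z 0) :> (Z -> \bar R).
  by apply/funext => z; rewrite funeposE max_l.
by case: ifPn => // /eqP E; rewrite /outer_energy E.
Qed.

Lemma strong_duality :
  primal_value = (omega mu phi F f + dual_value mu phi F f a)%E.
Proof.
by rewrite omegaE dual_valueE inner_valueE addeC subeK// outer_fin.
Qed.

Lemma integral_gap_dual theta g : is_dual_solution mu phi F f a theta -> feasible g ->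
  (total g < +oo)%E ->
  (\int[mu]_(z in D) gap theta g z = total g - primal_value)%E.
Proof.
move=> [_]; rewrite dual_valueE /dual_obj => E gf tinf.
have KF : Kfun mu phi F f theta != +oo%E by apply/eqP => KF; rewrite KF in E.
have [iK KE] := integrable_conj KF.
have Kfin : Kfun mu phi F f theta \is a fin_num by rewrite KE; exact: integrable_fin_num.
rewrite integral_gap// -inner_value_total// -E.
have inf : inner g \is a fin_num.
  rewrite ge0_fin_numE ?inner_ge0//; apply: le_lt_trans tinf.
  by rewrite (feasible_split gf) leeDr// outer_ge0.
rewrite -(fineK inf) -(fineK Kfin) -!EFinD; congr EFin; ring.
Qed.

End duality.

(** * Convergence of minimizing sequences *)

Lemma limn_einf_ge0 {R : realType} (u : (\bar R)^nat) : (forall n, (0 <= u n)%E) ->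
  (0 <= limn_einf u)%E.
Proof.
move=> u0; rewrite limn_einf_lim; apply: lime_ge; first exact: is_cvg_einfs.
by apply: nearW => n; apply: le_ereal_inf_tmp => _ [j _ <-].
Qed.

Lemma limn_einf_frequently {R : realType} (u : (\bar R)^nat) : (limn_einf u < +oo)%E ->
  exists M : R, forall N : nat, exists2 j, (N <= j)%N & (u j <= M%:E)%E.
Proof.
move=> lt; apply: contrapT => H.
suff ge (M : R) : (M%:E <= limn_einf u)%E.
  move: lt ge; case: (limn_einf u) => [r| |]// _ ge.
    by have := ge (r + 1); rewrite lee_fin gerDl ler10.
  by have := ge 0.
have [N HN] : exists N : nat, forall j, (N <= j)%N -> (M%:E < u j)%E.
  apply: contrapT => /forallNP HN; apply: H; exists M => N.
  apply: contrapT => HN'; apply: (HN N) => j Nj.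
  by rewrite ltNge; apply/negP => uj; apply: HN'; exists j.
rewrite limn_einf_lim; apply: lime_ge; first exact: is_cvg_einfs.
exists N => // n /= Nn; apply: le_ereal_inf_tmp => _ [j /= nj <-].
by apply/ltW/HN/(leq_trans Nn).
Qed.

Lemma limn_einf_le_bound {R : realType} (u : (\bar R)^nat) (b : \bar R) :
  (forall n, (u n <= b)%E) -> (limn_einf u <= b)%E.
Proof.
move=> ub; rewrite limn_einf_lim; apply: lime_le; first exact: is_cvg_einfs.
apply: nearW => n; apply: le_trans (ub n).
by apply: ereal_inf_lbound; exists n => /=.
Qed.

Lemma nneseries_cvg0 {R : realType} (u : (\bar R)^nat) : (forall n, (0 <= u n)%E) ->
  (\sum_(n <oo) u n < +oo)%E -> u n @[n --> \oo] --> 0%E.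
Proof.
move=> u0 us; have := nneseries_tail_cvg us (fun k _ => u0 k).
apply: squeeze_cvge => //; last exact: cvg_cst.
apply: nearW => n; rewrite u0/=.
have := @nneseries_lim_ge R u xpredT n n.+1 (fun k _ _ => u0 k).
by rewrite big_nat1.
Qed.

Section convergence.
Context {disp : measure_display} {Z : measurableType disp} {R : realType}.
Variable mu : {sigma_finite_measure set Z -> \bar R}.
Context {d : nat}.
Variable phi : Z -> 'rV[R]_d.
Hypothesis phi_meas : forall i, measurable_fun setT (fun z => phi z 0 i).
Variable f : Z -> R -> \bar R.
Hypothesis fB : in_B f.
Hypothesis f_ge0 : forall z t, (0 <= f z t)%E.
Hypothesis f_coercive : forall z (M : R), exists T : R,
  forall t, (f z t <= M%:E)%E -> t <= T.
Variables (F : set 'rV[R]_d) (a : 'rV[R]_d).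
Hypothesis Fface : is_face (cn mu phi) F.
Hypothesis Fa : relint F a.
Implicit Types (g : Z -> R) (A : set Z) (theta : 'rV[R]_d).
Local Notation D := (in_cl phi F).
Local Notation total g := (\int[mu]_z f z (g z))%E.
Local Notation feasible := (momentGa mu phi a `&` nonneg_fun).
Local Notation primal := (primal_value mu phi f a).

Hypothesis primal_lt : (primal < +oo)%E.

Let mD : measurable D := measurable_in_cl phi_meas F.

(* The rates have sum 1, which makes the gaps along a [fast] sequence
   summable. *)
Definition rate (j : nat) : R := 1 / (2 ^ (j + 1))%:R.

Definition fast (gs : nat -> Z -> R) := forall j,
  feasible (gs j) /\ (total (gs j) <= primal + (rate j)%:E)%E.

Lemma rate_gt0 j : 0 < rate j.
Proof. by rewrite divr_gt0// ltr0n expn_gt0. Qed.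

Lemma rate_le1 j : rate j <= 1.
Proof. by rewrite ler_pdivrMr ?ltr0n ?expn_gt0// mul1r ler1n expn_gt0. Qed.

Let pf : primal \is a fin_num.
Proof. exact: primal_fin. Qed.

Lemma fast_lty gs j : fast gs -> (total (gs j) < +oo)%E.
Proof.
by move=> /(_ j)[_] /le_lt_trans; apply; rewrite -(fineK pf) -EFinD ltry.
Qed.

Lemma fast_exists : exists gs, fast gs.
Proof.
have /choice[gs H] : forall j, exists g, feasible g /\ (total g <= primal + (rate j)%:E)%E.
  move=> j; have [_ [g gf <-] glt] := lb_ereal_inf_adherent (rate_gt0 j) pf.
  by exists g; split=> //; exact: ltW.
by exists gs.
Qed.

Lemma fast_gap_cvg0 theta gs : is_dual_solution mu phi F f a theta -> fast gs ->
  {ae mu, forall z, D z -> gap phi f theta (gs j) z @[j --> \oo] --> 0%E}.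
Proof.
move=> dual fgs.
have mgs j : measurable_fun setT (gs j) by have [[[[]]]] := fgs j.
have mgap j : measurable_fun D (gap phi f theta (gs j)).
  apply: emeasurable_funB.
    apply: emeasurable_funD; first exact: measurable_integrand.
    exact: measurable_conj.
  apply/measurable_EFinP/measurable_funTS; apply: measurable_funM => //.
  exact: measurable_dotp.
have gap0 j z : D z -> (0 <= gap phi f theta (gs j) z)%E by move=> _; exact: gap_ge0.
have sum_lty : (\int[mu]_(z in D) (\sum_(j <oo) gap phi f theta (gs j) z) < +oo)%E.
  rewrite (integral_nneseries mu mD mgap gap0).
  apply: (@le_lt_trans _ _ (\sum_(j <oo) (rate j)%:E)%E); last first.
    have := @cvg_geometric_eseries_half R 1 0; rewrite expr0 divr1 => /cvg_lim.
    by rewrite /eseries /rate /= => ->//; rewrite ltry.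
  apply: lee_nneseries => [j _ _|j _].
    by apply: integral_ge0 => z _; exact: gap_ge0.
  rewrite (integral_gap_dual phi_meas fB f_ge0 Fface Fa primal_lt dual (fgs j).1 (fast_lty j fgs)).
  by rewrite leeBlDl// (fgs j).2.
have msum : measurable_fun D (fun z => \sum_(j <oo) gap phi f theta (gs j) z)%E.
  apply: (@ge0_emeasurable_sum _ _ _ _ _ xpredT) => [j z Dz _|j _]; last exact: mgap.
  exact: gap0.
have isum : mu.-integrable D (fun z => \sum_(j <oo) gap phi f theta (gs j) z)%E.
  apply/integrableP; split=> //.
  rewrite (eq_integral (fun z => \sum_(j <oo) gap phi f theta (gs j) z)%E) => // z /set_mem Dz.
  by rewrite gee0_abs//; apply: nneseries_ge0 => n _ _; exact: gap0.
apply: filterS (integrable_ae mD isum) => z H Dz.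
apply: nneseries_cvg0 => [j|]; first exact: gap0.
by rewrite ltey_eq H.
Qed.

(** By Fatou's lemma the lower limit of the energy densities is integrable, hence finite a.e. The
    subsequence of bounded energy depends on [z]. *)
Lemma fast_bounded gs : fast gs ->
  {ae mu, forall z, exists M : R, forall N : nat,
    exists2 j, (N <= j)%N & (f z (gs j z) <= M%:E)%E}.
Proof.
move=> fgs; have mgs j : measurable_fun setT (gs j) by have [[[[]]]] := fgs j.
have mf j : measurable_fun setT (fun z => f z (gs j z)) by exact: in_B_measurable_comp.
have mlim : measurable_fun setT (fun z => limn_einf (fun j => f z (gs j z))).
  rewrite /limn_einf; apply: measurableT_comp => //.
  by apply: measurable_fun_limn_esup => j; exact: measurableT_comp.
have lim0 z : (0 <= limn_einf (fun j => f z (gs j z)))%E by exact: limn_einf_ge0.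
have ilim : mu.-integrable setT (fun z => limn_einf (fun j => f z (gs j z))).
  apply/integrableP; split=> //; under eq_integral do rewrite gee0_abs//.
  have := fatou mu measurableT mf (fun j z _ => f_ge0 z (gs j z)).
  move=> /le_lt_trans; apply.
  apply: (@le_lt_trans _ _ (primal + 1)%E); last by rewrite -(fineK pf) -EFinD ltry.
  apply: limn_einf_le_bound => j; apply: (le_trans (fgs j).2).
  by rewrite leeD2l// lee_fin rate_le1.
apply: filterS (integrable_ae measurableT ilim) => z /(_ I) zfin.
by apply: limn_einf_frequently; rewrite ltey_eq zfin.
Qed.

Lemma fast_cvg theta gs : is_dual_solution mu phi F f a theta -> fast gs ->
  {ae mu, forall z, gs j z @[j --> \oo] --> dual_fun phi F f theta z}.
Proof.
move=> dual fgs.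
have gs0 : {ae mu, forall z, forall j, ~ D z -> gs j z = 0}.
  apply: ae_foralln => j.
  exact: (feasible_support phi_meas Fface Fa (fgs j).1).
have KF : Kfun mu phi F f theta != +oo%E.
  have [fin E] := dual; apply/eqP => KF; move: E fin; rewrite /dual_obj KF addeNy => <-.
  by [].
have [iK _] := integrable_conj phi_meas fB f_ge0 Fface Fa primal_lt KF.
have aeK := integrable_ae mD iK.
have aegap := fast_gap_cvg0 dual fgs.
have aeb := fast_bounded fgs.
apply: filterS2 (filterI gs0 aeK) (filterI aegap aeb) => z [z0 zK] [zgap zb].
rewrite /dual_fun; have [Dz|nDz] := pselect (D z); last first.
  rewrite (_ : (fun j => gs j z) = cst 0); last by apply/funext => j; exact: z0.
  by case: asboolP => [[]|_] //; exact: cvg_cst.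
have [dv cv] := fenchel_gap_cvg (fB.2 z) (f_coercive z) (zK Dz) (zgap Dz) zb.
by case: asboolP => // -[].
Qed.

End convergence.

(** * Convergence locally in measure *)

Lemma cvge0P {R : realType} (u : (\bar R)^nat) : (forall n, (0 <= u n)%E) ->
  (u n @[n --> \oo] --> 0%E) <->
  (forall e : R, 0 < e -> \forall n \near \oo, (u n <= e%:E)%E).
Proof.
move=> u0; split=> [cv e e0|H].
  have : nbhs (0 : \bar R)%E [set x | (x < e%:E)%E].
    by apply: open_nbhs_nbhs; split; [exact: open_ereal_lt_ereal|rewrite /= lte_fin].
  by move=> /cv[N _ H]; exists N => // n Nn; exact/ltW/(H n Nn).
apply/fine_cvgP; split.
  apply: filterS (H 1 ltr01) => n un.
  by rewrite ge0_fin_numE// (le_lt_trans un) ?ltry.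
apply/cvgr0Pnorm_le => e e0; apply: filterS (H e e0) => n un /=.
have uf : u n \is a fin_num by rewrite ge0_fin_numE// (le_lt_trans un) ?ltry.
by rewrite ger0_norm ?fine_ge0// -lee_fin fineK.
Qed.

Lemma lsc_limn_einf {R : realType} (f : R -> \bar R) (u : nat -> R) (t : R) :
  lower_semicontinuous f -> (forall s, (0 <= f s)%E) ->
  u j @[j --> \oo] --> t -> (f t <= limn_einf (fun j => f (u j)))%E.
Proof.
move=> flsc f0 ut; rewrite leNgt; apply/negP => lt.
have L0 := limn_einf_ge0 (fun j => f0 (u j)).
have [y [ly yf]] : exists y : R, (limn_einf (fun j => f (u j)) < y%:E)%E /\ (y%:E < f t)%E.
  move: L0 lt; case: (limn_einf _) => [l _|_|//]; last by rewrite ltNge leey.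
  case: (f t) => [b| |]// lt.
    by exists ((l + b) / 2); move: lt; rewrite !lte_fin => lt; split; lra.
  by exists (l + 1); rewrite lte_fin ltry ltrDl.
have [V nV HV] := flsc _ _ yf.
move: ly; apply/negP; rewrite -leNgt limn_einf_lim.
apply: lime_ge; first exact: is_cvg_einfs.
have [N _ HN] := ut _ nV; exists N => // n /= Nn.
apply: le_ereal_inf_tmp => _ [j /= nj <-].
by apply/ltW/HV/HN/(leq_trans Nn).
Qed.

Section local_convergence.
Context {disp : measure_display} {Z : measurableType disp} {R : realType}.
Variable mu : {sigma_finite_measure set Z -> \bar R}.
Implicit Types (gs : nat -> Z -> R) (g : Z -> R).

Lemma measurable_dist_gt g g' (Y : set Z) (e : R) : measurable Y ->
  measurable_fun setT g -> measurable_fun setT g' ->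
  measurable (Y `&` [set z | `|g z - g' z| > e]).
Proof.
move=> mY mg mg'; apply: measurableI => //; rewrite -[X in measurable X]setTI.
have := @measurable_fun_ltr _ _ _ setT (cst e) (fun z => `|g z - g' z|) (measurable_cst _).
move=> /(_ _ measurableT [set true] I); apply.
by apply: measurableT_comp => //; exact: measurable_funB.
Qed.

Lemma ae_cvg_locally_in_measure gs g : (forall n, measurable_fun setT (gs n)) ->
  measurable_fun setT g -> {ae mu, forall z, gs n z @[n --> \oo] --> g z} ->
  cvg_locally_in_measure mu gs g.
Proof.
move=> mgs mg ae Y e mY Yfin e0; apply/cvge0P => // eps eps0.
have aeY : \forall z \ae mu, Y z -> gs n z @[n --> \oo] --> g z.
  by apply: filterS ae => z H _; exact: H.
have [B [mB Beps unif]] := ae_pointwise_almost_uniform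
  (fun n => measurable_funTS (mgs n)) (measurable_funTS mg) mY Yfin aeY eps0.
have nb : nbhs (g : {uniform` (Y `\` B) -> R})
    [set h | forall z, (Y `\` B) z -> `|g z - h z| < e].
  apply/uniform_nbhs; exists [set xy | ball xy.1 e xy.2]; split=> //.
  exact: (entourage_ball R (PosNum e0)).
have : \forall n \near \oo, forall z, (Y `\` B) z -> `|g z - gs n z| < e by exact: unif nb.
apply: filterS => n H; apply: (le_trans _ (ltW Beps)); apply: le_measure; [exact/mem_set/measurable_dist_gt|exact: mem_set|].
move=> z [Yz /= dz]; apply: contrapT => nB.
by have := H z (conj Yz nB); rewrite distrC ltNge (ltW dz).
Qed.

Lemma cvg_locally_unique gs g g' : (forall n, measurable_fun setT (gs n)) ->
  measurable_fun setT g -> measurable_fun setT g' ->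
  cvg_locally_in_measure mu gs g -> cvg_locally_in_measure mu gs g' -> g = g' %[ae mu].
Proof.
move=> mgs mg mg' cg cg'.
have [S [ST _ Sfin]] := (sigma_finiteP setT mu).1 (sigma_finiteT mu).
pose e k : R := k.+1%:R^-1.
have e0 k : 0 < e k by rewrite invr_gt0.
have e20 k : 0 < e k / 2 by rewrite divr_gt0.
have neg n k : mu.-negligible (S n `&` [set z | `|g z - g' z| > e k]).
  have mS := (Sfin n).1.
  apply/negligibleP; first exact: measurable_dist_gt.
  apply/eqP; rewrite eq_le measure_ge0 andbT; apply/lee_addgt0Pr => eps eps0.
  rewrite add0e.
  have eps20 : 0 < eps / 2 by rewrite divr_gt0.
  have c1 := (cvge0P (fun j => measure_ge0 mu _)).1 (cg _ _ mS (Sfin n).2 (e20 k)) _ eps20.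
  have c2 := (cvge0P (fun j => measure_ge0 mu _)).1 (cg' _ _ mS (Sfin n).2 (e20 k)) _ eps20.
  have [j [h1 h2]] := filter_ex (filterI c1 c2).
  have m1 := measurable_dist_gt (e k / 2) mS (mgs j) mg.
  have m2 := measurable_dist_gt (e k / 2) mS (mgs j) mg'.
  apply: (@le_trans _ _ (mu ((S n `&` [set z | `|gs j z - g z| > e k / 2]) `|`
      (S n `&` [set z | `|gs j z - g' z| > e k / 2])))).
    apply: le_measure; [exact/mem_set/measurable_dist_gt|exact/mem_set/measurableU|].
    move=> z [Sz /= dz].
    have [h|h] := ltP (e k / 2) `|gs j z - g z|; first by left.
    right; split=> //=; rewrite ltNge; apply/negP => h'.
    move: dz; apply/negP; rewrite -leNgt (le_trans (ler_distD (gs j z) _ _))//.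
    by rewrite [e k](splitr (e k)) lerD// distrC.
  apply: (le_trans (measureU2 _ m1 m2)).
  by rewrite [eps in leRHS]splitr EFinD leeD.
have negU : mu.-negligible (\bigcup_n \bigcup_k (S n `&` [set z | `|g z - g' z| > e k])).
  by apply: negligible_bigcup => n; apply: negligible_bigcup => k.
apply: negligibleS negU => z /= ne.
have [n _ Sn] : (\bigcup_i S i) z by rewrite -ST.
exists n => //.
have d0 : 0 < `|g z - g' z| by rewrite normr_gt0 subr_eq0; apply/eqP.
exists (Num.truncn (`|g z - g' z|^-1)) => //; split=> //=.
rewrite /e invf_plt ?posrE//; exact: truncnS_gt.
Qed.

End local_convergence.

(** * Projections and the effective dual solution *)

Section projections.
Context {disp : measure_display} {Z : measurableType disp} {R : realType}.
Variable mu : {sigma_finite_measure set Z -> \bar R}.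
Context {d : nat}.
Variable phi : Z -> 'rV[R]_d.
Hypothesis phi_meas : forall i, measurable_fun setT (fun z => phi z 0 i).
Variable f : Z -> R -> \bar R.
Hypothesis fB : in_B f.
Hypothesis f_ge0 : forall z t, (0 <= f z t)%E.
Hypothesis f_coercive : forall z (M : R), exists T : R,
  forall t, (f z t <= M%:E)%E -> t <= T.
Variables (F : set 'rV[R]_d) (a : 'rV[R]_d).
Hypothesis Fface : is_face (cn mu phi) F.
Hypothesis Fa : relint F a.
Implicit Types (g : Z -> R) (gs : nat -> Z -> R).
Local Notation total g := (\int[mu]_z f z (g z))%E.
Local Notation feasible := (momentGa mu phi a `&` nonneg_fun).
Local Notation primal := (primal_value mu phi f a).
Local Notation fast := (fast mu phi f a).
Hypothesis primal_lt : (primal < +oo)%E.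

Let pf : primal \is a fin_num.
Proof. exact: primal_fin. Qed.

Lemma fast_measurable gs : fast gs -> forall j, measurable_fun setT (gs j).
Proof. by move=> fgs j; have [[[[]]]] := fgs j. Qed.

(** One fast sequence converges a.e. to [dual_fun] of every dual solution. Its upper limit is
    therefore a measurable version common to all of them, and no measurability of the derivative of
    the conjugate has to be shown. *)
Lemma effective_exists : exists g, is_effective_dual_solution mu phi F f a g.
Proof.
have [gs fgs] := fast_exists f_ge0 primal_lt.
exists (fun z => fine (limn_esup (fun j => (gs j z)%:E))); split.
- apply: measurableT_comp => //; apply: measurable_fun_limn_esup => j.
  by apply/measurable_EFinP; exact: fast_measurable.
- exact: (dual_solution_exists phi_meas fB f_ge0 Fface Fa primal_lt).
- move=> theta dual.
  have := fast_cvg phi_meas fB f_ge0 f_coercive Fface Fa primal_lt dual fgs.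
  apply: filterS => z cv /=.
  have cvE : (gs j z)%:E @[j --> \oo] --> (dual_fun phi F f theta z)%:E.
    by apply: cvg_EFin; first exact: nearW.
  by rewrite (cvg_limn_einf_sup cvE).2.
Qed.

Variable gstar : Z -> R.
Hypothesis gstarP : is_effective_dual_solution mu phi F f a gstar.

Let mgstar : measurable_fun setT gstar. Proof. by case: gstarP. Qed.

Lemma fast_cvg_effective gs : fast gs ->
  {ae mu, forall z, gs j z @[j --> \oo] --> gstar z}.
Proof.
move=> fgs; have [_ [theta dual] eqs] := gstarP.
have cv := fast_cvg phi_meas fB f_ge0 f_coercive Fface Fa primal_lt dual fgs.
by apply: filterS2 cv (eqs _ dual) => z H ->.
Qed.

Lemma rate_archimedean (e : R) n : 0 < e -> exists2 m, (n <= m)%N & (rate m : R) <= e.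
Proof.
move=> e0; exists (maxn n (Num.truncn e^-1).+1); first exact: leq_maxl.
rewrite /rate ler_pdivrMr ?ltr0n ?expn_gt0// mulrC -ler_pdivrMr// div1r.
rewrite (le_trans (ltW (truncnS_gt e^-1)))// ler_nat.
apply: (leq_trans (leq_maxr n _)); apply: ltnW.
by apply: (leq_trans (ltn_expl _ (isT : (1 < 2)%N))); rewrite leq_exp2l// leq_addr.
Qed.

(** The indices [k] need not increase, since [fast] restricts only the energies. The predicate [P]
    will single out the terms that violate convergence. *)
Lemma minimizing_fast gs (P : nat -> Prop) : (forall n, feasible (gs n)) ->
  total (gs n) @[n --> \oo] --> primal ->
  (forall N, exists2 n, (N <= n)%N & P n) ->
  exists k : nat -> nat, fast (gs \o k) /\ forall j, P (k j).
Proof.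
move=> gf cv Pinf.
have ev j : \forall n \near \oo, (total (gs n) <= primal + ((rate j : R))%:E)%E.
  have : nbhs primal [set x | (x < primal + ((rate j : R))%:E)%E].
    apply: open_nbhs_nbhs; split; first exact: open_ereal_lt_ereal.
    by rewrite /= -(fineK pf) -EFinD lte_fin ltrDl rate_gt0.
  by move=> /cv[N _ H]; exists N => // n Nn; exact/ltW/(H n Nn).
have /choice[k Hk] : forall j, exists n, P n /\ (total (gs n) <= primal + ((rate j : R))%:E)%E.
  move=> j; have [N _ HN] := ev j; have [n Nn Pn] := Pinf N.
  by exists n; split=> //; exact: HN.
by exists k; split=> [j|j]; [split; [exact: gf|exact: (Hk j).2]|exact: (Hk j).1].
Qed.

(** Terms violating the convergence infinitely often would contain a fast sequence, which converges
    a.e. and hence locally in measure. *)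
Lemma minimizing_cvg gs : (forall n, feasible (gs n)) ->
  total (gs n) @[n --> \oo] --> primal -> cvg_locally_in_measure mu gs gstar.
Proof.
move=> gf cv Y e mY Yfin e0; apply/cvge0P => // eps eps0.
apply: contrapT => nev.
pose P n := ~ (mu (Y `&` [set z | (`|gs n z - gstar z| > e)%R]) <= eps%:E)%E.
have Pinf N : exists2 n, (N <= n)%N & P n.
  apply: contrapT => H; apply: nev; exists N => // n /= Nn.
  by apply: contrapT => Pn; apply: H; exists n.
have [k [fk Pk]] := minimizing_fast gf cv Pinf.
have := ae_cvg_locally_in_measure (fast_measurable fk) mgstar (fast_cvg_effective fk).
move=> /(_ Y e mY Yfin e0) /(cvge0P (fun j => measure_ge0 mu _)).1 /(_ eps eps0).
by move=> /filter_ex[j] /Pk.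
Qed.

Lemma fast_minimizing gs : fast gs -> total (gs n) @[n --> \oo] --> primal.
Proof.
move=> fgs.
have cvr : (primal + ((rate n : R))%:E)%E @[n --> \oo] --> (primal + 0)%E.
  apply: cvgeD; [by rewrite fin_num_adde_defr|exact: cvg_cst|].
  apply/cvge0P => [n|e e0]; first by rewrite lee_fin ltW// rate_gt0.
  have [m _ me] := rate_archimedean 0 e0.
  exists m => // n /= mn; rewrite lee_fin (le_trans _ me)//.
  rewrite /rate !div1r lef_pV2 ?posrE ?ltr0n ?expn_gt0// ler_nat leq_exp2l//.
  by rewrite leq_add2r.
rewrite adde0 in cvr.
apply: (squeeze_cvge _ (cvg_cst primal) cvr).
by apply: nearW => n; rewrite (primal_le f (fgs n).1) (fgs n).2.
Qed.

(** The constant sequence at a minimizer is fast, so its a.e. limit is [gstar]. *)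
Lemma minimizer_effective g : feasible g -> (forall g', feasible g' -> (total g <= total g')%E) ->
  g = gstar %[ae mu].
Proof.
move=> gf gmin.
have fg : fast (fun=> g).
  move=> j; split=> //; apply: (@le_trans _ _ primal).
    by apply: le_ereal_inf_tmp => _ [g' g'f <-]; exact: gmin.
  by rewrite leeDl// lee_fin ltW// rate_gt0.
apply: filterS (fast_cvg_effective fg) => z cv.
have cvc : g z @[_ --> \oo] --> g z by exact: cvg_cst.
by rewrite -(cvg_lim (@Rhausdorff R) cv) -[LHS](cvg_lim (@Rhausdorff R) cvc).
Qed.

(** Lower semicontinuity and Fatou's lemma along a fast sequence bound the energy of the limit by
    the primal value. The moment is assumed because it may change in an a.e. limit. *)
Lemma effective_minimizer : momentGa mu phi a gstar ->
  exists g, feasible g /\ forall g', feasible g' -> (total g <= total g')%E.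
Proof.
move=> [Ggs ma]; have [gs fgs] := fast_exists f_ge0 primal_lt.
have cv := fast_cvg_effective fgs.
(* As a limit of nonnegative functions [gstar] is nonnegative only a.e., while feasibility asks for
   it everywhere. *)
pose g z := Num.max (gstar z) 0.
have mg : measurable_fun setT g by apply: measurable_maxr.
have gE : gstar = g %[ae mu].
  apply: filterS cv => z cvz; rewrite /g max_l//.
  by apply: (cvgr_to_ge cvz); apply: nearW => j; exact: (fgs j).1.2.
have [Gg mo] := moment_ae phi_meas mg gE Ggs.
exists g; split.
  by split; [split=> //; rewrite mo|move=> z; rewrite /g le_max lexx orbT].
suff le : (total g <= primal)%E.
  by move=> g' g'f; apply: (le_trans le); exact: primal_le.
have mf j : measurable_fun setT (fun z => f z (gs j z)).
  by apply: in_B_measurable_comp => //; exact: fast_measurable.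
apply: (@le_trans _ _ (\int[mu]_z limn_einf (fun j => f z (gs j z)))%E).
  have -> : (total g = \int[mu]_z f z (gstar z))%E.
    apply: ae_eq_integral => //; [exact: in_B_measurable_comp|exact: in_B_measurable_comp|].
    by apply: filterS gE => z E _; rewrite E.
  apply: ae_ge0_le_integral => //.
  - exact: in_B_measurable_comp.
  - by move=> z _; exact: limn_einf_ge0.
  - rewrite /limn_einf; apply: measurableT_comp => //.
    by apply: measurable_fun_limn_esup => j; exact: measurableT_comp.
  - apply: filterS cv => z cvz _.
    by apply: lsc_limn_einf cvz => //; exact: Gamma_lsc (fB.2 z).
apply: (le_trans (fatou mu measurableT mf (fun j z _ => f_ge0 z (gs j z)))).
rewrite limn_einf_lim; apply: lime_le; first exact: is_cvg_einfs.
(* The infimum of the tail from [n] is at most any of its terms, and a late one is within [e] of the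
   primal value. *)
apply: nearW => n; apply/lee_addgt0Pr => e e0.
have [m nm me] := rate_archimedean n e0.
apply: (@le_trans _ _ (total (gs m))).
  by apply: ereal_inf_lbound; exists m.
by apply: (le_trans (fgs m).2); rewrite leeD2l// lee_fin.
Qed.

End projections.

Unset Implicit Arguments.

Theorem theorem8p2 (disp : measure_display) (Z : measurableType disp)
  (R : realType) (mu : {sigma_finite_measure set Z -> \bar R})
  (d : nat) (phi : Z -> 'rV[R]_d)
  (phi_meas : forall i, measurable_fun setT (fun z => phi z 0 i))
  (beta : Z -> R -> \bar R) (beta_B : in_B beta)
  (h : Z -> R) (h_meas : measurable_fun setT h) (h_ge0 : forall z, 0 <= h z)
  (h_gt0 : forall z, right_deriv (beta z) 0 = -oo%E -> 0 < h z)
  (a : 'rV[R]_d) (a_dom : domJ mu phi beta h a) :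
  let F := face_at (cn mu phi) a in
  let betah := bregman_integrand beta h in
  [/\ (exists theta, is_dual_solution mu phi F betah a theta) /\
      Jval mu phi beta h a =
        (omega mu phi F betah + dual_value mu phi F betah a)%E,
      exists gstar, is_effective_dual_solution mu phi F betah a gstar
    & forall gstar, is_effective_dual_solution mu phi F betah a gstar ->
      (((exists g, is_bregman_projection mu phi beta h a g) <->
         momentGa mu phi a gstar) /\
       (forall g, is_bregman_projection mu phi beta h a g ->
         g = gstar %[ae mu])) /\
      ((exists ghat, is_generalized_bregman_projection mu phi beta h a ghat) /\
       (forall ghat, is_generalized_bregman_projection mu phi beta h a ghat ->
         ghat = gstar %[ae mu]))].
Proof.
move=> F betah.
have fB : in_B betah by exact: bregman_integrand_B.
have f_ge0 z t : (0 <= betah z t)%E.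
  by apply: bregman_delta_ge0 => //; [exact: beta_B.2|exact: h_gt0].
have f_coercive z (M : R) : exists T : R, forall t, (betah z t <= M%:E)%E -> t <= T.
  apply: (Gamma_coercive (fB.2 z) (f_ge0 z) (_ : betah z (h z) = 0%E)).
  by apply: bregman_deltaxx => //; [exact: beta_B.2|exact: h_gt0].
have BE g : bregman_distance mu beta g h = (\int[mu]_z betah z (g z))%E.
  rewrite /bregman_distance /cintegral.
  have -> : ((fun z => bregman_delta (beta z) (g z) (h z))^\+ =
      fun z => bregman_delta (beta z) (g z) (h z))%E.
    by apply/funext => z; rewrite funeposE max_l// f_ge0.
  by case: ifPn => // /eqP <-.
have JE : Jval mu phi beta h a = primal_value mu phi betah a.
  by rewrite /Jval /primal_value; under eq_imagel do rewrite BE.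
have primal_lt : (primal_value mu phi betah a < +oo)%E by rewrite -JE.
have Ca : cn mu phi a.
  by have [_ [g [[Gg ga] g_ge0] _] _] := ereal_inf_lt a_dom; exists g.
have [Fface Fa] := face_atP Ca.
split.
- split; first exact: (dual_solution_exists phi_meas fB f_ge0 Fface Fa primal_lt).
  by rewrite JE; exact: (strong_duality phi_meas fB f_ge0 Fface Fa primal_lt).
- exact: (effective_exists phi_meas fB f_ge0 f_coercive Fface Fa primal_lt).
move=> gstar gstarP.
have mgstar : measurable_fun setT gstar by case: gstarP.
have minP g : is_bregman_projection mu phi beta h a g -> g = gstar %[ae mu].
  move=> [gf gmin].
  apply: (minimizer_effective phi_meas fB f_ge0 f_coercive Fface Fa primal_lt gstarP gf).
  by move=> g' /gmin; rewrite !BE.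
have genP : is_generalized_bregman_projection mu phi beta h a gstar.
  split=> // gs gf; rewrite JE => cv.
  apply: (minimizing_cvg phi_meas fB f_ge0 f_coercive Fface Fa primal_lt gstarP gf).
  by under eq_fun do rewrite -BE.
split; split.
- split=> [[g gproj]|mgs].
    have [[Gg ga] _] := gproj.1.
    have [Ggs ms] := moment_ae phi_meas mgstar (minP g gproj) Gg.
    by split=> //; rewrite ms.
  have [g [gf gmin]] :=
    effective_minimizer phi_meas fB f_ge0 f_coercive Fface Fa primal_lt gstarP mgs.
  by exists g; split=> // g' /gmin; rewrite !BE.
- exact: minP.
- by exists gstar.
- move=> ghat [mghat ghatP].
  (* The existence of a minimizing sequence keeps the defining condition of [ghat] from being
     vacuous: [ghat] and [gstar] are limits of the same sequence. *)
  have [gs fgs] := fast_exists f_ge0 primal_lt.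
  have gf n : (momentGa mu phi a `&` nonneg_fun) (gs n) by exact: (fgs n).1.
  have cv : bregman_distance mu beta (gs n) h @[n --> \oo] --> Jval mu phi beta h a.
    under eq_fun do rewrite BE; rewrite JE; exact: fast_minimizing.
  apply: (cvg_locally_unique (fast_measurable fgs) mghat mgstar).
    exact: ghatP.
  by case: genP => _; apply.
Qed.
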